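(* Let $(K,S,\{F_i\}_{i\in S})$ be a generalized Sierpiński carpet and assume that $p>\dim_{\mathrm{ARC}}(K,d)$. Let $\beta_p:=\log(N_*\rho_p)/\log a$. Then the space $\mathcal F_p=\{f\in L^p(K,\mu): \sup_{n\ge1}\rho_p^{\,n}\,\mathcal E_p^{G_n}(M_nf)<\infty\}$ has the following expression: $$\mathcal F_p=\Biggl\{f\in L^p(K,\mu)\ \mid\ \limsup_{r\downarrow0}\int_K\frac{1}{\mu(B_d(x,r))}\int_{B_d(x,r)}\frac{|f(x)-f(y)|^p}{r^{\beta_p}}\,d\mu(y)\,d\mu(x)<\infty\Biggr\}.$$
   Context: Generalized Sierpiński carpet. Let $D,a\in\mathbb N$ with $D\ge2$, $a\ge3$; $Q_0=[-1,1]^D$; $\emptyset\neq S\subsetneq\{0,1,\dots,a-1\}^D$; $\mathbf e_1,\dots,\mathbf e_D$ the standard basis of $\mathbb R^D$. For $i\in\{0,\dots,a-1\}^D$ let $f_i(x)=a^{-1}x+2a^{-1}i-(a-1)a^{-1}\sum_{j=1}^D\mathbf e_j$, $Q_1=\bigcup_{i\in S}f_i(Q_0)$, let $K$ be the unique non-empty compact subset of $\mathbb R^D$ with $K=\bigcup_{i\in S}f_i(K)$, and $F_i=f_i|_K$. The triple $(K,S,\{F_i\}_{i\in S})$ is a generalized Sierpiński carpet if: (GSC1) $f(Q_1)=Q_1$ for every isometry $f$ of $\mathbb R^D$ with $f(Q_0)=Q_0$; (GSC2) $Q_1$ is connected; (GSC3) $\mathrm{int}_{\mathbb R^D}\bigl(Q_1\cap\prod_{k=1}^D[2(i_k-\varepsilon_k)a^{-1}-1,\,2(i_k+1)a^{-1}-1]\bigr)$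 is either empty or connected for all $(i_k)\in\mathbb Z^D$, $(\varepsilon_k)\in\{0,1\}^D$; (GSC4) $[-1,1]\times\{1\}^{D-1}\subset Q_1$. Metric and measure: $d(x,y)=\frac{1}{2\sqrt D}|x-y|_{\mathbb R^D}$ on $K$; $B_d(x,r)=\{y\in K:d(x,y)<r\}$; $N_*=\#S$; $\mu$ is the self-similar Borel probability measure on $K$ with equal weights, $\mu(A)=N_*^{-1}\sum_{i\in S}\mu(F_i^{-1}(A))$. Words and graphs: $W_n=S^n$ ($n\ge1$), $W_\#=\bigcup_{n\ge1}W_n$, $|w|=n$ for $w\in W_n$; for $w=w_1\cdots w_n$, $F_w=F_{w_1}\circ\cdots\circ F_{w_n}$, $K_w=F_w(K)$; words are concatenated as $vw$, and $v\cdot W_n=\{vw: w\in W_n\}$. $G_n=(W_n,E_n)$ with $E_n=\{(v,w)\in W_n^2: v\ne w,\ K_v\cap K_w\ne\emptyset\}$; $d_{G_n}$ is its graph distance. For $w\in W_m$, $\mathcal B_n(w,1)=\bigcup_{v\in W_m,\,d_{G_m}(v,w)\le1}v\cdot W_n\subseteq W_{n+m}$. Energies: for a finite graph $G=(V,E)$ (with $E$ a symmetric set of ordered pairs) and $f:V\to\mathbb R$, $\mathcal E_p^G(f)=\frac12\sum_{(x,y)\in E}|f(x)-f(y)|^p$; for disjoint $A,B\subseteq V$, $\mathcal C_p^G(A,B)=\inf\{\mathcal E_p^G(f): f|_A\equiv1,\ f|_B\equiv0\}$. Set $\mathcal C_p^{(n)}=\sup_{w\in W_\#}\mathcal C_p^{G_{n+|w|}}\bigl(w\cdot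 W_n,\ W_{n+|w|}\setminus\mathcal B_n(w,1)\bigr)$ and $\rho_p^{-1}=\lim_{n\to\infty}(\mathcal C_p^{(n)})^{1/n}$ (the limit exists and $\rho_p\in(0,\infty)$). For $f\in L^p(K,\mu)$, $M_nf(w)=N_*^n\int_{K_w}f\,d\mu$, $w\in W_n$. Ahlfors regular conformal dimension: two compatible metrics $d_1,d_2$ on $K$ are quasisymmetric to each other if there is a homeomorphism $\eta:[0,\infty)\to[0,\infty)$ with $d_2(x,y)/d_2(x,z)\le\eta(d_1(x,y)/d_1(x,z))$ for all $x,y,z\in K$, $x\neq z$. A metric $d'$ is $\alpha'$-Ahlfors regular if for some Borel regular measure $\nu$ and $C\ge1$, $C^{-1}r^{\alpha'}\le\nu(B_{d'}(x,r))\le Cr^{\alpha'}$ for all $x$ and $0<r<\mathrm{diam}(K,d')$. $\dim_{\mathrm{ARC}}(K,d)$ is the infimum of $\alpha'>0$ such that some metric on $K$ is quasisymmetric to $d$ and $\alpha'$-Ahlfors regular. *)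

(* Defs.v *)
From HB Require Import structures.
From mathcomp Require Import all_boot all_order all_algebra.
From mathcomp Require Import all_classical all_reals all_analysis.

Set Implicit Arguments.
Unset Strict Implicit.
Unset Printing Implicit Defensive.

Import Order.TTheory GRing.Theory Num.Theory.
Import numFieldNormedType.Exports.

Local Open Scope classical_set_scope.
Local Open Scope ring_scope.

Definition is_metric (R : realType) (T : Type) (d : T -> T -> R) : Prop :=
  [/\ forall x y, 0 <= d x y,
      forall x y, d x y = 0 <-> x = y,
      forall x y, d x y = d y x &
      forall x y z, d x z <= d x y + d y z].

Definition mball (R : realType) (T : Type) (d : T -> T -> R) (x : T) (r : R)
  : set T := [set y | d x y < r].

Definition compatible (R : realType) (T : topologicalType) (d : T -> T -> R)
  : Prop :=
  forall x (A : set T), nbhs x A <-> exists2 e : R, 0 < e & mball d x e `<=` A.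

Definition homeo_half_line (R : realType) (eta : R -> R) : Prop :=
  exists zeta : R -> R,
    [/\ forall t, 0 <= t -> 0 <= eta t /\ zeta (eta t) = t,
        forall t, 0 <= t -> 0 <= zeta t /\ eta (zeta t) = t,
        {within `[0, +oo[, continuous eta} &
        {within `[0, +oo[, continuous zeta}].

Definition quasisymmetric (R : realType) (T : Type) (d1 d2 : T -> T -> R)
  : Prop :=
  exists2 eta : R -> R, homeo_half_line eta &
    forall x y z, x <> z -> d2 x y / d2 x z <= eta (d1 x y / d1 x z).

(* A Borel regular measure is an outer measure for which Borel sets are
   Caratheodory measurable and every set has a Borel hull of equal measure. *)
Definition borel_regular (R : realType) (T : topologicalType)
    (nu : {outer_measure set T -> \bar R}) : Prop :=
  (<<s @open T >> `<=` caratheodory_measurable nu) /\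
  (forall A, exists B, [/\ <<s @open T >> B, A `<=` B & nu B = nu A]).

Definition ahlfors_regular (R : realType) (T : topologicalType)
    (d : T -> T -> R) (alpha : R) : Prop :=
  exists (nu : {outer_measure set T -> \bar R}) (C : R),
    [/\ borel_regular nu, 1 <= C &
      forall x (r : R), 0 < r ->
        (r%:E < ereal_sup [set (d u.1 u.2)%:E | u in [set: T * T]])%E ->
        ((C^-1 * r `^ alpha)%:E <= nu (mball d x r) <= (C * r `^ alpha)%:E)%E].

Definition dimARC (R : realType) (T : topologicalType) (d : T -> T -> R)
  : \bar R :=
  ereal_inf [set alpha%:E | alpha in [set alpha : R | 0 < alpha /\
    exists d' : T -> T -> R,
      [/\ is_metric d', compatible d', quasisymmetric d d' &
          ahlfors_regular d' alpha]]].

Definition energy (R : realType) (p : R) (V : finType) (E : rel V) (f : V -> R)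
  : R :=
  2^-1 * \sum_(u : V * V | E u.1 u.2) `|f u.1 - f u.2| `^ p.

Definition capacity (R : realType) (p : R) (V : finType) (E : rel V)
    (A B : {set V}) : \bar R :=
  ereal_inf [set (energy p E f)%:E | f in [set f : V -> R |
    (forall x, x \in A -> f x = 1) /\ (forall x, x \in B -> f x = 0)]].

(* [+oo] between points in different components *)
Definition graph_dist (R : realType) (V : finType) (E : rel V) (x y : V)
  : \bar R :=
  ereal_inf [set (size s)%:R%:E | s in [set s | path E x s /\ last x s = y]].

Definition multi_index (D a : nat) := {ffun 'I_D -> 'I_a}.

Definition enorm (R : realType) (D : nat) (x : 'rV[R]_D) : R :=
  Num.sqrt (\sum_k x 0 k ^+ 2).

Definition Q0 (R : realType) (D : nat) : set 'rV[R]_D :=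
  [set x | forall k, -1 <= x 0 k <= 1].
Arguments Q0 : clear implicits.

Definition simil (R : realType) (D a : nat) (i : multi_index D a) (x : 'rV[R]_D)
  : 'rV[R]_D :=
  a%:R^-1 *: x + (2 * a%:R^-1) *: (\row_k (i k)%:R)
  - ((a%:R - 1) * a%:R^-1) *: \sum_(j < D) delta_mx 0 j.

Definition Q1 (R : realType) (D a : nat) (S : {set multi_index D a})
  : set 'rV[R]_D :=
  \bigcup_(i in [set` S]) (simil i @` Q0 R D).
Arguments Q1 R {D a} S.

Definition isometry (R : realType) (D : nat) (f : 'rV[R]_D -> 'rV[R]_D)
  : Prop :=
  forall x y, enorm (f x - f y) = enorm (x - y).

Definition GSC1 (R : realType) (D a : nat) (S : {set multi_index D a}) : Prop :=
  forall f : 'rV[R]_D -> 'rV[R]_D,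
    isometry f -> f @` Q0 R D = Q0 R D -> f @` Q1 R S = Q1 R S.
Arguments GSC1 R {D a} S.

Definition GSC2 (R : realType) (D a : nat) (S : {set multi_index D a}) : Prop :=
  connected (Q1 R S).
Arguments GSC2 R {D a} S.

Definition GSC3_block (R : realType) (D a : nat) (i : 'I_D -> int)
    (eps : 'I_D -> bool) : set 'rV[R]_D :=
  [set x | forall k,
    2 * (i k - (eps k)%:Z)%:~R * a%:R^-1 - 1 <= x 0 k
      <= 2 * (i k + 1)%:~R * a%:R^-1 - 1].
Arguments GSC3_block R {D} a i eps.

Definition GSC3 (R : realType) (D a : nat) (S : {set multi_index D a}) : Prop :=
  forall (i : 'I_D -> int) (eps : 'I_D -> bool),
    (Q1 R S `&` GSC3_block R a i eps)° = set0 \/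
    connected (Q1 R S `&` GSC3_block R a i eps)°.
Arguments GSC3 R {D a} S.

Definition GSC4 (R : realType) (D a : nat) (S : {set multi_index D a}) : Prop :=
  [set x : 'rV[R]_D | forall k : 'I_D,
    (k = 0%N :> nat -> -1 <= x 0 k <= 1) /\
    (k <> 0%N :> nat -> x 0 k = 1)] `<=` Q1 R S.
Arguments GSC4 R {D a} S.

Definition attractor (R : realType) (D a : nat) (S : {set multi_index D a})
    (K : set 'rV[R]_D) : Prop :=
  [/\ K !=set0, compact K & K = \bigcup_(i in [set` S]) (simil i @` K)].

Record gen_carpet (R : realType) (D a : nat) (S : {set multi_index D a})
    (K : set 'rV[R]_D) : Prop := GenCarpet {
  carpet_dim : (2 <= D)%N ;
  carpet_scale : (3 <= a)%N ;
  carpet_nonempty : S != finset.set0 ;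
  carpet_proper : S \proper [set: multi_index D a]%SET ;
  carpet_attractor : attractor S K ;
  carpet_gsc1 : GSC1 R S ;
  carpet_gsc2 : GSC2 R S ;
  carpet_gsc3 : GSC3 R S ;
  carpet_gsc4 : GSC4 R S
}.

Definition dcarpet (R : realType) (D : nat) (x y : 'rV[R]_D) : R :=
  (2 * Num.sqrt D%:R)^-1 * enorm (x - y).

Definition dcarpet_on (R : realType) (D : nat) (K : set 'rV[R]_D) (x y : K)
  : R := dcarpet (set_val x) (set_val y).

Definition Bd (R : realType) (D : nat) (K : set 'rV[R]_D) (x : 'rV[R]_D)
    (r : R) : set 'rV[R]_D :=
  [set y | K y /\ dcarpet x y < r].

(* ['rV[R]_D] with its Borel sigma-algebra *)
Definition borelRV (R : realType) (D : nat) :=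
  g_sigma_algebraType (@open 'rV[R]_D).

(* Borel measures on the compact set [K] are represented by Borel measures on
   the ambient space that are concentrated on [K]; [F_i^-1(A)] is then
   [K `&` f_i^-1(A)], since the domain of [F_i] is [K]. *)
Definition self_similar (R : realType) (D a : nat) (S : {set multi_index D a})
    (K : set 'rV[R]_D) (mu : probability (borelRV R D) R) : Prop :=
  mu K = 1%E /\
  forall A : set (borelRV R D), measurable A ->
    mu A = (#|S|%:R^-1%:E *
            \sum_(i in S) mu (K `&` @simil R D a i @^-1` A))%E.

Definition letter (D a : nat) (S : {set multi_index D a}) := {i : multi_index D a | i \in S}.

Definition word (D a : nat) (S : {set multi_index D a}) (n : nat) :=
  n.-tuple (letter S).

Definition simil_word (R : realType) (D a : nat) (S : {set multi_index D a}) (n : nat)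
    (w : word S n) (x : 'rV[R]_D) : 'rV[R]_D :=
  foldr (fun (i : letter S) y => simil (val i) y) x w.

Definition cell (R : realType) (D a : nat) (S : {set multi_index D a})
    (K : set 'rV[R]_D) (n : nat) (w : word S n) : set 'rV[R]_D :=
  simil_word w @` K.

Definition cell_rel (R : realType) (D a : nat) (S : {set multi_index D a})
    (K : set 'rV[R]_D) (n : nat) : rel (word S n) :=
  fun v w => (v != w) && `[< cell K v `&` cell K w !=set0 >].

Definition subwords (D a : nat) (S : {set multi_index D a}) (m n : nat)
    (v : word S m) : {set word S (m + n)} :=
  [set cat_tuple v u | u : word S n]%SET.

Definition word_nbhd (R : realType) (D a : nat) (S : {set multi_index D a})
    (K : set 'rV[R]_D) (m n : nat) (w : word S m) : {set word S (m + n)} :=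
  (\bigcup_(v : word S m | (graph_dist R (cell_rel K (n := m)) v w <= 1%:E)%E)
     subwords n v)%SET.

Definition Cpn (R : realType) (D a : nat) (S : {set multi_index D a})
    (K : set 'rV[R]_D) (p : R) (n : nat) : \bar R :=
  ereal_sup [set c | exists (m : nat) (w : word S m), (0 < m)%N /\
    c = capacity p (cell_rel K (n := (m + n)%N)) (subwords n w)
          (~: word_nbhd K n w)%SET].

(* The limit is taken in [\bar R]; it exists and lies in (0, +oo) for a
   carpet, so that [fine] is harmless. *)
Definition rho_exp (R : realType) (D a : nat) (S : {set multi_index D a})
    (K : set 'rV[R]_D) (p : R) : R :=
  (fine (limn (fun n => poweR (Cpn S K p n) n%:R^-1)))^-1.

Definition beta_exp (R : realType) (D a : nat) (S : {set multi_index D a})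
    (K : set 'rV[R]_D) (p : R) : R :=
  ln (#|S|%:R * rho_exp S K p) / ln a%:R.

Definition Mn (R : realType) (D a : nat) (S : {set multi_index D a})
    (K : set 'rV[R]_D) (mu : probability (borelRV R D) R) (n : nat)
    (f : borelRV R D -> R) (w : word S n) : R :=
  #|S|%:R ^+ n * \int[mu]_(x in cell K w) f x.

(* Elements of [L^p(K, mu)] are represented by Borel functions on the ambient
   space; membership in [Fp] only depends on the class modulo [mu]-null sets. *)
Definition Fp (R : realType) (D a : nat) (S : {set multi_index D a})
    (K : set 'rV[R]_D) (mu : probability (borelRV R D) R) (p : R)
  : set (borelRV R D -> R) :=
  [set f | f \in Lfun mu p%:E /\
    (ereal_sup [set (rho_exp S K p ^+ n *
                     energy p (cell_rel K (n := n)) (@Mn R D a S K mu n f))%:E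
               | n in [set n | (0 < n)%N]] < +oo)%E].

Definition korevaar_schoen (R : realType) (D : nat) (K : set 'rV[R]_D)
    (mu : probability (borelRV R D) R) (p b : R) (f : borelRV R D -> R) (r : R)
  : \bar R :=
  (\int[mu]_(x in K)
     ((fine (mu (Bd K x r)))^-1%:E *
      \int[mu]_(y in Bd K x r) (`|f x - f y| `^ p / r `^ b)%:E))%E.

(* Main.v *)
(** Off the null set of points common to two cells of the same level, the cells
    of level [n] partition [K]; let [M_n f] be the step function of the averages
    of [f] over these cells.  By Jensen's inequality, the jump of [M_n f] between
    two adjacent cells is controlled by [|f(x) - f(y)|^p] integrated over the
    pairs at distance less than [3 a^-n], so that finiteness of the upper limit
    bounds the rescaled energies.

    Conversely, as [Q_1] is connected, two letters are joined by a chain of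
    pairwise intersecting cubes, and the norm [|M_(n+1) f - M_n f|_p^p] is at most
    a constant times [N^-n] times the energy of level [n + 1].  If the rescaled
    energies are bounded, these increments are dominated by a geometric series
    of ratio [(N rho)^(-1/p) < 1], whence [|f - M_n f|_p^p = O((N rho)^-n)].
    Comparing [f(x)] and [f(y)] with the averages over the cells of [x] and [y]
    then bounds the integrals at scale [a^-n], because [a^beta = N rho].

    The inequality [N rho > 1] comes from a Lipschitz cutoff function, which shows
    that the capacities are [O((N a^-p)^n)].
    The inequality [p > 1] holds because [K] contains an arc, so that an Ahlfors
    regular metric on [K] has exponent at least [1]. *)
Require Import Defs.
From HB Require Import structures.
From mathcomp Require Import all_boot all_order all_algebra.
From mathcomp Require Import all_classical all_reals all_analysis.
From mathcomp Require Import measurable_realfun.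
From mathcomp Require Import zify ring lra.

Set Implicit Arguments.
Unset Strict Implicit.
Unset Printing Implicit Defensive.

Import Order.TTheory GRing.Theory Num.Theory.
Import numFieldNormedType.Exports.

Local Open Scope classical_set_scope.
Local Open Scope ring_scope.

(** * Words and cells *)

(** The geometry is reduced to integer arithmetic. GSC1 and GSC4 put every vertex of Q_0 into K, so
    two cells of one level meet exactly when their positions differ by at most 1 in each direction;
    degrees of the graphs and the cells met by a ball are then counted with the numbers [addr].

    Two obstacles shape the analysis. The value [rho_exp] may a priori be a default one;
    [rho_exp_gt] separates the value 0, for which both sides of the equation are all of L^p, from N
    rho > 1. The outer integrand of [korevaar_schoen] is not known to be measurable, so it is only
    compared with measurable functions given cell by cell.

    Geometric decay of M_(n+1) f - M_n f does not by itself identify the limit of M_n f as f. This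
    comes from the density in L^p of the functions constant on the cells of some level, obtained
    from open sets by a Dynkin argument. *)

Section Addresses.
Context (D a : nat) (S : {set multi_index D a}).
Implicit Types (s t : seq (letter S)) (k : 'I_D).

(* Position in direction [k] of the cell of [s] among the cubes of side
   [2 a^-(size s)] that tile [Q_0]. *)
Fixpoint addr k s : nat :=
  if s is i :: s' then (val i k * a ^ size s' + addr k s')%N else 0%N.

(** The sup-distance of the two positions is at most [L]; two inequalities stand in for the absolute
    value. *)
Definition nearL (L : nat) s t : bool :=
  [forall k, (addr k s <= addr k t + L)%N && (addr k t <= addr k s + L)%N].

Lemma nearLP L s t :
  reflect (forall k, (addr k s <= addr k t + L)%N /\ (addr k t <= addr k s + L)%N)
    (nearL L s t).
Proof. by apply: (iffP forallP) => h k; have := h k; [move/andP|move=> ?; apply/andP]. Qed.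

Lemma nearL_sym L s t : nearL L s t = nearL L t s.
Proof. by apply/nearLP/nearLP => h k; have [] := h k. Qed.

Lemma nearL_refl L s : nearL L s s.
Proof. by apply/nearLP => k; rewrite leq_addr. Qed.

Lemma addr_lt k s : (addr k s < a ^ size s)%N.
Proof.
elim: s => [//|i s IH] /=; rewrite expnS.
have : (val i k < a)%N by exact: ltn_ord.
move: (nat_of_ord _) => b; move: (addr k s) (a ^ size s)%N IH => x y; nia.
Qed.

Lemma addr_cat k s t : addr k (s ++ t) = (addr k s * a ^ size t + addr k t)%N.
Proof.
elim: s => [//|i s IH] /=.
by rewrite IH size_cat expnD mulnDl mulnA addnA.
Qed.

Lemma addr_rcons k s i : addr k (rcons s i) = (addr k s * a + val i k)%N.
Proof. by rewrite -cats1 addr_cat /= expn0 expn1 muln1 addn0. Qed.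

(** The k-th position is the number whose base a digits are the k-th entries of the letters. The
    contribution of the tail is below a^(size of the tail), so the leading digit can be read off. *)
Lemma addr_inj s t : size s = size t -> (forall k, addr k s = addr k t) -> s = t.
Proof.
elim: s t => [|i s IH] [|j t] //= [st] h.
have e k : val i k = val j k :> nat /\ addr k s = addr k t.
  have := h k; have := addr_lt k s; have := addr_lt k t; rewrite st.
  move: (nat_of_ord (val i k)) (nat_of_ord (val j k)) => x y.
  move: (addr k s) (addr k t) (a ^ size t)%N => u v w vw uw e.
  have [xy|xy|xy] := ltngtP x y; last by subst y; lia.
    have : (x.+1 * w <= y * w)%N by rewrite leq_mul2r xy orbT.
    by lia.
  have : (y.+1 * w <= x * w)%N by rewrite leq_mul2r xy orbT.
  by lia.
rewrite (IH t st) => [|k]; last by have [] := e k.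
congr cons; apply/val_inj/ffunP => k; apply/val_inj; by have [] := e k.
Qed.

Lemma card_nearL n L s :
  (#|[set w : word S n | nearL L s (tval w)]%SET| <= (2 * L).+1 ^ D)%N.
Proof.
(* Adding [L] before subtracting makes the truncated subtraction exact on near words, with offsets
   in [0, 2L]. *)
pose g (w : word S n) : {ffun 'I_D -> 'I_(2 * L).+1} :=
  [ffun k => inord (addr k w + L - addr k s)].
rewrite -[X in (_ <= X)%N](_ : #|{ffun 'I_D -> 'I_(2 * L).+1}| = _); last first.
  by rewrite card_ffun !card_ord.
rewrite -[X in (X <= _)%N](@card_in_imset _ _ g); first exact: max_card.
move=> v w; rewrite !inE => /nearLP hv /nearLP hw /ffunP e.
apply/val_inj/addr_inj; first by rewrite !size_tuple.
move=> k; have := e k; rewrite !ffunE => /(congr1 val) /=.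
move: (hv k) (hw k) => {g e hv hw}.
move: (addr k v) (addr k w) (addr k s) => x y z [? ?] [? ?].
by rewrite !inordK; lia.
Qed.

(** A common prefix cancels in the difference of positions. An edge of the graph of letters thus
    yields an edge between children inside every cell. *)
Lemma near_rcons s i j : nearL 1 (rcons s i) (rcons s j) = nearL 1 [:: i] [:: j].
Proof.
by apply/nearLP/nearLP => h k; have := h k; rewrite !addr_rcons /= !expn0; lia.
Qed.

End Addresses.

Lemma affine_continuous (R : realType) (V : normedModType R) (c : R) (u v : V) :
  continuous (fun x : V => c *: x + u - v).
Proof.
move=> x; apply: cvgB; last exact: cvg_cst.
apply: cvgD; last exact: cvg_cst.
by apply: cvgZr; exact: cvg_id.
Qed.

Section CellGeometry.
Context (R : realType) (D a : nat) (S : {set multi_index D a}).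
Context (a1 : (1 < a)%N).
Implicit Types (s t : seq (letter S)) (k : 'I_D) (x y : 'rV[R]_D).

Definition smap s x : 'rV[R]_D :=
  foldr (fun (i : letter S) y => simil (val i) y) x s.

Lemma scale_gt0 : (0 : R) < a%:R. Proof. by rewrite ltr0n; lia. Qed.
Lemma scale_neq0 : (a%:R : R) != 0. Proof. by rewrite gt_eqF// scale_gt0. Qed.

Lemma sum_delta (j0 : 'I_D) : (\sum_(j < D) (delta_mx 0 j : 'rV[R]_D)) 0 j0 = 1.
Proof.
rewrite summxE (bigD1 j0)//= mxE !eqxx /= big1 ?addr0// => j jj.
by rewrite mxE eqxx /= eq_sym (negbTE jj).
Qed.

Lemma affine_comp (F : fieldType) (x c i A B : F) : B != 0 -> A != 0 ->
  ((x + 1 + 2 * c) / B - 1 + 1 + 2 * i) / A - 1 =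
  (x + 1 + 2 * (i * B + c)) / (A * B) - 1.
Proof. by move=> B0 A0; field; rewrite A0 B0. Qed.

Lemma similE (i : multi_index D a) x k :
  (simil i x) 0 k = (x 0 k + 1 + 2 * (i k)%:R) / a%:R - 1.
Proof. rewrite /simil !mxE sum_delta; have := scale_neq0; move: (a%:R : R) => A A0; by field. Qed.

(** Shifted by 1, the cube becomes [0, 2]^D, where the composite map adds twice the position and
    divides by a^(size s). *)
Lemma smapE s x k :
  (smap s x) 0 k = (x 0 k + 1 + 2 * (addr k s)%:R) / a%:R ^+ size s - 1.
Proof.
elim: s => [|i s IH] /=; first by rewrite expr0; field.
rewrite similE IH natrD natrM natrX exprS.
have := scale_neq0; have : (a%:R : R) ^+ size s != 0 by rewrite expf_neq0// scale_neq0.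
move=> B0 A0; exact: affine_comp.
Qed.

Lemma smap_cat s t x : smap (s ++ t) x = smap s (smap t x).
Proof. by rewrite /smap foldr_cat. Qed.

Lemma smap_inj s : injective (smap s).
Proof.
move=> x y e; apply/rowP => k; have := congr1 (fun z : 'rV_D => z 0 k) e.
rewrite /= !smapE; have : (a%:R : R) ^+ size s != 0 by rewrite expf_neq0// scale_neq0.
move: (a%:R ^+ _ : R) => A A0 /(congr1 (fun z => (z + 1) * A)).
rewrite !subrK !divfK// => h; lra.
Qed.

Lemma smap_continuous s : continuous (smap s).
Proof.
elim: s => [|i s IH] /=; first by move=> x.
move=> x; apply: (@continuous_comp _ _ _ (smap s) (@simil R D a (val i))); first exact: IH.
exact: affine_continuous.
Qed.

End CellGeometry.

Lemma subinterval (R : realType) (n : nat) (y : R) :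
  (0 < n)%N -> 0 <= y <= n%:R -> exists2 j, (j < n)%N & j%:R <= y <= j.+1%:R.
Proof.
elim: n => // n IH _ /andP[y0 yn].
have [yn'|yn'] := leP n%:R y; first by exists n => //; rewrite yn' yn.
have n0 : (0 < n)%N.
  by rewrite lt0n; apply/negP => /eqP n0; move: yn'; rewrite n0 ltNge y0.
have [|j jn h] := IH n0; first by rewrite y0 ltW.
by exists j => //; rewrite ltnS ltnW.
Qed.

(** * Vertices, edges and adjacency of cells *)

Section CarpetGeometry.
Context (R : realType) (D a : nat) (S : {set multi_index D a})
  (K : set 'rV[R]_D) (hK : gen_carpet S K).
Implicit Types (s t : seq (letter S)) (k : 'I_D) (x y : 'rV[R]_D).

Lemma carpet_a_gt1 : (1 < a)%N. Proof. by have := carpet_scale hK; lia. Qed.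
Local Notation a1 := carpet_a_gt1.
Local Notation A0 := (@scale_gt0 R a a1).
Local Notation A0' := (@scale_neq0 R a a1).

Lemma apow_gt0 n : 0 < (a%:R : R) ^+ n. Proof. by rewrite exprn_gt0 ?A0. Qed.

Definition scell s : set 'rV[R]_D := smap s @` K.

Lemma carpet_compact : compact K. Proof. by have [] := carpet_attractor hK. Qed.

Lemma carpet_closed : closed K.
Proof. by apply: compact_closed; [exact: norm_hausdorff|exact: carpet_compact]. Qed.

Lemma carpet_split x : K x <-> exists i : letter S, exists2 y, K y & x = simil (val i) y.
Proof.
have [_ _ KE] := carpet_attractor hK; split.
  rewrite {1}KE => -[i /= iS [y Ky <-]].
  by exists (exist _ i iS); exists y.
by move=> [[i iS]] [y Ky ->]; rewrite KE; exists i => //; exists y.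
Qed.

(** A maximiser over K of a signed coordinate is the image of another point z of K. The maximum M
    also bounds z, and inserting this into the contraction formula forces M <= 1. *)
Lemma carpet_bounds x k : K x -> -1 <= x 0 k <= 1.
Proof.
move=> Kx.
have cont (c : R) : {within K, continuous (fun y : 'rV[R]_D => c * y 0 k)}.
  apply: continuous_subspaceT => y.
  exact: (@continuousM R 'rV[R]_D (cst c) (fun y => y 0 k) y
            (@cst_continuous _ _ _ _) (@coord_continuous R 1 D 0 k y)).
have K0 : K !=set0 by exists x.
suff bound (c : R) : `|c| = 1 -> c * x 0 k <= 1.
  have := bound 1 (normr1 _); have := bound (-1) (normrN1 _); lra.
move=> c1.
have [y yK ymax] := compact_EVT_max K0 carpet_compact (cont c).
apply: le_trans (ymax x (mem_set Kx)) _.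
have /carpet_split[i [z Kz e]] := set_mem yK.
have := ymax z (mem_set Kz); rewrite e (similE a1).
have := ltn_ord (val i k); set j := nat_of_ord _ => ja.
have : (j%:R + 1 : R) <= a%:R by rewrite natr1 ler_nat.
have : (0 : R) <= j%:R by [].
have a1' : (1 : R) < a%:R by rewrite ltr1n a1.
move: (j%:R) (a%:R) (z 0 k) a1' c1 => J A u A1 c1 j0 jA.
clear -A1 c1 j0 jA.
set v := (u + 1 + 2 * J) / A - 1.
have -> : u = A * v + A - 1 - 2 * J by rewrite /v; field; lra.
have [c0|c0] := leP 0 c; move: c1; [rewrite ger0_norm//|rewrite ltr0_norm//] => c1.
  rewrite c1 !mul1r => h; rewrite -(ler_pM2l (_ : 0 < A - 1)); lra.
have -> : c = -1 by lra.
by rewrite !mulN1r => h; rewrite -(ler_pM2l (_ : 0 < A - 1)); lra.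
Qed.

Lemma carpet_smap s x : K x -> K (smap s x).
Proof.
move=> Kx; elim: s => [//|i s IH] /=.
by apply/carpet_split; exists i; exists (smap s x).
Qed.

Lemma scell_sub s : scell s `<=` K.
Proof. by move=> _ [x Kx <-]; exact: carpet_smap. Qed.

Lemma scell_cat_sub s t : scell (s ++ t) `<=` scell s.
Proof. by move=> _ [x Kx <-]; exists (smap t x); rewrite -?smap_cat//; exact: carpet_smap. Qed.

Lemma scell_take n s : scell s `<=` scell (take n s).
Proof. by rewrite -{1}(cat_take_drop n s); exact: scell_cat_sub. Qed.

Lemma scell_cover_rcons s x : scell s x -> exists i, scell (rcons s i) x.
Proof.
move=> [y /carpet_split[i [z Kz ->]] <-]; exists i; exists z => //.
by rewrite -cats1 smap_cat.
Qed.

Lemma scell_cover n x : K x -> exists w : word S n, scell w x.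
Proof.
move=> Kx; elim: n => [|n [w]]; first by exists [tuple]; exists x.
by move=> /scell_cover_rcons[i wi]; exists (rcons_tuple w i).
Qed.

Lemma scell_compact s : compact (scell s).
Proof.
apply: continuous_compact carpet_compact.
by apply: continuous_subspaceT; apply: smap_continuous.
Qed.

Lemma scell_closed s : closed (scell s).
Proof. by apply: compact_closed; [exact: norm_hausdorff|exact: scell_compact]. Qed.

Lemma scell_bounds s x k : scell s x ->
  2 * (addr k s)%:R <= (x 0 k + 1) * a%:R ^+ size s <= 2 * (addr k s)%:R + 2.
Proof.
move=> [y /(carpet_bounds k) yb <-]; rewrite (smapE a1) subrK divfK.
  by move: yb => /andP[]; lra.
by rewrite gt_eqF ?apow_gt0.
Qed.

Lemma scell_near L s t x y : size s = size t -> scell s x -> scell t y ->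
  (forall k, `|x 0 k - y 0 k| * a%:R ^+ size s < 2 * L%:R) -> nearL L s t.
Proof.
move=> st sx ty h; apply/nearLP => k.
have := h k; have := scell_bounds k sx; have := scell_bounds k ty; rewrite -st.
have := apow_gt0 (size s); set A := (_ ^+ _) => Apos.
set m := addr k s; set n := addr k t => /andP[t1 t2] /andP[s1 s2].
rewrite -[X in _ * X](gtr0_norm Apos) -normrM ltr_norml => /andP[l1 l2].
split; rewrite -ltnS -(ltr_nat R) -natr1 natrD; lra.
Qed.

Lemma scell_close L s t x y k : size s = size t -> scell s x -> scell t y ->
  nearL L s t -> `|x 0 k - y 0 k| * a%:R ^+ size s <= 2 * (L%:R + 1).
Proof.
move=> st sx ty /nearLP /(_ k); have := scell_bounds k sx; have := scell_bounds k ty; rewrite -st.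
have := apow_gt0 (size s); set A := (_ ^+ _) => Apos.
set m := addr k s; set n := addr k t => /andP[t1 t2] /andP[s1 s2].
rewrite -!(ler_nat R) !natrD => -[l1 l2].
rewrite -[X in _ * X](gtr0_norm Apos) -normrM ler_norml; apply/andP; split; lra.
Qed.

Lemma apow_small (e : R) : 0 < e -> exists n, 2 / (a%:R : R) ^+ n < e.
Proof.
move=> e0; have [n hn] : exists n, 2 / e < n%:R.
  by exists (Num.truncn (2 / e)).+1; rewrite truncnS_gt.
exists n; rewrite ltr_pdivrMr ?apow_gt0//.
move: hn; rewrite ltr_pdivrMr// => /lt_le_trans; apply.
by rewrite mulrC ler_pM2l// -natrX ler_nat ltnW// ltn_expl ?a1.
Qed.

(** The cubes containing z shrink, and each contains the image of a fixed point of K; so z is in the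
    closure of K. *)
Lemma carpet_nested z :
  (forall n, exists2 s : seq (letter S), size s = n & exists2 y, Q0 R D y & smap s y = z) -> K z.
Proof.
move=> h; apply: carpet_closed => U.
rewrite -filter_from_ballE /= => -[e /= e0 eU].
have [[y0 Ky0] _ _] := carpet_attractor hK.
have [n hn] := apow_small e0.
have [s sn [y Qy e']] := h n; rewrite -e' {e'} in eU.
exists (smap s y0); split; first exact: carpet_smap.
apply: eU; rewrite -ball_normE /ball_ /=.
rewrite /Num.norm /= mx_normrE; apply: bigmax_lt => // -[i k] _ /=; rewrite !mxE (ord1 i).
rewrite !(smapE a1) sn.
have := Qy k; have := carpet_bounds k Ky0; move: hn.
have := apow_gt0 n; set A := _ ^+ _ => Apos hn yb y0b.
apply: le_lt_trans hn.
rewrite ler_pdivlMr// -[X in _ * X](gtr0_norm Apos) -normrM.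
set v := (X in `|X|); have -> : v = y 0 k - y0 0 k by rewrite /v; field; lra.
by rewrite ler_norml; lra.
Qed.

Definition corner (sg : 'I_D -> bool) : 'rV[R]_D := \row_k (if sg k then 1 else -1).

Lemma corner_norm sg k : `|corner sg 0 k| = 1.
Proof. by rewrite mxE; case: ifP; rewrite ?normrN1 ?normr1. Qed.

Lemma Q0_norm x : Q0 R D x <-> forall k, `|x 0 k| <= 1.
Proof. by split => h k; have := h k; rewrite ler_norml. Qed.

Lemma letter_of_point z : Q1 R S z ->
  exists i : letter S, forall k, exists2 u : R, -1 <= u <= 1 & (z 0 k + 1) * a%:R = u + 1 + 2 * (val i k)%:R.
Proof.
move=> [i iS [y Qy <-]]; exists (exist _ i iS) => k; exists (y 0 k); first exact: Qy.
by rewrite (similE a1) subrK divfK// A0'.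
Qed.

(** GSC4 puts the vertex (1, ..., 1) into Q_1, and the coordinate reflections [f] of GSC1 carry it
    to every other vertex. Only one cube of the tiling contains a given vertex. *)
Lemma corner_letter sg :
  exists i : letter S, forall k, val i k = (if sg k then a.-1 else 0)%N :> nat.
Proof.
pose f x : 'rV[R]_D := \row_k (corner sg 0 k * x 0 k).
have ff x : f (f x) = x by apply/rowP => k; rewrite !mxE; case: ifP => _; lra.
have iso : Defs.isometry f.
  move=> x y; rewrite /enorm; congr Num.sqrt; apply: eq_bigr => k _.
  by rewrite !mxE; case: ifP => _; lra.
have fQ x : Q0 R D x -> Q0 R D (f x).
  by rewrite !Q0_norm => h k; have := h k; rewrite mxE normrM corner_norm mul1r.
have fQ0 : f @` Q0 R D = Q0 R D.
  apply/seteqP; split => [_ [x Qx <-]|x Qx]; first exact: fQ.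
  by exists (f x) => //; exact: fQ.
have := carpet_gsc1 hK iso fQ0 => fQ1.
have : Q1 R S (f (corner xpredT)).
  rewrite -fQ1; exists (corner xpredT) => //.
  by apply: (carpet_gsc4 hK) => k; rewrite mxE; split => // _; rewrite lexx andbT; lra.
move=> /letter_of_point[i hi]; exists i => k.
have [u u1] := hi k; rewrite !mxE mulr1; have := ltn_ord (val i k).
move: (nat_of_ord (val i k)) => j ja.
have : (j%:R + 1 : R) <= a%:R by rewrite natr1 ler_nat.
have : (0 : R) <= j%:R by [].
case: (sg k) => j0 jA e.
  apply/eqP; rewrite eqn_leq -(leq_add2r 1) !addn1 prednK; last by have := a1; lia.
  rewrite ja /=; suff : (a <= j.+1)%N by lia.
  by rewrite -(ler_nat R) -natr1; nra.
by apply/eqP; rewrite -leqn0 -(ler_nat R); nra.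
Qed.

(** The vertex is the fixed point of the map of its corner letter. *)
Lemma carpet_corner sg : K (corner sg).
Proof.
have [i hi] := corner_letter sg; apply: carpet_nested => n.
exists (nseq n i); first by rewrite size_nseq.
exists (corner sg); first by rewrite Q0_norm => k; rewrite corner_norm.
elim: n => // n IH /=; rewrite IH; apply/rowP => k; rewrite (similE a1) hi mxE.
have := A0'; case: (sg k) => A0.
  by rewrite -subn1 natrB; [field|have := a1; lia].
by field.
Qed.

Lemma edge_letter (k0 : 'I_D) (j : 'I_a) : k0 = 0%N :> nat ->
  exists i : letter S, forall k, val i k = (if k == k0 then j : nat else a.-1) :> nat.
Proof.
move=> k00.
(* The midpoint of the j-th subinterval of the edge: no other cube of the tiling contains it, so its
   letter is determined. *)
pose z : 'rV[R]_D := \row_k (if k == k0 then (1 + 2 * j%:R) / a%:R - 1 else 1).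
have ja : (j%:R + 1 : R) <= a%:R by rewrite natr1 ler_nat.
have j0 : (0 : R) <= j%:R by [].
have : Q1 R S z.
  apply: (carpet_gsc4 hK) => k; rewrite mxE; split => [kk|kk].
    have -> : k = k0 by apply: val_inj; rewrite /= kk k00.
    rewrite eqxx -(ler_pM2r A0) -[X in _ && X](ler_pM2r A0) mulrBl divfK ?A0' //.
    by have := A0; move: (a%:R) ja => A; lra.
  by rewrite (_ : k == k0 = false)//; apply/eqP => h; apply: kk; rewrite h.
move=> /letter_of_point[i hi]; exists i => k.
have [u u1] := hi k; rewrite !mxE; have := ltn_ord (val i k).
move: (nat_of_ord (val i k)) => l la.
have lA : (l%:R + 1 : R) <= a%:R by rewrite natr1 ler_nat.
have l0 : (0 : R) <= l%:R by [].
case: eqP => _.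
  rewrite subrK divfK ?A0' // => e.
  have [lj|lj|//] := ltngtP l j.
    have : (l%:R + 1 : R) <= j%:R by rewrite natr1 ler_nat.
    by move=> lj1; exfalso; move: u1 e lj1; move: (j%:R) (l%:R) => J L; lra.
  have : (j%:R + 1 : R) <= l%:R by rewrite natr1 ler_nat.
  by move=> lj1; exfalso; move: u1 e lj1; move: (j%:R) (l%:R) => J L; lra.
move=> e; suff : (a <= l.+1)%N by have := a1; lia.
by rewrite -(ler_nat R) -natr1; nra.
Qed.

Definition edge (k0 : 'I_D) (r : R) : 'rV[R]_D := \row_k (if k == k0 then r else 1).

(** The letters of the nested cubes are the base a digits of (r + 1) / 2, taken along the edge. *)
Lemma carpet_edge (k0 : 'I_D) (r : R) : k0 = 0%N :> nat -> -1 <= r <= 1 -> K (edge k0 r).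
Proof.
move=> k00 r1; apply: carpet_nested => n.
suff [s sn [u u1 e]] : exists2 s : seq (letter S), size s = n &
    exists2 u, -1 <= u <= 1 & smap s (edge k0 u) = edge k0 r.
  exists s => //; exists (edge k0 u) => // k; rewrite mxE; case: ifP => // _.
  by rewrite lexx andbT; lra.
elim: n r r1 => [|n IH] r r1; first by exists [::] => //; exists r.
have a0 : (0 < a)%N by have := a1; lia.
have [|j ja /andP[j1 j2]] := @subinterval R a ((r + 1) * a%:R / 2) a0.
  have := A0; move: (a%:R : R) => A Apos; nra.
have [i hi] := edge_letter (Ordinal ja) k00.
have [|s sn [u u1 e]] := IH ((r + 1) * a%:R - 1 - 2 * j%:R).
  by move: j1 j2; rewrite -(@natr1 R j); move: (j%:R : R) ((r + 1) * a%:R : R) => J q; lra.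
exists (i :: s); first by rewrite /= sn.
exists u => //=; rewrite e; apply/rowP => k; rewrite (similE a1) hi !mxE /=; case: eqP => _.
  by field; exact: A0'.
by rewrite -subn1 natrB; [field; exact: A0'|].
Qed.

(** In each direction the cubes are equal or consecutive, so they share a vertex: take the side
    facing the other cube, and the upper side if the positions agree. Both cells contain that vertex
    by [carpet_corner]. *)
Lemma near_scell s t : size s = size t -> nearL 1 s t -> scell s `&` scell t !=set0.
Proof.
move=> st /nearLP near.
exists (smap s (corner (fun k => addr k s <= addr k t)%N)); split.
  by exists (corner (fun k => addr k s <= addr k t)%N) => //; exact: carpet_corner.
exists (corner (fun k => addr k t <= addr k s)%N).
  exact: carpet_corner.
apply/rowP => k; rewrite !(smapE a1) st !mxE.
have [n1 n2] := near k; congr (_ / _ - _).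
have [lt|gt|e] := ltngtP (addr k s) (addr k t).
- have -> : (addr k t = addr k s + 1)%N by lia.
  by rewrite natrD; lra.
- have -> : (addr k s = addr k t + 1)%N by lia.
  by rewrite natrD; lra.
- by rewrite e.
Qed.

Lemma cell_relE n (v w : word S n) : cell_rel K v w = (v != w) && nearL 1 v w.
Proof.
rewrite /cell_rel; congr (_ && _); apply/asboolP/idP.
  move=> [x [vx wx]]; apply: (@scell_near 1 v w x x) => //; first by rewrite !size_tuple.
  by move=> k; rewrite subrr normr0 mul0r mulr1.
by apply: near_scell; rewrite !size_tuple.
Qed.

End CarpetGeometry.

Section CarpetDistance.
Context (R : realType) (D : nat).
Implicit Types x y z : 'rV[R]_D.

Lemma enorm_le z (e : R) : 0 <= e -> (forall k, `|z 0 k| <= e) ->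
  enorm z <= Num.sqrt D%:R * e.
Proof.
move=> e0 h; rewrite /enorm -[X in _ * X](ger0_norm e0) -sqrtr_sqr -sqrtrM ?ler0n//.
rewrite ler_sqrt ?mulr_ge0 ?sqr_ge0 ?ler0n//.
apply: (@le_trans _ _ (\sum_(k < D) e ^+ 2)).
  apply: ler_sum => k _; rewrite -real_normK ?num_real//.
  by rewrite lerXn2r ?nnegrE// normr_ge0.
by rewrite sumr_const card_ord mulr_natl.
Qed.

Lemma norm_coord_enorm z k : `|z 0 k| <= enorm z.
Proof.
rewrite /enorm -sqrtr_sqr ler_sqrt; last by apply: sumr_ge0 => i _; exact: sqr_ge0.
by rewrite (bigD1 k)//= lerDl; apply: sumr_ge0 => i _; exact: sqr_ge0.
Qed.

Lemma dcarpet_le x y (e : R) : (0 < D)%N -> 0 <= e ->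
  (forall k, `|x 0 k - y 0 k| <= e) -> dcarpet x y <= e / 2.
Proof.
move=> D0 e0 h.
have sD : 0 < Num.sqrt (D%:R : R) by rewrite sqrtr_gt0 ltr0n.
have : enorm (x - y) <= Num.sqrt D%:R * e by apply: enorm_le => // k; rewrite !mxE.
rewrite /dcarpet; move: (enorm _) (Num.sqrt _) sD => n s s0 h'.
rewrite mulrC ler_pdivrMr; last lra.
by rewrite (_ : e / 2 * (2 * s) = s * e)//; field.
Qed.

(** The constant 2D, larger than 2 sqrt D, lets ball radii be compared with natural numbers of
    cells. *)
Lemma coord_le_dcarpet x y k : `|x 0 k - y 0 k| <= 2 * D%:R * dcarpet x y.
Proof.
have D1 : (1 : R) <= D%:R by rewrite ler1n; exact: leq_ltn_trans (ltn_ord k).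
have sD : 0 < Num.sqrt (D%:R : R) by rewrite sqrtr_gt0; lra.
have := norm_coord_enorm (x - y) k; rewrite !mxE => /le_trans; apply.
have n0 : 0 <= enorm (x - y) by exact: sqrtr_ge0.
have sDD : Num.sqrt (D%:R : R) <= D%:R.
  rewrite -{2}(@ger0_norm _ (D%:R : R)) ?ler0n// -sqrtr_sqr ler_sqrt ?sqr_ge0//.
  by rewrite expr2 ler_peMr ?ler0n.
rewrite /dcarpet; move: (enorm _) (Num.sqrt _) n0 sD sDD => n s n0 s0 h.
rewrite mulrA ler_peMl// ler_pdivlMr ?mul1r; lra.
Qed.

End CarpetDistance.

(** * Connectedness of the graph of letters *)

Section LetterGraph.
Context (R : realType) (D a : nat) (S : {set multi_index D a})
  (K : set 'rV[R]_D) (hK : gen_carpet S K).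

Definition letter_rel : rel (letter S) := fun i j => nearL 1 [:: i] [:: j].

Definition lcube (i : letter S) : set 'rV[R]_D := simil (val i) @` Q0 R D.

Let a1 := carpet_a_gt1 hK.
Let A0 : (0 : R) < a%:R := scale_gt0 R a1.
Let A0' : (a%:R : R) != 0 := scale_neq0 R a1.

Lemma lcube_bounds i x : lcube i x <->
  forall k, 2 * (val i k)%:R <= (x 0 k + 1) * a%:R <= 2 * (val i k)%:R + 2.
Proof.
split=> [[y Qy <-] k|h].
  by rewrite (similE a1) subrK divfK//; have := Qy k; lra.
exists (\row_k ((x 0 k + 1) * a%:R - 1 - 2 * (val i k)%:R)).
  by move=> k; rewrite mxE; have := h k; lra.
apply/rowP => k; rewrite (similE a1) mxE; by field.
Qed.

Lemma lcube_closed i : closed (lcube i).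
Proof.
have -> : lcube i = \bigcap_(k in [set: 'I_D])
    ((fun x : 'rV[R]_D => (x 0 k + 1) * a%:R) @^-1` `[2 * (val i k)%:R, 2 * (val i k)%:R + 2]%classic).
  apply/seteqP; split=> x.
    by move=> /lcube_bounds h k _ /=; rewrite in_itv /=; exact: h.
  by move=> h; apply/lcube_bounds => k; have := h k I; rewrite /= in_itv.
apply: closed_bigI => k _; apply: preimage_closed; last exact: itv_closed.
move=> x _; apply: (@continuousM R 'rV[R]_D (fun x => x 0 k + 1) (cst a%:R) x).
  apply: (@continuousD R R 'rV[R]_D (fun x => x 0 k) (cst 1) x).
    exact: (@coord_continuous R 1 D 0 k x).
  exact: cst_continuous.
exact: cst_continuous.
Qed.

Lemma lcube_meet i j : lcube i `&` lcube j !=set0 -> letter_rel i j.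
Proof.
move=> [x [/lcube_bounds hi /lcube_bounds hj]]; apply/nearLP => k /=.
have := hi k; have := hj k; rewrite !expn0 !muln1 !addn0.
move: (nat_of_ord _) (nat_of_ord _) => m n /andP[? ?] /andP[? ?].
by rewrite -!(ler_nat R) !natrD; split; lra.
Qed.

(** Cubes of letters in different components are disjoint. The union over the component of [i] and
    the union over the other letters are closed, so the former is clopen and nonempty in the
    connected set Q_1. *)
Lemma letter_connect i j : connect letter_rel i j.
Proof.
pose U (P : pred (letter S)) := \bigcup_(l in [set l | P l]) lcube l.
have Ucl P : closed (U P).
  by apply: closed_bigcup => [|l _]; [exact: finite_finset|exact: lcube_closed].
have QE : Q1 R S = U predT.
  apply/seteqP; split=> x.
    by move=> [l lS xl]; exists (exist _ l lS).
  by move=> [[l lS] _ xl]; exists l.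
pose C := [pred l | connect letter_rel i l].
have corner_in (l : letter S) : lcube l (simil (val l) 0).
  by exists 0 => // k; rewrite mxE; lra.
have dis l m : C l -> lcube l `&` lcube m !=set0 -> C m.
  by move=> /= il /lcube_meet/connect1; exact: connect_trans.
have QC : Q1 R S `&` U C = Q1 R S.
  apply: (carpet_gsc2 hK).
  - exists (simil (val i) 0); split; first by rewrite QE; exists i.
    by exists i => //=; exact: connect0.
  - exists (~` U (predC C)); first by rewrite openC.
    rewrite QE; apply/seteqP; split=> x [[l _ xl] h]; split; try by exists l.
      move=> [m /= /negP Cm xm]; apply: Cm.
      by have [l' /= Cl' xl'] := h; apply: (dis l' m Cl'); exists x.
    exists l => //=; apply: contrapT => /negP Cl.
    by apply: h; exists l.
  - by exists (U C).
have : Q1 R S (simil (val j) 0) by rewrite QE; exists j.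
rewrite -QC => -[_ [l /= Cl xl]].
by apply: (dis l j Cl); exists (simil (val j) 0).
Qed.

(** A path without repetition has at most #|S| edges, and along each of them the increment is at
    most E^(1/p), where E is the whole sum. *)
Lemma letter_poincare (p : R) (g : letter S -> R) i j : 0 < p ->
  `|g i - g j| `^ p <= #|S|%:R `^ p * \sum_(e : letter S * letter S | letter_rel e.1 e.2) `|g e.1 - g e.2| `^ p.
Proof.
move=> p0; set E := \sum_(_ | _) _.
have E0 : 0 <= E by apply: sumr_ge0 => e _; exact: powR_ge0.
have step l m : letter_rel l m -> `|g l - g m| <= E `^ p^-1.
  move=> lm; rewrite -[X in X <= _]powRr1// -(@mulfV _ p) ?gt_eqF// powRrM.
  apply: ge0_ler_powR; rewrite ?nnegrE ?invr_ge0 ?powR_ge0 ?(ltW p0)//.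
  by rewrite /E (bigD1 (l, m))//= lerDl; apply: sumr_ge0 => e _; exact: powR_ge0.
have /connectP[s0 /shortenP[s sp us _] ->] := letter_connect i j.
have le : `|g i - g (last i s)| <= (size s)%:R * E `^ p^-1.
  move: sp {us}; elim: s i => [|l s IH] i /=; first by rewrite subrr normr0 mul0r.
  move=> /andP[il sp]; apply: le_trans (ler_distD (g l) _ _) _.
  by rewrite -natr1 mulrDl mul1r addrC lerD// ?IH// step.
have sN : (size s <= #|S|)%N.
  have : (size (i :: s) <= #|{: letter S}|)%N by rewrite -(card_uniqP us) max_card.
  by rewrite card_sig /= => /ltnW.
apply: (@le_trans _ _ ((#|S|%:R * E `^ p^-1) `^ p)).
  apply: ge0_ler_powR; rewrite ?nnegrE ?(ltW p0) ?mulr_ge0 ?powR_ge0//.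
  by apply: le_trans le _; rewrite ler_wpM2r ?powR_ge0// ler_nat.
by rewrite powRM ?powR_ge0// -powRrM mulVf ?gt_eqF// powRr1.
Qed.

End LetterGraph.

(** * The conformal dimension *)

Section ConformalDimension.
Context (R : realType) (D a : nat) (S : {set multi_index D a})
  (K : set 'rV[R]_D) (hK : gen_carpet S K).

Let D0 : (0 < D)%N. Proof. by have := carpet_dim hK; lia. Qed.
Let k0 : 'I_D := Ordinal D0.

(** Clamping extends the parametrisation of the edge to the whole line, where continuity can be
    stated without a subspace. *)
Let clamp (r : R) : R := Num.max (-1) (Num.min 1 r).

Let clampP r : -1 <= clamp r <= 1.
Proof.
rewrite /clamp le_max lexx /= ge_max; apply/andP; split; first lra.
by rewrite ge_min lexx.
Qed.

Let clamp_lipschitz r t : `|clamp r - clamp t| <= `|r - t|.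
Proof.
wlog rt : r t / r <= t.
  move=> h; have [/h//|/ltW/h] := leP r t.
  by rewrite distrC (distrC t).
have clampE u : [\/ u <= -1 /\ clamp u = -1, -1 <= u <= 1 /\ clamp u = u | 1 <= u /\ clamp u = 1].
  rewrite /clamp; have [u1|u1] := leP u (-1).
    by constructor 1; rewrite min_r ?max_l//; lra.
  by have [u2|u2] := leP u 1; [constructor 2|constructor 3]; rewrite max_r//; lra.
rewrite !ler0_norm; [|lra|].
  by have [] := clampE r; have [] := clampE t => -[? ->] [? ->]; lra.
by have [] := clampE r; have [] := clampE t => -[? ->] [? ->]; lra.
Qed.

Definition edge_path (r : R) : K :=
  exist _ (edge k0 (clamp r)) (mem_set (carpet_edge hK (erefl : k0 = 0%N :> nat) (clampP r))).

Lemma edge_path_continuous : continuous edge_path.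
Proof.
apply: continuous_comp_initial => r; rewrite /comp /=.
apply/cvgrPdist_lt => e e0; near=> t.
rewrite /Num.norm /= mx_normrE; apply: bigmax_lt => // -[i k] _ /=; rewrite !mxE.
case: ifP => _; last by rewrite subrr normr0.
by apply: le_lt_trans (clamp_lipschitz r t) _; near: t; exact: cvgr_dist_lt.
Unshelve. all: by end_near. Qed.

Lemma edge_path_ends : edge_path (-1) <> edge_path 1.
Proof.
move=> /(congr1 (fun z : K => (set_val z) 0 k0)); rewrite /= !mxE eqxx /clamp.
rewrite !maxEle !minEle; do ![case: ifPn]; rewrite -?ltNge; lra.
Qed.

Lemma mball_open (d : K -> K -> R) x r : is_metric d -> compatible d -> open (mball d x r).
Proof.
move=> [_ _ _ tri] cd; rewrite openE => y xy; apply/cd.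
exists (r - d x y); first by rewrite subr_gt0.
by move=> z /= yz; apply: le_lt_trans (tri x y z) _; rewrite -ltrBrDl.
Qed.

(* Balls of radius [delta/(4n)] around [n + 1] points at distances
   [i delta/(2n)], [i <= n], from one end of an edge are disjoint. *)
Lemma ahlfors_regular_ge1 (d : K -> K -> R) (alpha : R) :
  0 < alpha -> is_metric d -> compatible d -> ahlfors_regular d alpha -> 1 <= alpha.
Proof.
move=> al0 md cd [nu [C [[nuB _] C1 ar]]]; rewrite leNgt; apply/negP => al1.
have [dge deq dsym dtri] := md.
pose x0 := edge_path (-1); pose phi r := d x0 (edge_path r).
have phic : continuous phi.
  move=> r; apply/cvgrPdist_lt => e e0.
  have nb : nbhs (edge_path r) (mball d (edge_path r) e) by apply/cd; exists e.
  have {}nb : \forall t \near r, d (edge_path r) (edge_path t) < e := edge_path_continuous nb.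
  near=> t; have h : d (edge_path r) (edge_path t) < e by near: t.
  rewrite /phi.
  have := dtri x0 (edge_path r) (edge_path t); have := dtri x0 (edge_path t) (edge_path r).
  by rewrite (dsym (edge_path t)) ltr_norml; move: h => ? ? ?; lra.
pose del := phi 1.
have del0 : 0 < del.
  rewrite lt_neqAle dge andbT eq_sym; apply/eqP => /deq; exact: edge_path_ends.
have hit (v : R) : 0 <= v <= del -> exists r, phi r = v.
  move=> vd; have [|||r _ rv] := @IVT R phi (-1) 1 v; first lra.
  - exact: continuous_subspaceT.
  - have -> : phi (-1) = 0 by apply/deq.
    by rewrite -/del min_l ?max_r ?(ltW del0).
  - by exists r.
have big n : (0 < n)%N -> n.+1%:R * (C^-1 * (del / (4 * n%:R)) `^ alpha) <= C * (3 * del / 4) `^ alpha.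
  move=> n0; have n0' : (0 : R) < n%:R by rewrite ltr0n.
  have n1 : (1 : R) <= n%:R by rewrite ler1n.
  (* [minn] keeps the distances in [0, del / 2] for every index, so that a single choice of
     parameters covers all of them. *)
  pose v (i : nat) : R := (minn i n)%:R * del / (2 * n%:R).
  have v1 i : 0 <= v i <= del / 2.
    have : ((minn i n)%:R : R) <= n%:R by rewrite ler_nat geq_minr.
    have : (0 : R) <= (minn i n)%:R by [].
    rewrite /v; move: (_%:R) => m m0 mn; rewrite divr_ge0 ?mulr_ge0 ?(ltW del0)//=.
    by rewrite ler_pdivrMr; [nra|lra].
  have /choice[r rv] : forall i, exists r, phi r = v i.
    by move=> i; apply: hit; have := v1 i; lra.
  (* Empty sets beyond n complete the family to a sequence, the form in which an outer measure is
     additive on Caratheodory measurable sets. *)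
  pose A i := if (i <= n)%N then mball d (edge_path (r i)) (del / (4 * n%:R)) else set0.
  have e0 : 0 < del / (4 * n%:R) by rewrite divr_gt0//; lra.
  have mA i : nu.-caratheodory (A i).
    rewrite /A; case: ifP => _; last exact: caratheodory_measurable_set0.
    by apply: nuB; apply: sub_sigma_algebra; exact: mball_open.
  have tA : trivIset setT A.
    apply/trivIsetP => i j _ _; wlog ij : i j / (i < j)%N.
      move=> h; rewrite neq_ltn => /orP[|] ij; first by apply: h => //; rewrite neq_ltn ij.
      by rewrite setIC; apply: h => //; rewrite neq_ltn ij.
    move=> _; rewrite /A; case: ifP => [|_]; last by rewrite set0I.
    case: ifP => [|_]; last by rewrite setI0.
    move=> jn iN; rewrite -subset0 => y [/= hi hj]; exfalso.
    have := dtri x0 (edge_path (r i)) (edge_path (r j)).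
    rewrite -/(phi (r i)) -/(phi (r j)) !rv.
    have := dtri (edge_path (r i)) y (edge_path (r j)); rewrite (dsym y).
    move: hi hj; rewrite /mball /=.
    suff : v i + 2 * (del / (4 * n%:R)) <= v j by lra.
    rewrite /v (minn_idPl iN) (minn_idPl jn).
    have -> : i%:R * del / (2 * n%:R) + 2 * (del / (4 * n%:R)) = (i%:R + 1) * del / (2 * n%:R).
      by field; lra.
    rewrite ler_pM2r ?invr_gt0; last lra.
    by rewrite ler_pM2r// natr1 ler_nat.
  pose X := mball d x0 (3 * del / 4).
  have AX i : A i `<=` X.
    rewrite /A; case: ifP => [_ y /= yi|_]; last exact: sub0set.
    have := dtri x0 (edge_path (r i)) y; rewrite -/(phi (r i)) rv.
    move: yi; rewrite /mball /= => yi le; apply: le_lt_trans le _.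
    have := v1 i; suff : del / (4 * n%:R) <= del / 4 by lra.
    by rewrite ler_pM2l// lef_pV2 ?posrE; lra.
  have delsup s : 0 < s -> s < del -> (s%:E < ereal_sup [set (d u.1 u.2)%:E | u in [set: K * K]])%E.
    move=> s0 sd; apply: (@lt_le_trans _ _ del%:E); first by rewrite lte_fin.
    by apply: ereal_sup_ubound; exists (x0, edge_path 1).
  have e1 : del / (4 * n%:R) < del.
    by rewrite ltr_pdivrMr ?mulr_gt0// ltr_pMr//; lra.
  have := @caratheodory_additive R K nu A mA tA n.+1 X.
  have -> : \sum_(i < n.+1) nu (X `&` A i) = \sum_(i < n.+1) nu (mball d (edge_path (r i)) (del / (4 * n%:R))).
    apply: eq_bigr => i _; have -> : X `&` A i = A i by apply: setIidr.
    by rewrite /A -ltnS ltn_ord.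
  move=> E; rewrite -lee_fin.
  have h3 : 0 < 3 * del / 4 by lra.
  have h4 : 3 * del / 4 < del by lra.
  have /andP[_ up] := ar x0 (3 * del / 4) h3 (delsup _ h3 h4).
  apply: le_trans up; apply: (@le_trans _ _ (nu (X `&` \big[setU/set0]_(i < n.+1) A i))); last first.
    by apply: le_outer_measure; exact: subIsetl.
  rewrite E.
  apply: (@le_trans _ _ (\sum_(i < n.+1) (C^-1 * (del / (4 * n%:R)) `^ alpha)%:E)).
    by rewrite sumEFin lee_fin sumr_const card_ord mulr_natl.
  apply: lee_sum => i _; by have /andP[] := ar (edge_path (r i)) _ e0 (delsup _ e0 e1).
(* Once (del / 4)^alpha is cancelled, the packing inequality reads n^(1 - alpha) <= C^2 3^alpha,
   whose left side is unbounded when alpha < 1. *)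
pose B := C * C * 3 `^ alpha.
have big' n : (0 < n)%N -> n%:R `^ (1 - alpha) <= B.
  move=> n0; have := big n n0; have n0' : (0 : R) < n%:R by rewrite ltr0n.
  have e4 : del / (4 * n%:R) = del / 4 * n%:R^-1 by rewrite invfM mulrA.
  have c0 : 0 < del / 4 by rewrite divr_gt0.
  rewrite e4 -(mulrA 3); move: (del / 4) c0 => c c0.
  rewrite powRM ?invr_ge0 ?(ltW c0) ?(ltW n0')// powRM ?(ltW c0)//.
  have q0 : 0 < c `^ alpha by rewrite powR_gt0.
  have -> : n%:R `^ (1 - alpha) = n%:R * n%:R^-1 `^ alpha :> R.
    rewrite powRD; last by rewrite (gt_eqF n0') implybT.
    rewrite (powRr1 (ltW n0')) -[X in X `^ alpha](powR_inv1 (ltW n0')) -powRrM.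
    by rewrite mulN1r.
  move: (_ `^ _) q0 => q q0; rewrite /B.
  have := powR_ge0 (n%:R^-1 : R) alpha; move: (_ `^ _) => w w0.
  move: (3 `^ alpha) => u h.
  have : n.+1%:R * w <= C * C * u.
    rewrite -(ler_pM2r q0) -(ler_pM2l (_ : 0 < C^-1)) ?invr_gt0; last lra.
    rewrite (_ : C^-1 * (C * C * u * q) = C * (u * q)); last by field; lra.
    by apply: le_trans h; rewrite le_eqVlt; apply/orP; left; apply/eqP; ring.
  by apply: le_trans; rewrite ler_wpM2r// ler_nat.
have [m hm] : exists m : nat, B `^ (1 - alpha)^-1 < m%:R.
  by exists (Num.truncn (B `^ (1 - alpha)^-1)).+1; rewrite truncnS_gt.
have m0 : (0 < m)%N by rewrite -(ltr_nat R); apply: le_lt_trans hm; exact: powR_ge0.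
have := big' m m0; rewrite leNgt => /negP; apply.
have B0 : 0 <= B by rewrite /B !mulr_ge0 ?powR_ge0//; lra.
have b0 : 0 < 1 - alpha by lra.
have -> : B = (B `^ (1 - alpha)^-1) `^ (1 - alpha).
  by rewrite -powRrM mulVf ?gt_eqF// powRr1.
by apply: gt0_ltr_powR; rewrite ?nnegrE ?powR_ge0.
Unshelve. all: by end_near. Qed.

Lemma gt_dimARC_gt1 (p : R) : (dimARC (@dcarpet_on R D K) < p%:E)%E -> 1 < p.
Proof.
move=> /ereal_inf_lt[_ [alpha [al0 [d [md cd _ ar]]] <-]]; rewrite lte_fin.
apply: le_lt_trans; exact: (ahlfors_regular_ge1 al0 md cd ar).
Qed.

End ConformalDimension.

(** * The self-similar measure *)

Lemma negligible_bigcup_fin (d : measure_display) (T : measurableType d)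
    (R : realType) (mu : {measure set T -> \bar R}) (I : finType) (F : I -> set T) :
  (forall i, mu.-negligible (F i)) -> mu.-negligible (\bigcup_i F i).
Proof.
move=> nF; apply: (@negligibleS _ _ _ mu (\big[setU/set0]_(i : I) F i)).
  by move=> x [i _ Fx]; rewrite (bigD1 i)//=; left.
apply: big_ind => //; [exact: negligible_set0|exact: negligibleU].
Qed.

Section CarpetMeasure.
Context (R : realType) (D a : nat) (S : {set multi_index D a})
  (K : set 'rV[R]_D) (mu : probability (borelRV R D) R)
  (hK : gen_carpet S K) (hmu : self_similar S K mu).
Implicit Types (s t : seq (letter S)).

Local Notation sc := (scell K).
Let a1 := carpet_a_gt1 hK.
Let A0 : (0 : R) < a%:R := scale_gt0 R a1.
Let A0' : (a%:R : R) != 0 := scale_neq0 R a1.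

Lemma card_letters_gt0 : (0 < #|S|)%N.
Proof. by rewrite card_gt0; exact: carpet_nonempty hK. Qed.

Let N0 : (0 : R) < #|S|%:R. Proof. by rewrite ltr0n card_letters_gt0. Qed.

Lemma borel_open (A : set 'rV[R]_D) : open A -> measurable (A : set (borelRV R D)).
Proof. by move=> oA; exact: sub_sigma_algebra. Qed.

Lemma borel_closed (A : set 'rV[R]_D) : closed A -> measurable (A : set (borelRV R D)).
Proof.
move=> cA; rewrite -(setCK A); apply: measurableC; apply: borel_open.
by rewrite openC.
Qed.

Lemma measurable_carpet : measurable (K : set (borelRV R D)).
Proof. by apply: borel_closed; exact: carpet_closed hK. Qed.

Lemma measurable_scell s : measurable (sc s : set (borelRV R D)).
Proof. by apply: borel_closed; exact: scell_closed. Qed.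

Lemma mu_carpet : mu K = 1%E. Proof. by have [] := hmu. Qed.

Lemma mu_split (A : set (borelRV R D)) : measurable A ->
  (#|S|%:R%:E * mu A = \sum_(i in S) mu (K `&` @simil R D a i @^-1` A))%E.
Proof.
move=> mA; have [_ /(_ A mA) e] := hmu; rewrite e muleA -EFinM mulfV ?gt_eqF//.
by rewrite mul1e.
Qed.

Lemma mu_split0 (A : set (borelRV R D)) : measurable A ->
  (forall i, i \in S -> mu (K `&` @simil R D a i @^-1` A) = 0%E) -> mu A = 0%E.
Proof.
by move=> mA h; have [_ /(_ A mA) e] := hmu; rewrite e big1 ?mule0.
Qed.

Definition face (k : 'I_D) (b : bool) : set 'rV[R]_D :=
  K `&` [set x | x 0 k = if b then 1 else -1].

Lemma measurable_simil_preimage i (A : set 'rV[R]_D) : closed A ->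
  measurable (K `&` @simil R D a i @^-1` A : set (borelRV R D)).
Proof.
move=> cA; apply: measurableI; first exact: measurable_carpet.
apply: borel_closed; apply: preimage_closed cA => x _.
exact: affine_continuous.
Qed.

Lemma face_closed k b : closed (face k b).
Proof.
apply: closedI; first exact: carpet_closed hK.
apply: (@preimage_closed _ _ (fun x : 'rV[R]_D => x 0 k) [set if b then 1 else -1]).
  by move=> x _; exact: (@coord_continuous R 1 D 0 k x).
by apply: accessible_closed_set1; apply: hausdorff_accessible; exact: Rhausdorff.
Qed.

(* The letter at the corner opposite to a face does not touch it, so
   self-similarity shrinks the mass of the face by a factor less than [1]. *)
Lemma mu_face k b : mu (face k b) = 0%E.
Proof.
have mF : measurable (face k b : set (borelRV R D)) by apply: borel_closed; exact: face_closed.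
have [l lP] := corner_letter hK (fun=> ~~ b).
have lS : val l \in S by exact: valP l.
have fin : mu (face k b) \is a fin_num by exact: fin_num_measure.
have := mu_split mF; rewrite (bigD1 (val l))//=.
have -> : K `&` @simil R D a (val l) @^-1` face k b = set0.
  rewrite -subset0 => x [Kx [_ /=]]; rewrite (similE a1) lP.
  have /andP[x1 x2] := carpet_bounds hK k Kx.
  have A2 : (2 : R) <= a%:R by rewrite ler_nat.
  case: (b) => /= /(congr1 (fun z => (z + 1) * a%:R)); rewrite subrK divfK//; first by nra.
  by rewrite -subn1 natrB; [nra|lia].
rewrite measure0 add0e => h.
(* A point of K that a similitude sends into the face already lies on it. Each letter other than [l]
   thus contributes at most the mass m of the face, and N m <= (N - 1) m. *)
have : (#|S|%:R%:E * mu (face k b) <= \sum_(i in S | i != val l) mu (face k b))%E.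
  rewrite h; apply: lee_sum => i /andP[iS _]; apply: le_measure; rewrite ?inE//.
    by apply: measurable_simil_preimage; exact: face_closed.
  move=> x [Kx [_ /= e]]; split => //=; move: e; rewrite (similE a1).
  have /andP[x1 x2] := carpet_bounds hK k Kx.
  have iA : ((i k)%:R + 1 : R) <= a%:R by rewrite natr1 ler_nat.
  have i0 : (0 : R) <= (i k)%:R by [].
  by case: (b) => /= /(congr1 (fun z => (z + 1) * a%:R)); rewrite subrK divfK//; nra.
rewrite -(fineK fin) -EFinM sumEFin lee_fin => le.
have cS : (#|[pred i | (i \in S) && (i != val l)]| = #|S|.-1)%N.
  rewrite (cardD1 (val l) S) lS /=; apply: eq_card => i; by rewrite !inE andbC.
rewrite sumr_const cS -mulr_natl in le.
have : (#|S|.-1%:R + 1 = #|S|%:R :> R) by rewrite natr1 prednK// card_letters_gt0.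
have : 0 <= fine (mu (face k b)) by rewrite fine_ge0.
by move=> m0 e; congr EFin; nra.
Qed.

Definition bdry : set 'rV[R]_D := \bigcup_k (face k true `|` face k false).

Lemma mu_bdry : mu.-negligible (bdry : set (borelRV R D)).
Proof.
have nF k b : mu.-negligible (face k b : set (borelRV R D)).
  exists (face k b); split; [|exact: mu_face|by []].
  by apply: borel_closed; exact: face_closed.
by apply: negligible_bigcup_fin => k; exact: negligibleU.
Qed.

(** In a direction where the letters differ, the two cubes can only touch along opposite faces. *)
Lemma overlap_bdry (i j : letter S) x y : K x -> K y ->
  simil (val i) x = simil (val j) y -> i != j -> bdry x.
Proof.
move=> Kx Ky e ij.
have [k ijk] : exists k, val i k != val j k.
  apply/existsP; rewrite -negb_forall; apply: contra ij => /forallP h.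
  by apply/eqP/val_inj/ffunP => k; exact/eqP.
have := congr1 (fun z : 'rV[R]_D => (z 0 k + 1) * a%:R) e.
rewrite /= !(similE a1) !subrK !divfK// => {}e.
have /andP[x1 x2] := carpet_bounds hK k Kx.
have /andP[y1 y2] := carpet_bounds hK k Ky.
exists k => //; have [lt|gt|/val_inj/eqP] := ltngtP (val i k) (val j k); last by rewrite (negbTE ijk).
  have : ((val i k)%:R + 1 : R) <= (val j k)%:R by rewrite natr1 ler_nat.
  by left; split => //=; lra.
have : ((val j k)%:R + 1 : R) <= (val i k)%:R by rewrite natr1 ler_nat.
by right; split => //=; lra.
Qed.

Lemma preimage_cons_neq (i j : letter S) s : i != j ->
  K `&` @simil R D a (val i) @^-1` sc (j :: s) `<=` bdry.
Proof.
move=> ij x [Kx [y Ky e]]; apply: (overlap_bdry Kx _ (esym e) ij).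
exact: carpet_smap.
Qed.

Lemma preimage_cons (i : letter S) s :
  K `&` @simil R D a (val i) @^-1` sc (i :: s) = sc s.
Proof.
have si : injective (@simil R D a (val i)).
  by move=> x y e; apply: (@smap_inj R D a S a1 [:: i]).
apply/seteqP; split=> x.
  by move=> [Kx [y Ky /si <-]]; exists y.
by move=> sx; split; [exact: scell_sub sx|move: sx => [y Ky <-]; exists y].
Qed.

Lemma negligible_mu0 (A B : set (borelRV R D)) : measurable A ->
  A `<=` B -> mu.-negligible B -> mu A = 0%E.
Proof. by move=> mA AB nB; apply: measure_negligible => //; exact: negligibleS nB. Qed.

(** In the self-similarity formula for a cell only its first letter counts: the preimages under the
    other maps lie in the null set [bdry]. *)
Lemma mu_scell s : mu (sc s) = ((#|S|%:R ^+ size s)^-1)%:E.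
Proof.
elim: s => [|i s IH]; first by rewrite /scell /smap /= image_id expr0 invr1 mu_carpet.
have [_ /(_ _ (measurable_scell (i :: s))) ->] := hmu.
rewrite (bigD1 (val i)) ?(valP i)//= big1 => [|j /andP[jS ji]].
  by rewrite adde0 preimage_cons IH -EFinM -invfM -exprS.
apply: negligible_mu0 mu_bdry.
  by apply: measurable_simil_preimage; exact: scell_closed.
by apply: (@preimage_cons_neq (exist _ j jS) i s).
Qed.

(** Pulling back by a letter strips equal first letters and leads to shorter words; if one of the
    words starts with another letter, the preimage lies in [bdry]. *)
Lemma mu_scell_overlap s t : size s = size t -> s != t -> mu (sc s `&` sc t) = 0%E.
Proof.
elim: s t => [|i s IH] [|j t]//= [st] ne.
apply: mu_split0; first by apply: measurableI; exact: measurable_scell.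
move=> l lS.
have mm : measurable (K `&` @simil R D a l @^-1` (sc (i :: s) `&` sc (j :: t)) : set (borelRV R D)).
  by apply: measurable_simil_preimage; apply: closedI; exact: scell_closed.
pose l' : letter S := exist _ l lS.
have [li|li] := eqVneq l' i; last first.
  apply: negligible_mu0 mu_bdry => //.
  by move=> x [Kx [h _]]; apply: (preimage_cons_neq li); split; [exact: Kx|exact: h].
have [lj|lj] := eqVneq l' j; last first.
  apply: negligible_mu0 mu_bdry => //.
  by move=> x [Kx [_ h]]; apply: (preimage_cons_neq lj); split; [exact: Kx|exact: h].
have {}ne : s != t by apply: contra ne => /eqP ->; rewrite -li -lj.
rewrite -[RHS](IH t st ne); congr (mu _).
rewrite -(preimage_cons i s) -(preimage_cons i t) -{1}li -lj -li /=.
by apply/seteqP; split => x; [move=> [? [? ?]]|move=> [[? ?] [? ?]]].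
Qed.

End CarpetMeasure.

(** * Power inequalities and Jensen's inequality *)

Section PowerInequalities.
Context (R : realType).
Implicit Types p x y z : R.

Lemma powR_le_nneg p x y : 0 <= p -> 0 <= x -> x <= y -> x `^ p <= y `^ p.
Proof.
move=> p0 x0 xy; apply: ge0_ler_powR; rewrite ?nnegrE//; exact: le_trans xy.
Qed.

Lemma powR_add_le p x y : 0 <= p -> 0 <= x -> 0 <= y ->
  (x + y) `^ p <= 2 `^ p * (x `^ p + y `^ p).
Proof.
move=> p0 x0 y0; wlog xy : x y x0 y0 / x <= y.
  move=> h; have [/h|/ltW/h] := leP x y; first exact.
  by rewrite (addrC y) (addrC (y `^ p)); exact.
apply: (@le_trans _ _ ((2 * y) `^ p)); first by apply: powR_le_nneg => //; lra.
by rewrite powRM// ler_pM2l ?powR_gt0// lerDr powR_ge0.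
Qed.

Lemma powR_dist_le p x y z : 0 <= p ->
  `|x - z| `^ p <= 2 `^ p * (`|x - y| `^ p + `|y - z| `^ p).
Proof.
move=> p0; apply: le_trans (powR_add_le p0 (normr_ge0 _) (normr_ge0 _)).
by apply: powR_le_nneg => //; exact: ler_distD.
Qed.

(* The tangent of [t^p] at [M], from Young's inequality with conjugate
   exponents [p] and [p/(p-1)]. *)
Lemma powR_tangent p x M : 1 < p -> 0 <= x -> 0 <= M ->
  p * M `^ (p - 1) * x <= x `^ p + (p - 1) * M `^ p.
Proof.
move=> p1 x0 M0; have q0 : 0 < p / (p - 1) by rewrite divr_gt0; lra.
have := @conjugate_powR _ x (M `^ (p - 1)) p (p / (p - 1)) x0 (powR_ge0 _ _).
have e : p^-1 + (p / (p - 1))^-1 = 1 by field; apply/andP; split; lra.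
have p0 : 0 < p by lra.
move=> /(_ p0 q0 e); rewrite -powRrM.
have -> : (p - 1) * (p / (p - 1)) = p by field; lra.
move=> h; rewrite -(ler_pM2l (_ : 0 < p^-1)) ?invr_gt0//.
apply: le_trans (_ : x * M `^ (p - 1) <= _); last apply: le_trans h _.
  by rewrite le_eqVlt; apply/orP; left; apply/eqP; field; lra.
by rewrite le_eqVlt; apply/orP; left; apply/eqP; field; apply/andP; split; lra.
Qed.

End PowerInequalities.

Section GeneralIntegral.
Context (d : measure_display) (T : measurableType d) (R : realType).

(** The integral of a nonnegative function is a supremum over the simple functions below it, so it
    is monotone even on functions whose measurability is unknown, such as the integrand of
    [korevaar_schoen]. *)
Lemma ge0_le_integral_weak (mu : {measure set T -> \bar R}) (A : set T) (f g : T -> \bar R) :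
  (forall x, A x -> 0 <= f x)%E -> (forall x, A x -> f x <= g x)%E ->
  (\int[mu]_(x in A) f x <= \int[mu]_(x in A) g x)%E.
Proof.
move=> f0 fg; rewrite !ge0_integralE//; last first.
  by move=> x Ax; apply: le_trans (fg x Ax); exact: f0.
apply: le_ereal_sup => _ [h hf <-]; exists h => // x; apply: le_trans (hf x) _.
by rewrite /patch; case: ifPn => // /set_mem; exact: fg.
Qed.

Lemma measurable_normpow (A : set T) (g : T -> R) (p : R) : measurable_fun A g ->
  measurable_fun A (EFin \o (fun x => `|g x| `^ p)).
Proof.
move=> mg; apply/measurable_EFinP.
apply: (measurableT_comp (measurable_powR p)).
exact: measurableT_comp.
Qed.

(** The tangent inequality at M, the mean of |g|, is integrated over A. The extended reals allow an
    infinite right side. *)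
Lemma jensen_powR (mu : {measure set T -> \bar R}) (A : set T) (g : T -> R) (m p : R) :
  measurable A -> mu A = m%:E -> 0 < m -> 1 < p -> mu.-integrable A (EFin \o g) ->
  ((`|m^-1 * \int[mu]_(x in A) g x| `^ p)%:E <= m^-1%:E * \int[mu]_(x in A) (`|g x| `^ p)%:E)%E.
Proof.
move=> mA muA m0 p1 ig.
have mg : measurable_fun A g by apply/measurable_EFinP; exact: measurable_int ig.
pose M := m^-1 * \int[mu]_(x in A) `|g x|.
have igabs : mu.-integrable A (EFin \o (fun x => `|g x|)) by exact: integrable_norm.
have M0 : 0 <= M by rewrite mulr_ge0 ?invr_ge0 ?(ltW m0)// Rintegral_ge0.
have gM : `|m^-1 * \int[mu]_(x in A) g x| <= M.
  rewrite normrM (ger0_norm (_ : 0 <= m^-1)) ?invr_ge0 ?(ltW m0)//.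
  by rewrite ler_pM2l ?invr_gt0//; exact: le_normr_Rintegral.
apply: (@le_trans _ _ (M `^ p)%:E).
  by rewrite lee_fin; apply: powR_le_nneg; rewrite ?normr_ge0//; lra.
have : (\int[mu]_(x in A) (p * M `^ (p - 1) * `|g x|)%:E <=
        \int[mu]_(x in A) ((`|g x| `^ p)%:E + ((p - 1) * M `^ p)%:E))%E.
  apply: ge0_le_integral_weak => x _; last by rewrite -EFinD lee_fin; exact: powR_tangent.
  by rewrite lee_fin !mulr_ge0 ?powR_ge0//; lra.
have c0 : 0 <= (p - 1) * M `^ p by rewrite mulr_ge0 ?powR_ge0//; lra.
rewrite ge0_integralD//; last exact: measurable_normpow.
under eq_integral do rewrite EFinM.
rewrite ge0_integralZl//; first last.
- by rewrite lee_fin mulr_ge0 ?powR_ge0//; lra.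
- by apply/measurable_EFinP; exact: measurableT_comp.
rewrite (integral_cst mu mA) muA.
have -> : (\int[mu]_(x in A) `|g x|%:E = (M * m)%:E)%E.
  rewrite /M mulrC mulrA mulfV ?gt_eqF// mul1r /Rintegral fineK//.
  exact: integrable_fin_num igabs.
rewrite -!EFinM => h.
have eM : p * M `^ (p - 1) * (M * m) = M `^ p * m + (p - 1) * M `^ p * m.
  have -> : M `^ p = M `^ (p - 1) * M.
    by rewrite mulrC mulr_powRB1//; lra.
  by ring.
rewrite eM EFinD leeD2rE// in h.
rewrite muleC lee_pdivlMr// -EFinM.
Qed.

End GeneralIntegral.

(** * Partition into cores and cell averages *)

Section Cores.
Context (R : realType) (D a : nat) (S : {set multi_index D a})
  (K : set 'rV[R]_D) (mu : probability (borelRV R D) R)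
  (hK : gen_carpet S K) (hmu : self_similar S K mu).
Implicit Types (s t : seq (letter S)).

Local Notation sc := (scell K).
Local Notation N := (#|S|%:R : R).

Let N0 : 0 < N. Proof. by rewrite ltr0n (card_letters_gt0 hK). Qed.
Let Nn0 n : 0 < N ^+ n. Proof. by rewrite exprn_gt0. Qed.

(* Removing the null set of all overlaps turns the cells of each level into a
   genuine partition. *)
Definition overlaps : set (borelRV R D) :=
  \bigcup_n \bigcup_(vw : word S n * word S n)
    (if vw.1 != vw.2 then sc vw.1 `&` sc vw.2 else set0).

Definition core s : set (borelRV R D) := sc s `\` overlaps.

Definition full : set (borelRV R D) := K `\` overlaps.

Lemma measurable_overlaps : measurable overlaps.
Proof.
apply: bigcup_measurable => n _; apply: fin_bigcup_measurable; first exact: finite_finset.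
move=> -[v w] _ /=.
by case: ifP => // _; apply: measurableI; exact: (measurable_scell hK).
Qed.

Lemma mu_overlaps : mu overlaps = 0%E.
Proof.
apply: measure_negligible; first exact: measurable_overlaps.
apply: negligible_bigcup => n; apply: negligible_bigcup_fin => -[v w] /=.
case: ifPn => [vw|_]; last exact: negligible_set0.
exists (sc v `&` sc w); split => //.
  by apply: measurableI; exact: (measurable_scell hK).
by apply: (mu_scell_overlap hK hmu) => //; rewrite !size_tuple.
Qed.

Lemma measurable_core s : measurable (core s).
Proof. by apply: measurableD; [exact: (measurable_scell hK)|exact: measurable_overlaps]. Qed.

Lemma mu_core s : mu (core s) = ((N ^+ size s)^-1)%:E.
Proof.
rewrite -(mu_scell hK hmu) /core measureD.
- rewrite [X in (_ - X)%E](_ : _ = 0%E) ?sube0//.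
  apply: (@subset_measure0 _ _ _ mu _ overlaps) => //; last exact: mu_overlaps.
    by apply: measurableI; [exact: (measurable_scell hK)|exact: measurable_overlaps].
  exact: measurable_overlaps.
- exact: (measurable_scell hK).
- exact: measurable_overlaps.
- by rewrite -ge0_fin_numE// fin_num_measure//; exact: (measurable_scell hK).
Qed.

Lemma core_inj s t x : size s = size t -> core s x -> core t x -> s = t.
Proof.
move=> st [sx Zx] [tx _]; apply/eqP; apply: contrapT => /negP ne; apply: Zx.
have tsz : size t == size s by rewrite st.
exists (size s) => //; exists (in_tuple s, Tuple tsz) => //=.
by rewrite ifT//; apply: contra ne => /eqP/(congr1 val) /= ->.
Qed.

Lemma core_cover n x : K x -> ~ overlaps x -> exists w : word S n, core w x.
Proof. by move=> Kx Zx; have [w wx] := scell_cover hK n Kx; exists w. Qed.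

Lemma core_take n s x : core s x -> core (take n s) x.
Proof. by move=> [sx Zx]; split => //; exact: (scell_take hK n sx). Qed.

Lemma core_bigsetU n : full = \big[setU/set0]_(w : word S n) core w.
Proof.
apply/seteqP; split => x.
  move=> [Kx Zx]; have [w wx] := core_cover n Kx Zx.
  by rewrite (bigD1 w)//=; left.
apply: (big_ind (fun A : set (borelRV R D) => A `<=` full)) => //.
  by move=> A B hA hB y [/hA|/hB].
by move=> w _ y [wy Zy]; split => //; exact: (scell_sub hK wy).
Qed.

Lemma core_rcons_bigsetU s : core s = \big[setU/set0]_(i : letter S) core (rcons s i).
Proof.
apply/seteqP; split => x.
  move=> [/scell_cover_rcons -/(_ hK)[i ix] Zx].
  by rewrite (bigD1 i)//=; left.
apply: (big_ind (fun A : set (borelRV R D) => A `<=` core s)) => //.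
  by move=> A B hA hB y [/hA|/hB].
move=> i _ y /(core_take (size s)).
by rewrite -cats1 take_size_cat.
Qed.

Lemma core_trivIset n : trivIset [set` index_enum (word S n)] (fun w : word S n => core w).
Proof.
move=> v w _ _ [x [vx wx]]; apply: val_inj; apply: (core_inj _ vx wx).
by rewrite !size_tuple.
Qed.

Lemma core_rcons_trivIset s : trivIset [set` index_enum (letter S)] (fun i => core (rcons s i)).
Proof.
move=> i j _ _ [x [ix jx]].
have /rcons_inj[] : rcons s i = rcons s j by apply: (core_inj _ ix jx); rewrite !size_rcons.
by [].
Qed.

Lemma measurable_full : measurable full.
Proof. by apply: measurableD; [exact: (measurable_carpet hK)|exact: measurable_overlaps]. Qed.

Lemma integral_full (h : borelRV R D -> \bar R) :
  measurable_fun setT h -> (forall x, 0 <= h x)%E ->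
  (\int[mu]_x h x = \int[mu]_(x in full) h x)%E.
Proof.
move=> mh h0.
pose E := ~` full.
have mE : measurable E.
  by apply: measurableC; exact: measurable_full.
have muE : mu E = 0%E.
  rewrite /E /full setDE setCI setCK; apply: measure_negligible.
    apply: measurableU; last exact: measurable_overlaps.
    by apply: measurableC; exact: (measurable_carpet hK).
  apply: negligibleU; last first.
    by exists overlaps; split => //; [exact: measurable_overlaps|exact: mu_overlaps].
  exists (~` K); split => //; first by apply: measurableC; exact: (measurable_carpet hK).
  have := probability_setC mu (measurable_carpet hK).
  by rewrite (mu_carpet hmu) subee.
rewrite (ge0_negligible_integral mE measurableT mh _ muE)//.
by rewrite setTD /E setCK.
Qed.

Lemma integral_cores n (h : borelRV R D -> \bar R) :
  measurable_fun setT h -> (forall x, 0 <= h x)%E ->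
  (\int[mu]_x h x = \sum_(w : word S n) \int[mu]_(x in core w) h x)%E.
Proof.
move=> mh h0; rewrite integral_full// (core_bigsetU n) ge0_integral_bigsetU//.
- by move=> w; exact: measurable_core.
- exact: index_enum_uniq.
- exact: core_trivIset.
- by rewrite -core_bigsetU; apply: measurable_funTS.
Qed.

Definition mean (f : borelRV R D -> R) s : R :=
  N ^+ size s * \int[mu]_(x in sc s) f x.

Lemma Mn_mean n (f : borelRV R D -> R) (w : word S n) : @Mn R D a S K mu n f w = mean f w.
Proof. by rewrite /Mn /mean size_tuple. Qed.

Section Integrable.
Context (f : borelRV R D -> R) (fi : mu.-integrable setT (EFin \o f)).

Let fi_core s : mu.-integrable (core s) (EFin \o f).
Proof. by apply: integrableS fi => //; exact: measurable_core. Qed.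

Lemma mean_core s : mean f s = N ^+ size s * \int[mu]_(x in core s) f x.
Proof.
congr (_ * _); congr fine; apply: negligible_integral => //.
- exact: measurable_overlaps.
- exact: (measurable_scell hK).
- by apply: integrableS fi => //; exact: (measurable_scell hK).
- exact: mu_overlaps.
Qed.

Lemma mean_rcons s : mean f s = N^-1 * \sum_(i : letter S) mean f (rcons s i).
Proof.
have mf : measurable_fun setT (EFin \o f) by exact: measurable_int fi.
rewrite mean_core {1}core_rcons_bigsetU /Rintegral integral_bigsetU_EFin; first last.
- by rewrite -core_rcons_bigsetU; exact: measurable_funTS.
- exact: core_rcons_trivIset.
- exact: index_enum_uniq.
- by move=> i; exact: measurable_core.
rewrite -sum_fine => [|i _]; last first.
  by apply: integrable_fin_num; [exact: measurable_core|exact: fi_core].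
under [in RHS]eq_bigr do rewrite mean_core size_rcons.
rewrite -mulr_sumr mulrA exprS mulrA mulVf ?gt_eqF// mul1r; congr (_ * _).
Qed.

Lemma mean_jensen p s c : 1 < p ->
  ((`|mean f s - c| `^ p)%:E <=
    (N ^+ size s)%:E * \int[mu]_(x in core s) (`|f x - c| `^ p)%:E)%E.
Proof.
move=> p1.
have mc := measurable_core s.
have ci : mu.-integrable (core s) (EFin \o cst c) by exact: finite_measure_integrable_cst.
have gi : mu.-integrable (core s) (EFin \o (fun x => f x - c)).
  by have := integrableB mc (fi_core s) ci.
have m0 : 0 < (N ^+ size s)^-1 by rewrite invr_gt0.
have := jensen_powR mc (mu_core s) m0 p1 gi.
rewrite invrK (RintegralB mc (fi_core s) ci).
have -> : \int[mu]_(x in core s) cst c x = c * (N ^+ size s)^-1.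
  by transitivity (c * fine (mu (core s))); [exact: Rintegral_cst|rewrite mu_core].
by rewrite mulrBr mulrCA mulfV ?gt_eqF// mulr1 -mean_core.
Qed.

End Integrable.

End Cores.

(** * Step functions *)

Section StepFunctions.
Import HBNNSimple.
Context (R : realType) (D a : nat) (S : {set multi_index D a})
  (K : set 'rV[R]_D) (mu : probability (borelRV R D) R)
  (hK : gen_carpet S K) (hmu : self_similar S K mu) (p : R) (p1 : 1 < p).
Implicit Types (s t : seq (letter S)) (c : seq (letter S) -> R) (f g h : borelRV R D -> R).

Local Notation N := (#|S|%:R : R).
Local Notation core := (core K).
Local Notation overlaps := (@overlaps R D a S K).
Local Notation ind A := (\1_(A : set (borelRV R D)) : borelRV R D -> R).
Local Notation mT := (measurable_fun [set: borelRV R D]).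

Let N0 : 0 < N. Proof. by rewrite ltr0n (card_letters_gt0 hK). Qed.
Let pgt0 : 0 < p. Proof. exact: lt_trans ltr01 p1. Qed.
Let p0 : 0 <= p. Proof. exact: ltW. Qed.
Let pn0 : p != 0. Proof. exact: lt0r_neq0. Qed.

(** The coefficients are defined on words of every length, so that the averages form a single [c]
    for all levels, and [c \o take n] rewrites a step function of level n at a finer level. *)
Definition step n c : borelRV R D -> R :=
  fun x => \sum_(w : word S n) c (tval w) * \1_(core w) x.

Lemma measurable_step n c : mT (step n c).
Proof.
apply: measurable_sum => w; apply: measurable_funM; first exact: measurable_cst.
by apply: measurable_indic; exact: (measurable_core hK).
Qed.

Lemma stepE n c (w : word S n) x : core w x -> step n c x = c w.
Proof.
move=> wx; rewrite /step (bigD1 w)//= indicE mem_set// mulr1 big1 ?addr0// => v vw.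
rewrite indicE memNset ?mulr0// => vx; case/eqP: vw; apply: val_inj.
by apply: (core_inj _ vx wx); rewrite !size_tuple.
Qed.

Lemma step_take n m c x : K x -> ~ overlaps x -> (n <= m)%N ->
  step n c x = step m (c \o take n) x.
Proof.
move=> Kx Zx nm; have [w wx] := core_cover hK m Kx Zx; rewrite (stepE _ wx).
have tsz : size (take n w) == n by rewrite size_takel ?size_tuple.
by rewrite (@stepE n c (Tuple tsz))//=; exact: (core_take hK).
Qed.

Definition Lp h : \bar R := (\int[mu]_x (`|h x| `^ p)%:E)%E.

Let normpow_ge0 h (x : borelRV R D) : (0 <= (`|h x| `^ p)%:E)%E.
Proof. by rewrite lee_fin powR_ge0. Qed.

Lemma Lp_ge0 h : (0 <= Lp h)%E. Proof. by apply: integral_ge0 => x _; exact: normpow_ge0. Qed.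

Lemma Lp_full h : mT h -> (Lp h = \int[mu]_(x in full S K) (`|h x| `^ p)%:E)%E.
Proof.
by move=> mh; exact: (integral_full hK hmu (measurable_normpow p mh) (normpow_ge0 h)).
Qed.

Lemma Lp_cores n h : mT h ->
  (Lp h = \sum_(w : word S n) \int[mu]_(x in core w) (`|h x| `^ p)%:E)%E.
Proof. by move=> mh; exact: (integral_cores hK hmu n (measurable_normpow p mh) (normpow_ge0 h)). Qed.

Lemma eq_Lp f g : mT f -> mT g ->
  (forall x, K x -> ~ overlaps x -> f x = g x) -> Lp f = Lp g.
Proof.
move=> mf mg fg; rewrite (Lp_full mf) (Lp_full mg).
by apply: eq_integral => x /set_mem[Kx Zx]; rewrite fg.
Qed.

Lemma le_Lp f g : mT f -> mT g ->
  (forall x, K x -> ~ overlaps x -> `|f x| <= `|g x|) -> (Lp f <= Lp g)%E.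
Proof.
move=> mf mg fg; rewrite (Lp_full mf) (Lp_full mg).
apply: ge0_le_integral_weak => // x [Kx Zx].
by rewrite lee_fin; apply: powR_le_nneg => //; exact: fg.
Qed.

(** The sharp triangle inequality, written on p-th powers: sums of unbounded length cannot afford
    the factor 2^p of [LpD_le] at each term. *)
Lemma Lp_minkowski f g (A B : R) : mT f -> mT g -> 0 <= A -> 0 <= B ->
  (Lp f <= (A `^ p)%:E)%E -> (Lp g <= (B `^ p)%:E)%E ->
  (Lp (f \+ g)%R <= ((A + B) `^ p)%:E)%E.
Proof.
move=> mf mg A0 B0 fA gB.
have LpE h : Lp h = poweR ('N[mu]_p%:E[EFin \o h])%E p.
  by rewrite poweR_Lnorm//; apply: eq_integral => x _; rewrite poweR_EFin.
have nrm h C : 0 <= C -> (Lp h <= (C `^ p)%:E)%E -> ('N[mu]_p%:E[EFin \o h] <= C%:E)%E.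
  move=> C0 hC; have -> : ('N[mu]_p%:E[EFin \o h] = poweR (Lp h) p^-1)%E.
    by rewrite LpE -poweRrM mulfV// poweRe1 ?Lnorm_ge0.
  have -> : C%:E = poweR (C `^ p)%:E p^-1.
    by rewrite poweR_EFin -powRrM mulfV// powRr1.
  apply: gt0_ler_poweR => //; rewrite ?invr_ge0// in_itv /= ?leey ?andbT ?Lp_ge0//.
  by rewrite lee_fin powR_ge0.
rewrite LpE -poweR_EFin; apply: gt0_ler_poweR => //.
- by rewrite in_itv /= leey andbT Lnorm_ge0.
- by rewrite in_itv /= leey andbT lee_fin addr_ge0.
- apply: le_trans (minkowski_EFin _ mf mg (ltW p1)) _.
  by rewrite EFinD; apply: leeD; apply: nrm.
Qed.

Lemma LpD_le f g : mT f -> mT g ->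
  (Lp (f \+ g)%R <= (2 `^ p)%:E * (Lp f + Lp g))%E.
Proof.
move=> mf mg; rewrite /Lp -ge0_integralD//; try exact: measurable_normpow.
rewrite -ge0_integralZl//; first last.
- by move=> x _; rewrite -EFinD lee_fin addr_ge0 ?powR_ge0.
- by apply: emeasurable_funD; exact: measurable_normpow.
apply: ge0_le_integral_weak => // x _; rewrite -EFinD -EFinM lee_fin.
apply: le_trans (powR_add_le p0 (normr_ge0 _) (normr_ge0 _)).
by apply: powR_le_nneg => //; exact: ler_normD.
Qed.

Lemma LpZ (k : R) f : mT f -> (Lp (fun x => k * f x)%R = (`|k| `^ p)%:E * Lp f)%E.
Proof.
move=> mf; rewrite /Lp -ge0_integralZl//; last exact: measurable_normpow.
by apply: eq_integral => x _; rewrite normrM powRM.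
Qed.

Lemma Lp_dominated (F : nat -> borelRV R D -> R) g : (forall n, mT (F n)) -> mT g ->
  (Lp g < +oo)%E ->
  (forall n x, K x -> ~ overlaps x -> `|F n x| <= `|g x|) ->
  (forall x, K x -> ~ overlaps x -> F ^~ x @ \oo --> 0) ->
  forall e, 0 < e -> exists n, (Lp (F n) <= e%:E)%E.
Proof.
move=> mF mg gfin Fg F0 e e0.
have mX := measurable_full hK.
have [|||||_ _ cv] := @dominated_convergence _ _ R mu _ mX
  (fun n x => (`|F n x| `^ p)%:E) (cst 0%E) (fun x => (`|g x| `^ p)%:E).
- by move=> n; apply: measurable_funTS; exact: measurable_normpow.
- exact: measurable_cst.
- apply: aeW => x [Kx Zx].
  apply: cvg_EFin; first exact: nearW.
  rewrite /comp /=.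
  move/cvgrPdist_lt: (F0 x Kx Zx) => Fx.
  apply/cvgrPdist_lt => r r0; have q0 : 0 < r `^ p^-1 by exact: powR_gt0.
  have {}Fx := Fx _ q0; near=> n.
  rewrite sub0r normrN ger0_norm ?powR_ge0//.
  rewrite -[X in _ < X](powRr1 (ltW r0)) -(mulVf pn0) powRrM.
  apply: gt0_ltr_powR; rewrite ?nnegrE ?powR_ge0//.
  have : `|0 - F n x| < r `^ p^-1 by near: n.
  by rewrite sub0r normrN.
- apply/integrableP; split; first by apply: measurable_funTS; exact: measurable_normpow.
  apply: le_lt_trans gfin; rewrite (Lp_full mg).
  by apply: ge0_le_integral_weak => // x _; rewrite gee0_abs.
- apply: aeW => x n [Kx Zx]; rewrite gee0_abs// lee_fin.
  by apply: powR_le_nneg => //; exact: Fg.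
move: cv; rewrite integral0 => /fine_cvgP[fin cv].
move/cvgrPdist_lt: cv => /(_ _ e0) nb.
have [n _ hn] := filterI fin nb; have [h1 h2] := hn n (leqnn n).
exists n; rewrite (Lp_full (mF n)).
move: h1 h2; rewrite /= => h1; rewrite sub0r normrN -{2}(fineK h1) lee_fin => h2.
by apply: le_trans (ltW h2); exact: ler_norm.
Unshelve. all: by end_near. Qed.

Definition approximable f : Prop :=
  forall e : R, 0 < e -> exists n c, (Lp (f \- step n c)%R <= e%:E)%E.

Lemma approximable_common f n c m : mT f -> (n <= m)%N ->
  Lp (f \- step n c) = Lp (f \- step m (c \o take n)).
Proof.
move=> mf nm; apply: eq_Lp; try by apply: measurable_funB => //; exact: measurable_step.
by move=> x Kx Zx /=; rewrite (step_take c Kx Zx nm).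
Qed.

Lemma approximableD f g : mT f -> mT g -> approximable f -> approximable g ->
  approximable (f \+ g).
Proof.
move=> mf mg af ag e e0.
have t0 : 0 < 2 `^ p :> R by exact: powR_gt0.
have e0' : 0 < e / (2 * 2 `^ p) by rewrite divr_gt0// mulr_gt0.
have [n [c hc]] := af _ e0'; have [m [d hd]] := ag _ e0'.
rewrite (approximable_common c mf (leq_maxl n m)) in hc.
rewrite (approximable_common d mg (leq_maxr n m)) in hd.
exists (maxn n m), (fun s => c (take n s) + d (take m s)).
set l := maxn n m in hc hd *.
have mstep q b : mT (step q b) by exact: measurable_step.
have -> : Lp ((f \+ g) \- step l (fun s => c (take n s) + d (take m s)))
    = Lp ((f \- step l (c \o take n)) \+ (g \- step l (d \o take m))).
  congr Lp; apply/funext => x /=; rewrite /step.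
  under eq_bigr do rewrite mulrDl.
  by rewrite big_split /=; ring.
apply: le_trans (LpD_le _ _) _; try exact: measurable_funB.
apply: (@le_trans _ _ ((2 `^ p)%:E * ((e / (2 * 2 `^ p))%:E + (e / (2 * 2 `^ p))%:E))%E).
  by apply: lee_wpmul2l; [rewrite lee_fin ltW|exact: leeD hc hd].
by rewrite -EFinD -EFinM lee_fin; rewrite le_eqVlt; apply/orP; left; apply/eqP; field; lra.
Qed.

Lemma Lp_cst (r : R) : Lp (cst r) = (`|r| `^ p)%:E.
Proof.
transitivity ((`|r| `^ p)%:E * mu [set: borelRV R D])%E.
  exact: (integral_cst mu measurableT (`|r| `^ p)%:E).
by rewrite probability_setT mule1.
Qed.

Lemma approximableZ (k : R) f : mT f -> approximable f -> approximable (fun x => k * f x).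
Proof.
move=> mf af e e0; have q0 : 0 < `|k| `^ p + 1 by rewrite ltr_wpDl ?powR_ge0.
have [n [c hc]] := af _ (divr_gt0 e0 q0).
exists n, (fun s => k * c s).
have -> : ((fun x => k * f x) \- step n (fun s => k * c s)) = (fun x => k * (f \- step n c) x).
  apply/funext => x /=; rewrite mulrBr /step mulr_sumr; congr (_ - _).
  by apply: eq_bigr => w _; rewrite mulrA.
rewrite LpZ; last by apply: measurable_funB => //; exact: measurable_step.
apply: (@le_trans _ _ ((`|k| `^ p)%:E * (e / (`|k| `^ p + 1))%:E)%E).
  by apply: lee_wpmul2l => //; rewrite lee_fin powR_ge0.
rewrite -EFinM lee_fin mulrA ler_pdivrMr// mulrC ler_pM2l//; lra.
Qed.

Lemma approximable_lim f : mT f ->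
  (forall e, 0 < e -> exists g, [/\ mT g, approximable g & (Lp (f \- g)%R <= e%:E)%E]) ->
  approximable f.
Proof.
move=> mf h e e0.
have t0 : 0 < 2 `^ p :> R by exact: powR_gt0.
have e0' : 0 < e / (2 * 2 `^ p) by rewrite divr_gt0// mulr_gt0.
have [g [mg ag fg]] := h _ e0'; have [n [c hc]] := ag _ e0'.
have ms := measurable_step n c.
exists n, c; have -> : f \- step n c = (f \- g) \+ (g \- step n c).
  by apply/funext => x /=; ring.
apply: le_trans (LpD_le (measurable_funB mf mg) (measurable_funB mg ms)) _.
apply: (@le_trans _ _ ((2 `^ p)%:E * ((e / (2 * 2 `^ p))%:E + (e / (2 * 2 `^ p))%:E))%E).
  by apply: lee_wpmul2l; [rewrite lee_fin ltW|exact: leeD fg hc].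
by rewrite -EFinD -EFinM lee_fin; rewrite le_eqVlt; apply/orP; left; apply/eqP; field; lra.
Qed.

Lemma approximable_cst (r : R) : approximable (cst r).
Proof.
move=> e e0; exists 0%N, (fun=> r).
rewrite (@eq_Lp _ (cst 0)).
- by rewrite Lp_cst normr0 powR0// lee_fin ltW.
- by apply: measurable_funB => //; exact: measurable_step.
- exact: measurable_cst.
- move=> x Kx Zx /=; have [w wx] := core_cover hK 0 Kx Zx.
  by rewrite (stepE _ wx) subrr.
Qed.

Lemma approximable_sum (I : Type) (r : seq I) (F : I -> borelRV R D -> R) :
  (forall i, mT (F i)) -> (forall i, approximable (F i)) ->
  approximable (fun x => \sum_(i <- r) F i x).
Proof.
move=> mF aF; elim: r => [|i r IH].
  rewrite (_ : (fun _ => _) = cst 0); first exact: approximable_cst.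
  by apply/funext => x; rewrite big_nil.
rewrite (_ : (fun _ => _) = F i \+ (fun x => \sum_(j <- r) F j x)).
  exact: (approximableD (mF i) (measurable_sum _ mF) (aF i) IH).
by apply/funext => x; rewrite big_cons.
Qed.

Lemma approximable_open (U : set 'rV[R]_D) : open U ->
  approximable (ind U).
Proof.
move=> oU e e0.
have mU : mT (ind U) by apply: measurable_indic; exact: borel_open.
(* The cells contained in U exhaust U up to overlaps, because the cells around a point of U shrink
   to it. *)
pose c s : R := if `[< scell K s `<=` U >] then 1 else 0.
have val01 n x : K x -> ~ overlaps x ->
    (ind U \- step n c) x = 0 \/
    (ind U \- step n c) x = 1.
  move=> Kx Zx; have [w wx] := core_cover hK n Kx Zx.
  rewrite /= (stepE _ wx) /c; case: asboolP => [wU|_].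
    by left; rewrite indicE mem_set ?subrr//; apply: wU; case: wx.
  by rewrite subr0 indicE; case: (_ \in _); [right|left].
have [|||||n hn] := @Lp_dominated (fun n => ind U \- step n c) (cst 1) _ _ _ _ _ e e0.
- by move=> n; apply: measurable_funB => //; exact: measurable_step.
- exact: measurable_cst.
- by rewrite Lp_cst ltry.
- by move=> n x Kx Zx; have [->|->] := val01 n x Kx Zx; rewrite ?normr0 ?normr1.
- move=> x Kx Zx.
  have [Ux|nUx] := pselect (U x); last first.
    apply: cvg_near_cst; apply: nearW => n.
    have [w wx] := core_cover hK n Kx Zx; rewrite /= (stepE _ wx) /c.
    case: asboolP => [wU|_]; first by exfalso; apply: nUx; apply: wU; case: wx.
    by rewrite indicE memNset// subr0.
  have : nbhs x U by exact: open_nbhs_nbhs.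
  rewrite -filter_from_ballE => -[r /= r0 rU].
  have [m hm] := apow_small hK r0.
  apply: cvg_near_cst; exists m => // n /= mn; have [w wx] := core_cover hK n Kx Zx; rewrite (stepE _ wx) /c.
  rewrite asboolT; first by rewrite indicE mem_set// subrr.
  move=> y wy; apply: rU; rewrite -ball_normE /ball_ /=.
  rewrite /Num.norm /= mx_normrE; apply: bigmax_lt => // -[i k] _ /=; rewrite !mxE (ord1 i).
  have A0 := apow_gt0 hK n.
  have := scell_close hK k (erefl (size w)) (proj1 wx) wy (nearL_refl 0 w).
  rewrite add0r mulr1 size_tuple -ler_pdivlMr// => /le_lt_trans; apply.
  apply: le_lt_trans hm; rewrite ler_pM2l// lef_pV2 ?posrE ?(apow_gt0 hK)//.
  by rewrite ler_eXn2l// ltr1n (carpet_a_gt1 hK).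
by exists n, c.
Qed.

(** Open sets form a pi-system generating the Borel sets. The class of sets with approximable
    indicator is closed under complements by linearity, and under disjoint unions by dominated
    convergence. *)
Lemma approximable_indic (A : set (borelRV R D)) : measurable A -> approximable (ind A).
Proof.
apply: (@dynkin_induction _ (borelRV R D) (@open 'rV[R]_D) (fun A => approximable (ind A))).
- by [].
- by move=> U V; exact: openI.
- by rewrite indicT; exact: approximable_cst.
- by move=> U; exact: approximable_open.
- move=> B mB aB; have mi : mT (ind B) by exact: measurable_indic.
  rewrite (_ : ind (~` B) = cst 1 \+ (fun x => -1 * ind B x)).
    apply: (approximableD (measurable_cst _) _ (approximable_cst 1) (approximableZ (-1) mi aB)).
    by apply: measurable_funM.
  by apply/funext => x; rewrite /= !indicE in_setC; case: (x \in B); rewrite /=; lra.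
- move=> F mF tF aF.
  have mi k : mT (ind (F k)) by exact: measurable_indic.
  have mU : mT (ind (\bigcup_k F k)) by apply: measurable_indic; exact: bigcup_measurable.
  have ms n : mT (fun x => \sum_(k <- iota 0 n) ind (F k) x) by exact: measurable_sum.
  apply: approximable_lim => // e e0.
  (* Off the union the remainder vanishes; at a point of F k it equals 1 as long as n <= k, and 0
     from then on. *)
  have val n x : (ind (\bigcup_k F k) x - \sum_(k <- iota 0 n) ind (F k) x : R) = 0 /\ n = n \/
     (exists2 k, F k x & (ind (\bigcup_k F k) x - \sum_(k <- iota 0 n) ind (F k) x : R) = if (k < n)%N then 0 else 1).
    have [[k _ kx]|nU] := pselect ((\bigcup_k F k) x); last first.
      left; split => //; rewrite indicE memNset// big1 ?subr0// => k _.
      by rewrite indicE memNset// => kx; apply: nU; exists k.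
    right; exists k => //.
    rewrite indicE mem_set; last by exists k.
    have e1 j : j != k -> ind (F j) x = 0 :> R.
      move=> jk; rewrite indicE memNset// => jx; case/eqP: jk.
      by apply: (tF j k) => //; exists x.
    case: ltnP => kn.
      rewrite (bigD1_seq k) ?iota_uniq ?mem_iota//= big1 => [|j jk]; last exact: e1.
      by rewrite indicE mem_set// addr0 subrr.
    rewrite big1_seq ?subr0// => j; rewrite mem_iota add0n => /andP[_ jn].
    by apply: e1; rewrite neq_ltn (leq_trans jn kn).
  have [|||||n hn] := @Lp_dominated (fun n => ind (\bigcup_k F k) \- (fun x => \sum_(k <- iota 0 n) ind (F k) x)) (cst 1) _ _ _ _ _ e e0.
  + by move=> n; exact: measurable_funB.
  + exact: measurable_cst.
  + by rewrite Lp_cst ltry.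
  + move=> n x _ _ /=; have [[-> _]|[k _ ->]] := val n x; first by rewrite normr0 normr1.
    by case: ifP => _; rewrite ?normr0 ?normr1.
  + move=> x _ _ /=; apply: cvg_near_cst.
    have [[k _ kx]|nU] := pselect ((\bigcup_k F k) x); last first.
      apply: nearW => n; have [[//]|[k kx _]] := val n x.
      by exfalso; apply: nU; exists k.
    exists k.+1 => // n /= kn; have [[//]|[j jx ->]] := val n x.
    have -> : j = k by apply: (tF j k) => //; exists x.
    by rewrite kn.
  exists (fun x => \sum_(k <- iota 0 n) ind (F k) x); split => //.
  exact: approximable_sum.
Qed.

Lemma approximable_ge0 f : mT f -> (forall x, 0 <= f x) -> (Lp f < +oo)%E -> approximable f.
Proof.
move=> mf f0 ffin; apply: approximable_lim => // e e0.
have mf' : measurable_fun setT (EFin \o f) by exact/measurable_EFinP.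
have [g [gm gc]] := approximation measurableT mf' (fun x _ => f0 x).
have gcv x : (fun n => g n x) @ \oo --> f x.
  by have /fine_cvg := gc x I.
have gle n x : g n x <= f x.
  rewrite -(cvg_lim _ (gcv x))//; apply: nondecreasing_cvgn_le => //.
    by move=> i j ij; have /lefP := gm i j ij; exact.
  by apply/cvg_ex; exists (f x); exact: gcv.
have [|||||n hn] := @Lp_dominated (fun n => f \- g n) f _ _ _ _ _ e e0.
- by move=> n; exact: measurable_funB.
- by [].
- by [].
- move=> n x _ _ /=; rewrite !ger0_norm//; last by rewrite subr_ge0.
  by rewrite lerBlDr lerDl.
- move=> x _ _ /=; rewrite -(subrr (f x)); apply: cvgB; [exact: cvg_cst|exact: gcv].
exists (g n); split => //.
have -> : g n = (fun x => \sum_(y <- finmap.enum_fset (fset_set (range (g n)))) y * \1_(g n @^-1` [set y]) x) :> (_ -> _).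
  by apply/funext => x; rewrite fimfunE fsbig_finite.
apply: approximable_sum => y; first exact: measurable_funM.
apply: approximableZ; first exact: measurable_indic.
exact: approximable_indic.
Qed.

Lemma approximable_Lp f : mT f -> (Lp f < +oo)%E -> approximable f.
Proof.
move=> mf ffin.
have mp : mT (fun x => Num.max (f x) 0) by apply: measurable_maxr => //; exact: measurable_cst.
have mn : mT (fun x => Num.max (- f x) 0).
  by apply: measurable_maxr; [exact: measurableT_comp|exact: measurable_cst].
have b1 : (Lp (fun x => Num.max (f x) 0)%R <= Lp f)%E.
  by apply: (le_Lp mp mf) => x _ _; rewrite maxEle; case: ifP => _; rewrite ?normr0.
have b2 : (Lp (fun x => Num.max (- f x) 0)%R <= Lp f)%E.
  by apply: (le_Lp mn mf) => x _ _; rewrite maxEle; case: ifP => _; rewrite ?normr0 ?normrN.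
have -> : f = (fun x => Num.max (f x) 0) \+ (fun x => -1 * Num.max (- f x) 0).
  by apply/funext => x /=; rewrite !maxEle; do 2 case: ifP; lra.
have max_ge0 (u : R) : 0 <= Num.max u 0 by rewrite le_max lexx orbT.
have ap := approximable_ge0 mp (fun x => max_ge0 _) (le_lt_trans b1 ffin).
have an := approximable_ge0 mn (fun x => max_ge0 _) (le_lt_trans b2 ffin).
have mn' : mT (fun x => -1 * Num.max (- f x) 0).
  by apply: measurable_funM; [exact: measurable_cst|exact: mn].
exact: (approximableD mp mn' ap (approximableZ (-1) mn an)).
Qed.

Lemma Lp_sub_step n c f : mT f ->
  (Lp (f \- step n c)%R = \sum_(w : word S n) \int[mu]_(x in core w) (`|f x - c w| `^ p)%:E)%E.
Proof.
move=> mf; rewrite (Lp_cores n (measurable_funB mf (measurable_step n c))).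
by apply: eq_bigr => w _; apply: eq_integral => x /set_mem wx; rewrite /= (stepE _ wx).
Qed.

Lemma Lp_step n c :
  Lp (step n c) = (\sum_(w : word S n) (N ^+ n)^-1 * `|c w| `^ p)%:E.
Proof.
rewrite (Lp_cores n (measurable_step n c)) -sumEFin; apply: eq_bigr => w _.
transitivity (\int[mu]_(x in core w) (cst (`|c w| `^ p)%:E x))%E.
  by apply: eq_integral => x /set_mem wx; rewrite (stepE _ wx).
transitivity ((`|c w| `^ p)%:E * mu (core w))%E.
  exact: (integral_cst mu (measurable_core hK w) (`|c w| `^ p)%:E).
by rewrite (mu_core hK hmu) size_tuple -EFinM mulrC.
Qed.

Section Integrable.
Context f (fi : mu.-integrable setT (EFin \o f)).

Let mf : mT f. Proof. by apply/measurable_EFinP; exact: measurable_int fi. Qed.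

(* The cell averages are, up to a constant, the best approximation of [f] by
   step functions. *)
Lemma Lp_sub_mean_le n c :
  (Lp (f \- step n (mean K mu f))%R <= (2 `^ p * 2)%:E * Lp (f \- step n c)%R)%E.
Proof.
have ms d : mT (step n d) by exact: measurable_step.
have -> : f \- step n (mean K mu f) = (f \- step n c) \+ step n (fun s => c s - mean K mu f s).
  apply/funext => x /=; rewrite /step.
  under [X in _ = _ + X]eq_bigr do rewrite mulrBl.
  by rewrite sumrB; ring.
apply: le_trans (LpD_le (measurable_funB mf (ms c)) (ms _)) _.
rewrite EFinM -muleA; apply: lee_wpmul2l; first by rewrite lee_fin powR_ge0.
rewrite (_ : 2%:E = 1%:E + 1%:E)%E; last by rewrite -EFinD.
rewrite ge0_muleDl ?lee_fin// !mul1e; apply: leeD => //.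
rewrite Lp_step (Lp_sub_step _ _ mf) -sumEFin; apply: lee_sum => w _.
have := mean_jensen hK hmu fi w (c w) p1; rewrite size_tuple distrC => h.
by rewrite mulrC EFinM lee_pdivrMr ?exprn_gt0// muleC.
Qed.

(** A step function of level n is also one of each level m >= n, so a single good approximation
    controls the averages of all later levels. *)
Lemma Lp_sub_mean_small (e : R) : (Lp f < +oo)%E -> 0 < e ->
  exists n, forall m, (n <= m)%N -> (Lp (f \- step m (mean K mu f))%R <= e%:E)%E.
Proof.
move=> ffin e0; have t0 : 0 < 2 `^ p * 2 :> R by rewrite mulr_gt0 ?powR_gt0.
have [n [c hc]] := approximable_Lp mf ffin (divr_gt0 e0 t0).
exists n => m nm; apply: le_trans (Lp_sub_mean_le m (c \o take n)) _.
rewrite -(approximable_common c mf nm).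
apply: (@le_trans _ _ ((2 `^ p * 2)%:E * (e / (2 `^ p * 2))%:E)%E).
  by apply: lee_wpmul2l => //; rewrite lee_fin ltW.
by rewrite -EFinM mulrC divfK ?gt_eqF.
Qed.

End Integrable.

End StepFunctions.

Lemma ler_sum_inj (R : numDomainType) (I J : finType) (P : pred I) (Q : pred J)
    (h : I -> J) (F : J -> R) :
  {in P &, injective h} -> (forall i, P i -> Q (h i)) -> (forall j, 0 <= F j) ->
  \sum_(i | P i) F (h i) <= \sum_(j | Q j) F j.
Proof.
move=> hinj PQ F0; rewrite -[leLHS](big_imset F hinj) (bigID (mem (h @: P)%SET) Q)/=.
rewrite [X in _ <= X + _](eq_bigl (mem (h @: P)%SET)) => [|j].
  by rewrite lerDl sumr_ge0.
by apply/andb_idl => /imsetP[i Pi ->]; exact: PQ.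
Qed.

Lemma sum_word_rcons (R : nmodType) (D a : nat) (S : {set multi_index D a}) m
    (G : seq (letter S) -> R) :
  \sum_(w : word S m.+1) G w = \sum_(w : word S m) \sum_(i : letter S) G (rcons w i).
Proof.
rewrite pair_bigA /=; pose h (u : word S m * letter S) := rcons_tuple u.1 u.2.
have hinj : injective h.
  move=> [v i] [w j] /(congr1 val) /= /rcons_inj[vw ->].
  by congr pair; exact: val_inj.
rewrite (reindex h)//; apply: onW_bij; apply: inj_card_bij hinj _.
by rewrite card_prod !card_tuple expnSr.
Qed.

(** * Increments of the averages between consecutive levels *)

Section Increments.
Context (R : realType) (D a : nat) (S : {set multi_index D a})
  (K : set 'rV[R]_D) (mu : probability (borelRV R D) R)
  (hK : gen_carpet S K) (hmu : self_similar S K mu) (p : R) (p1 : 1 < p).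

Local Notation N := (#|S|%:R : R).
Let N0 : 0 < N. Proof. by rewrite ltr0n (card_letters_gt0 hK). Qed.
Let p0 : 0 < p. Proof. exact: lt_trans ltr01 p1. Qed.

Let sum_letter_const (x : R) : \sum_(i : letter S) x = N * x.
Proof.
rewrite sumr_const mulr_natl; congr (_ *+ _); rewrite card_sig.
by apply: eq_card.
Qed.

(** Twice the graph energy, for coefficients given on words of all lengths. *)
Definition edge_energy n (c : seq (letter S) -> R) : R :=
  \sum_(u : word S n * word S n | cell_rel K u.1 u.2) `|c u.1 - c u.2| `^ p.

Lemma edge_energy_ge0 n c : 0 <= edge_energy n c.
Proof. by apply: sumr_ge0 => u _; exact: powR_ge0. Qed.

Lemma energy_Mn n (f : borelRV R D -> R) :
  energy p (cell_rel K (n := n)) (@Mn R D a S K mu n f) = 2^-1 * edge_energy n (mean K mu f).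
Proof. by rewrite /energy; congr (_ * _); apply: eq_bigr => u _; rewrite !Mn_mean. Qed.

(** Distinct adjacent siblings form an edge of level m + 1, and the edge determines the parent and
    both letters. The relation [letter_rel] is reflexive, unlike [cell_rel], but its diagonal
    contributes 0. *)
Lemma sum_children_energy m (c : seq (letter S) -> R) :
  \sum_(s : word S m) \sum_(e : letter S * letter S | letter_rel e.1 e.2)
     `|c (rcons s e.1) - c (rcons s e.2)| `^ p <= edge_energy m.+1 c.
Proof.
pose P (q : word S m * (letter S * letter S)) := letter_rel q.2.1 q.2.2 && (q.2.1 != q.2.2).
pose h (q : word S m * (letter S * letter S)) :=
  (rcons_tuple q.1 q.2.1, rcons_tuple q.1 q.2.2).
have -> : \sum_(s : word S m) \sum_(e : letter S * letter S | letter_rel e.1 e.2)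
     `|c (rcons s e.1) - c (rcons s e.2)| `^ p =
   \sum_(q | P q) `|c (h q).1 - c (h q).2| `^ p.
  rewrite pair_big_dep /= (bigID (fun q => q.2.1 != q.2.2))/= [X in _ + X]big1 ?addr0//.
  move=> [s [i j]] /= /andP[_]; rewrite negbK => /eqP ->.
  by rewrite subrr normr0 powR0// gt_eqF.
apply: (@ler_sum_inj _ _ _ P (fun u => cell_rel K u.1 u.2) h (fun u => `|c u.1 - c u.2| `^ p)).
- move=> [s [i j]] [t [k l]] _ _ [/rcons_inj[/val_inj -> ->] /rcons_inj[]].
  by move=> ->.
- move=> [s [i j]] /andP[/= ij ne]; rewrite (cell_relE hK) /= near_rcons.
  rewrite /letter_rel in ij; rewrite ij andbT.
  by apply: contra ne => /eqP/(congr1 val)/rcons_inj[->].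
- by move=> u; exact: powR_ge0.
Qed.

Section Integrable.
Context (f : borelRV R D -> R) (fi : mu.-integrable setT (EFin \o f)).
Local Notation M := (@mean R D a S K mu f).

(** The average on a cell is the mean of the averages on its children, and two children differ by at
    most [B] by [letter_poincare]. *)
Lemma mean_child_le s (i : letter S) :
  `|M (rcons s i) - M s| `^ p <= N `^ p *
    \sum_(e : letter S * letter S | letter_rel e.1 e.2) `|M (rcons s e.1) - M (rcons s e.2)| `^ p.
Proof.
set E := \sum_(_ | _) _.
have E0 : 0 <= N `^ p * E.
  by rewrite mulr_ge0 ?powR_ge0//; apply: sumr_ge0 => e _; exact: powR_ge0.
pose B := (N `^ p * E) `^ p^-1.
have BE : B `^ p = N `^ p * E by rewrite -powRrM mulVf ?gt_eqF// powRr1.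
have le j : `|M (rcons s i) - M (rcons s j)| <= B.
  have := letter_poincare hK (fun j => M (rcons s j)) i j p0; rewrite -/E -BE => h.
  by rewrite leNgt; apply/negP => lt; move: h; apply/negP; rewrite -ltNge;
    apply: gt0_ltr_powR; rewrite ?nnegrE ?powR_ge0.
rewrite -BE; apply: powR_le_nneg; rewrite ?(ltW p0)//.
have -> : M (rcons s i) - M s = N^-1 * \sum_(j : letter S) (M (rcons s i) - M (rcons s j)).
  rewrite sumrB mulrBr -(mean_rcons hK hmu fi) sum_letter_const.
  by rewrite mulrA mulVf ?gt_eqF// mul1r.
rewrite normrM (ger0_norm (_ : 0 <= N^-1)) ?invr_ge0 ?(ltW N0)//.
rewrite mulrC ler_pdivrMr//.
apply: le_trans (ler_norm_sum _ _ _) _.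
apply: le_trans (ler_sum _ (fun j _ => le j)) _.
by rewrite sum_letter_const mulrC.
Qed.

(** N^p is the chain constant of [letter_poincare], N the number of children of a cell, and N^-(m+1)
    the mass of a child. *)
Lemma Lp_increment m :
  (Lp mu p (step K m.+1 M \- step K m M)%R <=
    (N `^ p * N * (N ^+ m.+1)^-1 * edge_energy m.+1 M)%:E)%E.
Proof.
have ms n c := measurable_step hK n c.
have -> : Lp mu p (step K m.+1 M \- step K m M)
    = Lp mu p (step K m.+1 (fun s => M s - M (take m s))).
  apply: (eq_Lp hK hmu); [exact: measurable_funB|exact: ms|].
  move=> x Kx Zx /=; rewrite (step_take hK _ Kx Zx (leqnSn m)).
  by have [w wx] := core_cover hK m.+1 Kx Zx; rewrite !(stepE _ wx).
rewrite (Lp_step hK hmu) lee_fin -mulr_sumr [leRHS](_ : _ = (N ^+ m.+1)^-1 * (N `^ p * N * edge_energy m.+1 M)); last by ring.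
rewrite ler_pM2l ?invr_gt0 ?exprn_gt0//.
rewrite (sum_word_rcons m (fun s => `|M s - M (take m s)| `^ p)).
apply: (@le_trans _ _ (\sum_(w : word S m) \sum_(i : letter S) (N `^ p *
    \sum_(e : letter S * letter S | letter_rel e.1 e.2) `|M (rcons w e.1) - M (rcons w e.2)| `^ p))).
  apply: ler_sum => w _; apply: ler_sum => i _.
  by rewrite -cats1 take_size_cat ?size_tuple// cats1; exact: mean_child_le.
under eq_bigr do rewrite sum_letter_const mulrCA.
rewrite -mulr_sumr -mulrA ler_pM2l ?powR_gt0// -mulr_sumr ler_pM2l//; exact: sum_children_energy.
Qed.

End Integrable.
End Increments.

(** * Cutoff functions and capacities *)

Lemma max01_lipschitz (R : realDomainType) (x y d : R) : x <= y + d -> y <= x + d ->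
  `|Num.max 0 (1 - x) - Num.max 0 (1 - y)| <= d.
Proof.
by move=> h1 h2; rewrite !maxEle ler_norml; do 2 case: ifPn; rewrite -?ltNge => *; lra.
Qed.

Section Capacity.
Context (R : realType) (D a : nat) (S : {set multi_index D a})
  (K : set 'rV[R]_D) (hK : gen_carpet S K) (p : R) (p0 : 0 < p).

Local Notation N := (#|S|%:R : R).
Let N0 : 0 < N. Proof. by rewrite ltr0n (card_letters_gt0 hK). Qed.

Section Cutoff.
Context (m n : nat) (w : word S m).

(* Distance, in units of cells of level [m + n], from a cell to the cube of
   the word [w] in direction [k] (natural subtraction truncates at [0]). *)
Definition gap (k : 'I_D) (u : seq (letter S)) : nat :=
  (addr k w * a ^ n - addr k u) + ((addr k u).+1 - (addr k w * a ^ n + a ^ n)).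

(** A tent in the l^1 distance to the cube of [w], scaled to vanish one full cube, that is a^n
    cells, away from it. *)
Definition cutoff (u : seq (letter S)) : R :=
  Num.max 0 (1 - (\sum_k gap k u)%:R / a%:R ^+ n).

Let An0 : 0 < (a%:R : R) ^+ n := apow_gt0 hK n.

Lemma cutoff_subword (v : word S n) : cutoff (w ++ v) = 1.
Proof.
rewrite /cutoff big1 => [|k _]; first by rewrite mul0r subr0 max_r.
rewrite /gap addr_cat size_tuple; have := addr_lt k v; rewrite size_tuple.
move: (addr k v) (addr k w * a ^ n)%N (a ^ n)%N => x y z; lia.
Qed.

(** In some direction the positions of [v] and [w] differ by at least 2, so a full row of a^n cells
    separates them. *)
Lemma cutoff_far (v : word S m) (x : word S n) : ~~ nearL 1 v w -> cutoff (v ++ x) = 0.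
Proof.
rewrite /nearL negb_forall => /existsP[k far].
suff le : (a ^ n <= \sum_k gap k (v ++ x))%N.
  rewrite /cutoff max_l// subr_le0 ler_pdivlMr// mul1r -natrX ler_nat//.
rewrite (bigD1 k)//=; apply: leq_trans (leq_addr _ _).
rewrite /gap addr_cat size_tuple; have := addr_lt k x; rewrite size_tuple.
move: far; rewrite negb_and -!ltnNge.
move: (addr k v) (addr k w) (addr k x) (a ^ n)%N => i j y z.
by move=> /orP[] ij yz; nia.
Qed.

Lemma gap_lipschitz k u u' : nearL 1 u u' -> (gap k u <= gap k u' + 1)%N.
Proof.
move=> /nearLP/(_ k); rewrite /gap; move: (addr k u) (addr k u') => i j.
by move: (addr k w * a ^ n)%N (a ^ n)%N => x y; lia.
Qed.

Lemma cutoff_lipschitz u u' : nearL 1 u u' -> `|cutoff u - cutoff u'| <= D%:R / a%:R ^+ n.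
Proof.
move=> uu'.
have le s t : nearL 1 s t -> ((\sum_k gap k s)%:R : R) <= (\sum_k gap k t)%:R + D%:R.
  move=> st; rewrite -natrD ler_nat -[X in (_ <= _ + X)%N](card_ord D) -sum1_card -big_split /=.
  by apply: leq_sum => k _; exact: gap_lipschitz.
have le1 := le _ _ uu'; have le2 := le _ _ (etrans (nearL_sym _ _ _) uu').
rewrite /cutoff; move: (_%:R) (_%:R) (D%:R) le1 le2 => x y d le1 le2.
have e1 : x / a%:R ^+ n <= y / a%:R ^+ n + d / a%:R ^+ n by rewrite -mulrDl ler_pM2r ?invr_gt0.
have e2 : y / a%:R ^+ n <= x / a%:R ^+ n + d / a%:R ^+ n by rewrite -mulrDl ler_pM2r ?invr_gt0.
exact: max01_lipschitz.
Qed.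

Lemma card_cutoff_support :
  (#|[set u : word S (m + n) | (cutoff u != 0)%R]%SET| <= 3 ^ D * #|S| ^ n)%N.
Proof.
pose V := [set v : word S m | nearL 1 w (tval v)]%SET.
pose g (q : word S m * word S n) : word S (m + n) := cat_tuple q.1 q.2.
apply: (@leq_trans #|(g @: finset.setX V [set: word S n])%SET|); last first.
  apply: leq_trans (leq_imset_card _ _) _; rewrite cardsX cardsT card_tuple card_sig.
  by rewrite leq_mul// ?card_nearL// leq_eqVlt; apply/orP; left; apply/eqP; congr (_ ^ _)%N; exact: eq_card.
apply: subset_leq_card; apply/fintype.subsetP => u; rewrite inE => u0.
have tsz : size (take m u) == m by rewrite size_takel// size_tuple leq_addr.
have dsz : size (drop m u) == n by rewrite size_drop size_tuple addKn.
apply/imsetP; exists (Tuple tsz, Tuple dsz); last first.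
  by apply: val_inj => /=; rewrite cat_take_drop.
rewrite !inE andbT /= nearL_sym; apply: contraNT u0 => /(cutoff_far (v := Tuple tsz) (Tuple dsz)).
by rewrite /= cat_take_drop => ->.
Qed.

Lemma near_word_nbhd (u : word S (m + n)) : nearL 1 (take m u) w -> u \in word_nbhd K n w.
Proof.
move=> near.
have tsz : size (take m u) == m by rewrite size_takel// size_tuple leq_addr.
have dsz : size (drop m u) == n by rewrite size_drop size_tuple addKn.
apply/bigcupP; exists (Tuple tsz).
  have [e|ne] := eqVneq (Tuple tsz) w.
    apply: (@le_trans _ _ 0%:E); last by rewrite lee_fin.
    by apply: ereal_inf_lbound; exists [::].
  apply: ereal_inf_lbound; exists [:: w] => //=; split => //=.
  by rewrite andbT (cell_relE hK) ne.
apply/imsetP; exists (Tuple dsz) => //; apply: val_inj => /=.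
by rewrite cat_take_drop.
Qed.

Lemma cutoff_energy_le :
  energy p (cell_rel K (n := (m + n)%N)) (fun u => cutoff u) <=
    (D%:R / a%:R ^+ n) `^ p * (3 ^ D * (3 ^ D * #|S| ^ n))%:R.
Proof.
set U := [set u : word S (m + n) | cutoff u != 0]%SET.
set d := (D%:R / a%:R ^+ n : R).
have d0 : 0 <= d `^ p by exact: powR_ge0.
have card u : (\sum_(v : word S (m + n) | nearL 1 u v) 1 <= 3 ^ D)%N.
  rewrite -[leqRHS]/((2 * 1).+1 ^ D)%N; apply: leq_trans (card_nearL (m + n) 1 u).
  by rewrite sum1_card cardsE.
(* An edge with nonzero increment has an endpoint in [U], and each word has at most 3^D near words.
   Charging edges to either endpoint gives twice this bound, and the factor 1/2 of the energy
   cancels the 2. *)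
have half : \sum_(e : word S (m + n) * word S (m + n) | nearL 1 e.1 e.2) d `^ p * (e.1 \in U)%:R
    <= d `^ p * (3 ^ D * (3 ^ D * #|S| ^ n))%:R.
  rewrite -mulr_sumr ler_wpM2l// -natr_sum ler_nat -(pair_big_dep xpredT (fun u v : word S (m + n) => nearL 1 u v)
    (fun u v => (u \in U) : nat)) /=.
  apply: (@leq_trans (\sum_(u in U) 3 ^ D)%N).
    rewrite [leqRHS]big_mkcond; apply: leq_sum => u _; case: ifP => uU; first exact: card.
    by rewrite big1.
  by rewrite sum_nat_const mulnC leq_mul2l card_cutoff_support orbT.
rewrite /energy mulrC ler_pdivrMr//.
apply: (@le_trans _ _ (\sum_(e : word S (m + n) * word S (m + n) | nearL 1 e.1 e.2)
   (d `^ p * (e.1 \in U)%:R + d `^ p * (e.2 \in U)%:R))).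
  rewrite [leRHS](bigID (fun e : word S (m + n) * word S (m + n) => cell_rel K e.1 e.2))/=.
  apply: (@le_trans _ _ (\sum_(e : word S (m + n) * word S (m + n) | nearL 1 e.1 e.2 && cell_rel K e.1 e.2)
   (d `^ p * (e.1 \in U)%:R + d `^ p * (e.2 \in U)%:R))); last first.
    by rewrite lerDl; apply: sumr_ge0 => e _; rewrite addr_ge0// mulr_ge0.
  rewrite [leLHS](eq_bigl (fun e : word S (m + n) * word S (m + n) => nearL 1 e.1 e.2 && cell_rel K e.1 e.2)); last first.
    by move=> e; rewrite (cell_relE hK) andbCA andbb.
  apply: ler_sum => -[u v] /andP[/= uv _].
  have le : `|cutoff u - cutoff v| `^ p <= d `^ p.
    by apply: powR_le_nneg; [exact: ltW|by []|exact: cutoff_lipschitz].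
  rewrite !inE; have [u0|_] := eqVneq (cutoff u) 0; have [v0|_] := eqVneq (cutoff v) 0; rewrite /= ?mulr1 ?mulr0.
  - by rewrite u0 v0 subrr normr0 powR0 ?gt_eqF// addr0.
  - by rewrite add0r.
  - by rewrite addr0.
  - by rewrite (le_trans le)// lerDl.
rewrite big_split /= (_ : forall z : R, z * 2 = z + z); last by move=> z; lra.
apply: lerD => //.
apply: le_trans half; rewrite (reindex (fun e : word S (m + n) * word S (m + n) => (e.2, e.1)))/=; last first.
  by exists (fun e => (e.2, e.1)) => -[u v].
by rewrite le_eqVlt; apply/orP; left; apply/eqP; apply: eq_bigl => e; rewrite nearL_sym.
Qed.

Lemma capacity_word_le :
  (capacity p (cell_rel K (n := (m + n)%N)) (subwords n w) (~: word_nbhd K n w)%SET <=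
    ((D%:R / a%:R ^+ n) `^ p * (3 ^ D * (3 ^ D * #|S| ^ n))%:R)%:E)%E.
Proof.
apply: (@le_trans _ _ (energy p (cell_rel K (n := (m + n)%N)) (fun u => cutoff u))%:E); last first.
  by rewrite lee_fin; exact: cutoff_energy_le.
apply: ereal_inf_lbound; exists (fun u : word S (m + n) => cutoff u) => //; split.
  by move=> u /imsetP[v _ ->]; exact: cutoff_subword.
move=> u; rewrite inE => far.
have tsz : size (take m u) == m by rewrite size_takel// size_tuple leq_addr.
have dsz : size (drop m u) == n by rewrite size_drop size_tuple addKn.
rewrite -(cat_take_drop m u); apply: (@cutoff_far (Tuple tsz) (Tuple dsz)).
by apply: contra far => /near_word_nbhd.
Qed.

End Cutoff.

Lemma Cpn_ge0 n : (0 <= Cpn S K p n)%E.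
Proof.
have /card_gt0P[i iS] := card_letters_gt0 hK.
pose w : word S 1 := [tuple (exist _ i iS : letter S)].
apply: le_trans (ereal_sup_ubound _); last by exists 1%N, w.
apply: le_ereal_inf_tmp => _ [f _ <-]; rewrite lee_fin mulr_ge0 ?invr_ge0//.
by apply: sumr_ge0 => u _; exact: powR_ge0.
Qed.

Lemma Cpn_le n : (Cpn S K p n <= (D%:R `^ p * (3 ^ D * 3 ^ D)%:R * (N * (a%:R `^ p)^-1) ^+ n)%:E)%E.
Proof.
apply: ge_ereal_sup => _ [m [w [_ ->]]]; apply: le_trans (capacity_word_le n w) _.
have a0 : (0 : R) <= a%:R by [].
rewrite lee_fin powRM ?invr_ge0 ?exprn_ge0// !natrM !natrX exprMn.
have -> : (a%:R ^- n : R) `^ p = (a%:R `^ p)^-1 ^+ n.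
  by rewrite -powR_invn// powRAC -powRN -!powRrM -powR_mulrn ?powR_ge0// -powRrM; congr (_ `^ _); ring.
by rewrite le_eqVlt; apply/orP; left; apply/eqP; ring.
Qed.

Lemma bernoulli_le (x : R) n : 1 <= x -> 1 + n%:R * (x - 1) <= x ^+ n.
Proof.
move=> x1; elim: n => [|n IH]; first by rewrite mul0r addr0 expr0.
rewrite exprS -natr1; have : 0 <= (n%:R : R) by [].
move: (n%:R) (x ^+ n) IH => k y IH k0.
have : x * (1 + k * (x - 1)) <= x * y by rewrite ler_pM2l//; lra.
have : 0 <= k * (x - 1) ^+ 2 by rewrite mulr_ge0 ?sqr_ge0.
by rewrite expr2; lra.
Qed.

(* If the limit defining [rho_exp] were [0], infinite or nonexistent, [rho_exp]
   would be [0] (the default value of [limn] in [\bar R] is [0]). *)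
Lemma rho_exp_gt : rho_exp S K p = 0 \/ 1 < N * rho_exp S K p.
Proof.
rewrite /rho_exp; set u := fun n : nat => _.
have [->|l0] := eqVneq (fine (limn u)) 0; [by left; rewrite invr0|right].
have cu : cvgn u.
  by apply: contrapT => /dvgP ul; move: l0; rewrite ul eqxx.
have l0' : 0 < fine (limn u).
  rewrite lt_neqAle eq_sym l0 /= fine_ge0//; apply: lime_ge => //.
  by apply: nearW => n; exact: poweR_ge0.
have a1 : 1 < a%:R `^ p :> R.
  have e1 : (1 : R) `^ p = 1 by rewrite powR1.
  rewrite -[ltLHS]e1; apply: gt0_ltr_powR; rewrite ?nnegrE// ltr1n.
  exact: carpet_a_gt1 hK.
pose b := N * (a%:R `^ p)^-1; have b0 : 0 < b by rewrite mulr_gt0 ?invr_gt0//; lra.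
have bN : b < N by rewrite /b ltr_pdivrMr ?ltr_pMr//; lra.
(* The capacities are at most C b^n with b = N a^-p < N. A rate b' strictly between b and N absorbs
   the constant C from an explicit index on, by Bernoulli's inequality. *)
pose b' := (b + N) / 2.
have bb' : b < b' by rewrite /b'; lra.
pose C := D%:R `^ p * (3 ^ D * 3 ^ D)%:R : R.
have lb' : (limn u <= b'%:E)%E.
  apply: lime_le => //.
  have x1 : 1 < b' / b by rewrite ltr_pdivlMr ?mul1r.
  exists (Num.truncn (C / (b' / b - 1))).+1 => // n /= hn.
  have n0 : (0 < n)%N by exact: leq_trans hn.
  have -> : b'%:E = poweR (b' ^+ n)%:E n%:R^-1.
    by rewrite poweR_EFin -powR_mulrn ?(ltW (lt_trans b0 bb'))// -powRrM mulfV ?pnatr_eq0 -?lt0n// powRr1// ltW// (lt_trans b0).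
  apply: gt0_ler_poweR; rewrite ?invr_ge0// ?in_itv /= ?leey ?andbT ?Cpn_ge0//.
    by rewrite lee_fin exprn_ge0// ltW// (lt_trans b0).
  apply: le_trans (Cpn_le n) _; rewrite -/C -/b lee_fin.
  rewrite -ler_pdivlMr ?exprn_gt0// -expr_div_n.
  apply: le_trans (bernoulli_le n (ltW x1)).
  have : C / (b' / b - 1) < n%:R.
    by apply: lt_le_trans (truncnS_gt _) _; rewrite ler_nat.
  by rewrite ltr_pdivrMr; lra.
have : fine (limn u) <= b'.
  (* [fine] sends an infinite limit to 0, which [l0] excludes. *)
  rewrite -lee_fin fineK//; apply/fin_numP; split; apply: contra_neq l0 => ->//.
rewrite ltr_pdivlMr// mul1r => /le_lt_trans; apply; rewrite /b'; lra.
Qed.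

End Capacity.

(** * Averages over balls *)

Section KorevaarSchoen.
Context (R : realType) (D a : nat) (S : {set multi_index D a})
  (K : set 'rV[R]_D) (mu : probability (borelRV R D) R)
  (hK : gen_carpet S K) (hmu : self_similar S K mu) (p : R) (p1 : 1 < p).

Local Notation N := (#|S|%:R : R).
Local Notation core := (@core R D a S K).
Local Notation overlaps := (@overlaps R D a S K).
Local Notation mT := (measurable_fun [set: borelRV R D]).
Implicit Types (f : borelRV R D -> R) (h : borelRV R D -> \bar R).

Let N0 : 0 < N. Proof. by rewrite ltr0n (card_letters_gt0 hK). Qed.
Let Nn0 n : 0 < N ^+ n. Proof. by rewrite exprn_gt0. Qed.
Let D0 : (0 < D)%N. Proof. by have := carpet_dim hK; lia. Qed.
Let An0 n : 0 < (a%:R : R) ^+ n := apow_gt0 hK n.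
Let p0 : 0 < p. Proof. exact: lt_trans ltr01 p1. Qed.

Lemma measurable_ball (x : 'rV[R]_D) (r : R) : measurable (Bd K x r : set (borelRV R D)).
Proof.
have -> : Bd K x r = K `&` (dcarpet x @^-1` [set u | u < r]) by [].
apply: measurableI; first exact: (measurable_carpet hK).
apply: borel_open; apply: open_comp; last exact: open_lt.
move=> y _.
have cs : {for y, continuous (fun y : 'rV[R]_D => \sum_k ((x - y) 0 k) ^+ 2)}.
  elim: (index_enum _) => [|k l IH].
    rewrite (_ : (fun _ => _) = cst 0); first exact: cst_continuous.
    by apply/funext => z; rewrite big_nil.
  rewrite (_ : (fun _ => _) = (fun y : 'rV[R]_D => (x 0 k - y 0 k) * (x 0 k - y 0 k)
      + \sum_(j <- l) ((x - y) 0 j) ^+ 2)); last first.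
    by apply/funext => z; rewrite big_cons !mxE expr2.
  have c1 : {for y, continuous (fun y : 'rV[R]_D => x 0 k - y 0 k)}.
    apply: (@continuousB R R 'rV[R]_D (cst (x 0 k)) (fun y => y 0 k) y).
      exact: cst_continuous.
    exact: (@coord_continuous R 1 D 0 k y).
  exact: (@continuousD R R 'rV[R]_D _ _ y (@continuousM R 'rV[R]_D _ _ y c1 c1) IH).
apply: (@continuousM R 'rV[R]_D (cst _) (fun y => enorm (x - y)) y).
  exact: cst_continuous.
exact: (@continuous_comp _ _ _ _ Num.sqrt y cs (@sqrt_continuous R _)).
Qed.

(** Coordinates of points in near cells differ by at most 4 a^-n, and [dcarpet_le] halves this. *)
Lemma near_sub_ball n (v w : word S n) x r : core v x -> nearL 1 v w ->
  2 / a%:R ^+ n < r -> scell K w `<=` Bd K x r.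
Proof.
move=> [vx _] vw hr y wy; split; first exact: (scell_sub hK wy).
apply: le_lt_trans hr; rewrite (_ : 2 / _ = (4 / a%:R ^+ n) / 2); last by field; rewrite gt_eqF.
apply: (dcarpet_le D0) => [|k]; first by rewrite divr_ge0// ltW.
have svw : size v = size w by rewrite !size_tuple.
have := scell_close hK k svw vx wy vw; rewrite size_tuple -ler_pdivlMr//.
by move/le_trans; apply; rewrite ler_pM2r ?invr_gt0//; lra.
Qed.

Lemma ball_sub_near n L (v w : word S n) x y r : core v x -> core w y -> Bd K x r y ->
  D%:R * r * a%:R ^+ n <= L%:R -> nearL L v w.
Proof.
move=> [vx _] [wy _] [_ xyr] hr.
have svw : size v = size w by rewrite !size_tuple.
apply: (scell_near hK svw vx wy) => k; rewrite size_tuple.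
apply: (@lt_le_trans _ _ (2 * (D%:R * r * a%:R ^+ n))); last by rewrite ler_pM2l.
rewrite !mulrA ltr_pM2r//; apply: le_lt_trans (coord_le_dcarpet x y k) _.
by rewrite ltr_pM2l// mulr_gt0// ltr0n.
Qed.

Lemma ball_integral_cores n x r h : mT h -> (forall y, 0 <= h y)%E ->
  (\int[mu]_(y in Bd K x r) h y = \sum_(w : word S n) \int[mu]_(y in core w) (h \_ (Bd K x r)) y)%E.
Proof.
move=> mh h0; rewrite integral_mkcond; apply: (integral_cores hK hmu).
  by apply/(measurable_restrictT _ (measurable_ball x r)); exact: measurable_funTS.
by move=> y; rewrite /patch; case: ifP.
Qed.

Lemma ball_integral_le n L (v : word S n) x r h : core v x ->
  D%:R * r * a%:R ^+ n <= L%:R -> mT h -> (forall y, 0 <= h y)%E ->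
  (\int[mu]_(y in Bd K x r) h y <=
    \sum_(w : word S n | nearL L v w) \int[mu]_(y in core w) h y)%E.
Proof.
move=> vx hr mh h0; rewrite (ball_integral_cores n x r mh h0) [leRHS]big_mkcond /=.
apply: lee_sum => w _; case: ifPn => [_|far].
  apply: ge0_le_integral_weak => y _; rewrite /patch; case: ifP => // _.
rewrite (eq_integral (cst 0%E)) ?integral0// => y /set_mem wy.
rewrite /patch; case: ifPn => // /set_mem yB.
by move: far; rewrite (ball_sub_near vx wy yB hr).
Qed.

Lemma ball_integral_ge n (v : word S n) x r h : core v x ->
  2 / a%:R ^+ n < r -> mT h -> (forall y, 0 <= h y)%E ->
  (\sum_(w : word S n | nearL 1 v w) \int[mu]_(y in core w) h y <=
    \int[mu]_(y in Bd K x r) h y)%E.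
Proof.
move=> vx hr mh h0; rewrite (ball_integral_cores n x r mh h0) big_mkcond /=.
apply: lee_sum => w _; case: ifPn => [vw|_]; last first.
  by apply: integral_ge0 => y _; rewrite /patch; case: ifP.
rewrite [leRHS](eq_integral h)// => y /set_mem[wy _].
by rewrite /patch mem_set//; exact: (near_sub_ball vx vw hr).
Qed.

Lemma mu_ball_le n L (v : word S n) x r : core v x -> D%:R * r * a%:R ^+ n <= L%:R ->
  fine (mu (Bd K x r)) <= ((2 * L).+1 ^ D)%:R * (N ^+ n)^-1.
Proof.
move=> vx hr; rewrite -lee_fin fineK; last by apply: fin_num_measure; exact: measurable_ball.
have := @ball_integral_le n L v x r (cst 1%E) vx hr (measurable_cst _) (fun=> lee01).
rewrite (integral_cst mu (measurable_ball x r)) mul1e => /le_trans; apply.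
apply: (@le_trans _ _ (\sum_(w : word S n | nearL L v w) ((N ^+ n)^-1)%:E)%E).
  apply: lee_sum => w _; rewrite (integral_cst mu (measurable_core hK w)) mul1e.
  by have := mu_core hK hmu w; rewrite size_tuple => /= ->.
rewrite sumEFin lee_fin sumr_const -[leLHS]mulr_natl ler_pM2r ?invr_gt0// ler_nat.
by have := card_nearL n L v; rewrite cardsE.
Qed.

Lemma mu_ball_ge m x r : K x -> ~ overlaps x -> (a%:R ^+ m)^-1 < r ->
  (N ^+ m)^-1 <= fine (mu (Bd K x r)).
Proof.
move=> Kx Zx hr; rewrite -lee_fin fineK; last by apply: fin_num_measure; exact: measurable_ball.
have [w wx] := core_cover hK m Kx Zx.
have := mu_core hK hmu w; rewrite size_tuple => <-.
apply: le_measure; rewrite ?inE; [exact: (measurable_core hK)|exact: measurable_ball|].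
move=> y [wy _]; split; first exact: (scell_sub hK wy).
apply: le_lt_trans hr; rewrite (_ : _^-1 = (2 / a%:R ^+ m) / 2); last by field; rewrite gt_eqF.
apply: (dcarpet_le D0) => [|k]; first by rewrite divr_ge0// ltW.
have := scell_close hK k (erefl (size w)) (proj1 wx) wy (nearL_refl 0 w).
by rewrite size_tuple add0r mulr1 -ler_pdivlMr.
Qed.

(* The integrand [G] is not known to be measurable, so it is compared with
   measurable functions, infinite on the null set of overlaps. *)
Lemma integral_le_cores n (G : borelRV R D -> \bar R) (H : word S n -> borelRV R D -> \bar R) :
  (forall x, K x -> 0 <= G x)%E ->
  (forall v : word S n, mT (H v)) -> (forall (v : word S n) x, 0 <= H v x)%E ->
  (forall (v : word S n) x, core v x -> G x <= H v x)%E ->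
  (\int[mu]_(x in K) G x <= \sum_(v : word S n) \int[mu]_(x in core v) H v x)%E.
Proof.
move=> G0 mH H0 GH.
pose H' (x : borelRV R D) : \bar R := (\sum_(v : word S n) (H v \_ (core v)) x + (cst +oo%E \_ overlaps) x)%E.
have P0 (v : word S n) (x : borelRV R D) : (0 <= (H v \_ (core v)) x)%E by rewrite /patch; case: ifP.
have Q0 (x : borelRV R D) : (0 <= (cst +oo%E \_ overlaps : borelRV R D -> \bar R) x)%E.
  by rewrite /patch; case: ifP => _; rewrite ?leey.
have mH' : mT H'.
  apply: emeasurable_funD.
    apply: emeasurable_sum => v; apply/(measurable_restrictT _ (measurable_core hK v)).
    exact: measurable_funTS.
  apply/(measurable_restrictT _ (measurable_overlaps hK)).
  exact: measurable_cst.
have H'core (v : word S n) (x : borelRV R D) : core v x -> H' x = H v x.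
  move=> vx; rewrite /H' (bigD1 v)//= {1}/patch mem_set// big1 => [|w wv].
    by rewrite /patch memNset ?adde0//; case: vx.
  rewrite /patch memNset// => wx; case/eqP: wv; apply: val_inj.
  by apply: (core_inj _ wx vx); rewrite !size_tuple.
have -> : (\sum_(v : word S n) \int[mu]_(x in core v) H v x = \int[mu]_x H' x)%E.
  rewrite (integral_cores hK hmu n mH') => [|x]; last first.
    by rewrite adde_ge0// sume_ge0.
  by apply: eq_bigr => v _; apply: eq_integral => x /set_mem vx; rewrite (H'core v).
rewrite integral_mkcond; apply: ge0_le_integral_weak => x _.
  by rewrite /patch; case: ifPn => // /set_mem; exact: G0.
rewrite {1}/patch; case: ifPn => [/set_mem Kx|_]; last first.
  by rewrite adde_ge0// sume_ge0.
have [Zx|Zx] := pselect (overlaps x).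
  rewrite /H' [X in (_ + X)%E](_ : _ = +oo%E); last by rewrite /patch mem_set.
  rewrite addey ?leey//; rewrite -ltNye; apply: (@lt_le_trans _ _ 0%E) => //.
  by rewrite sume_ge0.
by have [v vx] := core_cover hK n Kx Zx; rewrite (H'core v)//; exact: GH.
Qed.

Lemma integral_ge_cores n (G : borelRV R D -> \bar R) (H : word S n -> borelRV R D -> \bar R) :
  (forall x, K x -> 0 <= G x)%E ->
  (forall v : word S n, mT (H v)) -> (forall (v : word S n) x, 0 <= H v x)%E ->
  (forall (v : word S n) x, core v x -> H v x <= G x)%E ->
  (\sum_(v : word S n) \int[mu]_(x in core v) H v x <= \int[mu]_(x in K) G x)%E.
Proof.
move=> G0 mH H0 GH.
pose H' (x : borelRV R D) : \bar R := (\sum_(v : word S n) (H v \_ (core v)) x)%E.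
have P0 (v : word S n) (x : borelRV R D) : (0 <= (H v \_ (core v)) x)%E by rewrite /patch; case: ifP.
have mH' : mT H'.
  apply: emeasurable_sum => v; apply/(measurable_restrictT _ (measurable_core hK v)).
  exact: measurable_funTS.
have H'core (v : word S n) (x : borelRV R D) : core v x -> H' x = H v x.
  move=> vx; rewrite /H' (bigD1 v)//= {1}/patch mem_set// big1 ?adde0// => w wv.
  rewrite /patch memNset// => wx; case/eqP: wv; apply: val_inj.
  by apply: (core_inj _ wx vx); rewrite !size_tuple.
have -> : (\sum_(v : word S n) \int[mu]_(x in core v) H v x = \int[mu]_x H' x)%E.
  rewrite (integral_cores hK hmu n mH') => [|x]; last by rewrite sume_ge0.
  by apply: eq_bigr => v _; apply: eq_integral => x /set_mem vx; rewrite (H'core v).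
rewrite [leRHS]integral_mkcond; apply: ge0_le_integral_weak => x _; first by rewrite sume_ge0.
have [[v vx]|nv] := pselect (exists v : word S n, core v x).
  rewrite (H'core v)// {1}/patch mem_set; last by case: vx => /(scell_sub hK).
  exact: GH.
rewrite /H' big1 => [|v _]; last by rewrite /patch memNset// => vx; apply: nv; exists v.
by rewrite /patch; case: ifPn => // /set_mem; exact: G0.
Qed.

Lemma integral_core_affine n (w : word S n) f (k s t c A : R) :
  mT f -> 0 <= k -> 0 <= s -> 0 <= t ->
  (\int[mu]_(y in core w) (`|f y - c| `^ p)%:E = A%:E)%E ->
  (\int[mu]_(y in core w) (k * (s + t * `|f y - c| `^ p))%:E =
    (k * ((N ^+ n)^-1 * s + t * A))%:E)%E.
Proof.
move=> mf k0 s0 t0 hA.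
have mw := measurable_core hK w.
have mg : measurable_fun (core w) (fun y => (`|f y - c| `^ p)%:E).
  apply: measurable_funTS; apply: (measurable_normpow p (g := fun y => f y - c)).
  by apply: measurable_funB => //; exact: measurable_cst.
under eq_integral do rewrite EFinM EFinD EFinM.
have g0 y : (0 <= (`|f y - c| `^ p)%:E)%E by rewrite lee_fin powR_ge0.
have tg0 y : (0 <= t%:E * (`|f y - c| `^ p)%:E)%E by rewrite mule_ge0.
have mtg : measurable_fun (core w) (fun y => (t%:E * (`|f y - c| `^ p)%:E)%E).
  by apply: emeasurable_funM => //; exact: measurable_cst.
have ms : measurable_fun (core w) (fun y : borelRV R D => s%:E) by exact: measurable_cst.
rewrite (ge0_integralZl mu mw (emeasurable_funD ms mtg)) => [|y _|//]; last first.
  by rewrite adde_ge0.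
have s0' : (0 <= s%:E)%E by rewrite lee_fin.
rewrite (ge0_integralD mu mw (fun _ _ => s0') ms (fun y _ => tg0 y) mtg).
rewrite (ge0_integralZl mu mw mg (fun y _ => g0 y))// hA (integral_cst mu mw s%:E).
have := mu_core hK hmu w; rewrite size_tuple => /= ->.
by rewrite EFinM EFinD !EFinM (muleC s%:E).
Qed.

Definition near_count n (v : word S n) : R := (\sum_(w : word S n | nearL 1 v w) 1)%N%:R.

Lemma near_count_le n (v : word S n) : near_count v <= (3 ^ D)%:R.
Proof.
rewrite ler_nat -[leqRHS]/((2 * 1).+1 ^ D)%N; apply: leq_trans (card_nearL n 1 v).
by rewrite sum1_card cardsE.
Qed.

Lemma near_sum_cst n (v : word S n) (x : R) :
  \sum_(w : word S n | nearL 1 v w) x = near_count v * x.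
Proof. by rewrite sumr_const -[LHS]mulr_natl /near_count sum1_card. Qed.

Lemma near_edge_energy n (c : seq (letter S) -> R) :
  \sum_(v : word S n) \sum_(w : word S n | nearL 1 v w) `|c v - c w| `^ p = edge_energy K p n c.
Proof.
rewrite pair_big_dep /= (bigID (fun q => q.1 != q.2))/= [X in _ + X]big1 ?addr0 => [|[v w]/=].
  by apply: eq_bigl => q; rewrite (cell_relE hK) andbC.
by move=> /andP[_]; rewrite negbK => /eqP ->; rewrite subrr normr0 powR0// gt_eqF.
Qed.

(** The radius is tied to two levels: the ball is covered by the near cells of level n, and it
    contains a cell of level n + D + 1, which bounds its measure from below. In the factor 2 * 3^D,
    the error f - c is counted once at x and once at y, over at most 3^D near cells. *)
Lemma korevaar_schoen_le n (r b B : R) (c : seq (letter S) -> R) f :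
  mT f -> 0 < r -> D%:R * r * a%:R ^+ n <= 1 -> (a%:R ^+ (n + D.+1))^-1 < r ->
  (Lp mu p (f \- step K n c)%R <= B%:E)%E ->
  (korevaar_schoen K mu p b f r <=
    (N ^+ (n + D.+1) * (2 `^ p * 2 `^ p / r `^ b) *
      (2 * (3 ^ D)%:R * (N ^+ n)^-1 * B + (N ^+ n)^-1 * (N ^+ n)^-1 * edge_energy K p n c))%:E)%E.
Proof.
move=> mf r0 rn rm; rewrite (Lp_sub_step hK hmu _ _ _ mf) => leB.
have I0 (w : word S n) : (0 <= \int[mu]_(x in core w) (`|f x - c w| `^ p)%:E)%E.
  by apply: integral_ge0 => x _; rewrite lee_fin powR_ge0.
pose A (w : word S n) := fine (\int[mu]_(x in core w) (`|f x - c w| `^ p)%:E)%E.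
have AE (w : word S n) : (\int[mu]_(x in core w) (`|f x - c w| `^ p)%:E = (A w)%:E)%E.
  rewrite fineK// ge0_fin_numE//; apply: le_lt_trans (ltry B); apply: le_trans leB.
  by rewrite (bigD1 w)//= leeDl// sume_ge0.
have A0 (w : word S n) : 0 <= A w by rewrite fine_ge0.
have {}leB : \sum_(w : word S n) A w <= B.
  by rewrite -lee_fin -sumEFin; apply: le_trans leB; apply: lee_sum => w _; rewrite AE.
set m := (n + D.+1)%N in rm *.
set k := N ^+ m * (2 `^ p * 2 `^ p / r `^ b).
have rb0 : 0 < r `^ b by exact: powR_gt0.
have k0 : 0 <= k by rewrite mulr_ge0 ?exprn_ge0 ?mulr_ge0 ?powR_ge0 ?invr_ge0// ltW.
(* On the core of v the inner integral is bounded by an affine function of |f x - c v|^p: [T v]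
   collects the terms free of x, and [t v] is the total mass of the near cells. *)
pose T (v : word S n) := \sum_(w : word S n | nearL 1 v w) ((N ^+ n)^-1 * `|c v - c w| `^ p + A w).
have T0 (v : word S n) : 0 <= T v.
  by apply: sumr_ge0 => w _; rewrite addr_ge0// mulr_ge0 ?powR_ge0// invr_ge0 ltW.
pose t (v : word S n) := near_count v * (N ^+ n)^-1.
have t0 (v : word S n) : 0 <= t v by rewrite mulr_ge0// invr_ge0 ltW.
pose H (v : word S n) (x : borelRV R D) := (k * (T v + t v * `|f x - c v| `^ p))%:E.
apply: (@le_trans _ _ (\sum_(v : word S n) \int[mu]_(x in core v) H v x)%E).
  apply: integral_le_cores.
  - move=> x Kx; rewrite mule_ge0// ?lee_fin ?invr_ge0 ?fine_ge0//.
    by apply: integral_ge0 => y _; rewrite lee_fin divr_ge0 ?powR_ge0.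
  - move=> v; apply/measurable_EFinP; apply: measurable_funM; first exact: measurable_cst.
    apply: measurable_funD; first exact: measurable_cst.
    apply: measurable_funM; first exact: measurable_cst.
    apply/measurable_EFinP; apply: (measurable_normpow p (g := fun y => f y - c v)).
    by apply: measurable_funB => //; exact: measurable_cst.
  - by move=> v x; rewrite lee_fin mulr_ge0// addr_ge0// mulr_ge0// powR_ge0.
  move=> v x vx; have Kx : K x by case: vx => /(scell_sub hK).
  have Zx : ~ overlaps x by case: vx.
  have mh : mT (fun y => (`|f x - f y| `^ p / r `^ b)%:E).
    apply/measurable_EFinP; apply: measurable_funM; last exact: measurable_cst.
    apply/measurable_EFinP; apply: (measurable_normpow p (g := fun y => f x - f y)).
    by apply: measurable_funB => //; exact: measurable_cst.
  have h0 y : (0 <= (`|f x - f y| `^ p / r `^ b)%:E)%E by rewrite lee_fin divr_ge0 ?powR_ge0.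
  have q0 : 0 <= 2 `^ p * 2 `^ p / r `^ b by rewrite !mulr_ge0 ?powR_ge0// invr_ge0 ltW.
  apply: (@le_trans _ _ ((N ^+ m)%:E * (2 `^ p * 2 `^ p / r `^ b * (T v + t v * `|f x - c v| `^ p))%:E)%E); last first.
    by rewrite /H /k -EFinM lee_fin !mulrA.
  apply: lee_pmul => //.
  - by rewrite lee_fin invr_ge0 fine_ge0.
  - exact: integral_ge0.
  - rewrite lee_fin -[leRHS]invrK lef_pV2 ?posrE ?invr_gt0//; first exact: mu_ball_ge.
    by apply: lt_le_trans (mu_ball_ge Kx Zx rm); rewrite invr_gt0.
  apply: le_trans (ball_integral_le vx (L := 1) rn mh h0) _.
  apply: (@le_trans _ _ (\sum_(w : word S n | nearL 1 v w) (2 `^ p * 2 `^ p / r `^ b *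
    ((N ^+ n)^-1 * (`|f x - c v| `^ p + `|c v - c w| `^ p) + 1 * A w))%:E)%E); last first.
    rewrite sumEFin lee_fin -mulr_sumr ler_wpM2l// /T /t -mulrA -near_sum_cst -big_split /=.
    by apply: ler_sum => w _; rewrite mul1r mulrDr -addrA addrC.
  apply: lee_sum => w _.
  rewrite -(integral_core_affine mf q0 (addr_ge0 (powR_ge0 _ _) (powR_ge0 _ _)) ler01 (AE w)).
  apply: ge0_le_integral_weak => // y _; rewrite lee_fin mul1r.
  rewrite -[leRHS]mulrAC ler_pM2r ?invr_gt0//.
  have e2 : 1 <= 2 `^ p :> R.
    have e1 : (1 : R) `^ p = 1 by rewrite powR1.
    by rewrite -[leLHS]e1; apply: powR_le_nneg; rewrite ?(ltW p0)// ler1n.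
  (* Passing through f x, c v, c w, f y takes two quasi-triangle inequalities, whence 2^p 2^p; the
     first increment carries a single 2^p and is enlarged using 2^p >= 1. *)
  have h1 := powR_dist_le (f x) (c v) (f y) (ltW p0).
  have h2 := powR_dist_le (c v) (c w) (f y) (ltW p0).
  rewrite (distrC (c w)) in h2; have := powR_ge0 `|f x - c v| p.
  have e0 : 0 <= 2 `^ p :> R by exact: le_trans ler01 e2.
  move=> X0; have h3 := ler_wpM2l e0 h2; have h4 := ler_wpM2r (mulr_ge0 e0 X0) e2.
  apply: le_trans h1 _; rewrite mulrDr.
  by move: h3 h4; lra.
under eq_bigr do rewrite (integral_core_affine mf k0 (T0 _) (t0 _) (AE _)).
rewrite sumEFin lee_fin -mulr_sumr ler_wpM2l//.
have i0 : 0 <= (N ^+ n)^-1 by rewrite invr_ge0 ltW.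
have s1 : \sum_v t v * A v <= (3 ^ D)%:R * (N ^+ n)^-1 * B.
  apply: (@le_trans _ _ (\sum_v (3 ^ D)%:R * (N ^+ n)^-1 * A v)).
    by apply: ler_sum => v _; rewrite ler_wpM2r// ler_wpM2r// near_count_le.
  by rewrite -mulr_sumr ler_wpM2l// mulr_ge0.
have s2 : \sum_(v : word S n) \sum_(w : word S n | nearL 1 v w) A w <= (3 ^ D)%:R * B.
  rewrite (exchange_big_dep xpredT)//=.
  apply: (@le_trans _ _ (\sum_w (3 ^ D)%:R * A w)); last by rewrite -mulr_sumr ler_wpM2l.
  apply: ler_sum => w _; under eq_bigl do rewrite nearL_sym.
  by rewrite near_sum_cst ler_wpM2r// near_count_le.
rewrite big_split /= -mulr_sumr /T.
rewrite [X in _ * X](_ : _ = (N ^+ n)^-1 * edge_energy K p n c +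
    \sum_(v : word S n) \sum_(w : word S n | nearL 1 v w) A w); last first.
  rewrite -near_edge_energy mulr_sumr -big_split /=; apply: eq_bigr => v _.
  by rewrite mulr_sumr -big_split.
have : (N ^+ n)^-1 * \sum_(v : word S n) \sum_(w : word S n | nearL 1 v w) A w <= (N ^+ n)^-1 * ((3 ^ D)%:R * B).
  by rewrite ler_wpM2l.
lra.
Qed.

(** Jensen's inequality is applied twice: for fixed x it replaces f(y) by the average over the cell
    w, and then f(x) by the average over v. At most (2L + 1)^D cells of level n meet the ball, which
    bounds its measure from above. *)
Lemma korevaar_schoen_ge n L (r b : R) f : mu.-integrable setT (EFin \o f) ->
  0 < r -> 2 / a%:R ^+ n < r -> D%:R * r * a%:R ^+ n <= L%:R ->
  (((((2 * L).+1 ^ D)%:R * r `^ b)^-1 * (N ^+ n)^-1 * edge_energy K p n (@mean R D a S K mu f))%:E <=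
    korevaar_schoen K mu p b f r)%E.
Proof.
move=> fi r0 rn rL.
have mf : mT f by apply/measurable_EFinP; exact: measurable_int fi.
pose M := @mean R D a S K mu f.
have rb0 : 0 < r `^ b by exact: powR_gt0.
set q := ((2 * L).+1 ^ D)%:R : R.
have q0 : 0 < q by rewrite ltr0n expn_gt0.
have k0 : 0 <= (q * r `^ b)^-1 by rewrite invr_ge0 mulr_ge0// ltW.
have mg c : mT (fun x => (`|f x - c| `^ p)%:E).
  apply: (measurable_normpow p (g := fun y => f y - c)).
  by apply: measurable_funB => //; exact: measurable_cst.
have msum (v : word S n) : mT (fun x => \sum_(w : word S n | nearL 1 v w) (`|f x - M w| `^ p)%:E)%E.
  pose h (w : word S n) (x : borelRV R D) := if nearL 1 v w then (`|f x - M w| `^ p)%:E else 0%E.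
  rewrite (_ : (fun _ => _) = fun x => (\sum_(w : word S n) h w x)%E).
    by apply: emeasurable_sum => w; rewrite /h; case: (nearL 1 v w); [exact: mg|exact: measurable_cst].
  by apply/funext => x; rewrite big_mkcond.
have g0 c x : (0 <= (`|f x - c| `^ p)%:E)%E by rewrite lee_fin powR_ge0.
pose H (v : word S n) (x : borelRV R D) :=
  ((q * r `^ b)^-1%:E * \sum_(w : word S n | nearL 1 v w) (`|f x - M w| `^ p)%:E)%E.
apply: (@le_trans _ _ (\sum_(v : word S n) \int[mu]_(x in core v) H v x)%E); last first.
  apply: integral_ge_cores.
  - move=> x Kx; rewrite mule_ge0// ?lee_fin ?invr_ge0 ?fine_ge0//.
    by apply: integral_ge0 => y _; rewrite lee_fin divr_ge0 ?powR_ge0.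
  - move=> v; apply: emeasurable_funM; first exact: measurable_cst.
    by exact: msum.
  - by move=> v x; rewrite mule_ge0// sume_ge0.
  move=> v x vx.
  have mh : mT (fun y => (`|f x - f y| `^ p / r `^ b)%:E).
    apply/measurable_EFinP; apply: measurable_funM; last exact: measurable_cst.
    apply/measurable_EFinP; apply: (measurable_normpow p (g := fun y => f x - f y)).
    by apply: measurable_funB => //; exact: measurable_cst.
  have h0 y : (0 <= (`|f x - f y| `^ p / r `^ b)%:E)%E by rewrite lee_fin divr_ge0 ?powR_ge0.
  have muB : 0 < fine (mu (Bd K x r)).
    apply: (@lt_le_trans _ _ (N ^+ n)^-1); first by rewrite invr_gt0.
    rewrite -lee_fin fineK; last by apply: fin_num_measure; exact: measurable_ball.
    have := mu_core hK hmu v; rewrite size_tuple => <-.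
    apply: le_measure; rewrite ?inE; [exact: (measurable_core hK)|exact: measurable_ball|].
    by move=> y [vy _]; exact: (near_sub_ball vx (nearL_refl 1 v) rn).
  apply: (@le_trans _ _ ((N ^+ n / q)%:E * \sum_(w : word S n | nearL 1 v w) ((r `^ b)^-1 * (N ^+ n)^-1 * `|f x - M w| `^ p)%:E)%E).
    rewrite /H !sumEFin -!EFinM lee_fin -!mulr_sumr invfM.
    rewrite le_eqVlt; apply/orP; left; apply/eqP; field.
    by rewrite !gt_eqF.
  apply: lee_pmul.
  - by rewrite lee_fin divr_ge0// ltW.
  - apply: sume_ge0 => w _; rewrite lee_fin !mulr_ge0 ?powR_ge0// invr_ge0 ltW//.
  - rewrite lee_fin -[leLHS]invrK lef_pV2 ?posrE ?invr_gt0 ?divr_gt0// invf_div.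
    exact: (@mu_ball_le n L v).
  apply: le_trans (ball_integral_ge vx rn mh h0); apply: lee_sum => w _.
  rewrite -mulrA EFinM (_ : (\int[mu]_(y in core w) (`|f x - f y| `^ p / r `^ b)%:E)%E
     = ((r `^ b)^-1%:E * \int[mu]_(y in core w) (`|f y - f x| `^ p)%:E)%E); last first.
    rewrite -ge0_integralZl//; first last.
    - by rewrite lee_fin invr_ge0 ltW.
    - by apply: measurable_funTS; exact: mg.
    - exact: (measurable_core hK).
    by apply: eq_integral => y _; rewrite -EFinM distrC mulrC.
  apply: lee_wpmul2l; first by rewrite lee_fin invr_ge0 ltW.
  have := mean_jensen hK hmu fi w (f x) p1; rewrite size_tuple distrC => h.
  by rewrite mulrC EFinM lee_pdivrMr// muleC.
rewrite -near_edge_energy -mulrA mulr_sumr mulr_sumr -sumEFin; apply: lee_sum => v _.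
have mv := measurable_core hK v.
rewrite ge0_integralZl//; first last.
- by move=> x _; rewrite sume_ge0.
- by apply: measurable_funTS; exact: msum.
rewrite EFinM; apply: lee_wpmul2l => //.
under eq_integral do rewrite -big_filter.
rewrite (ge0_integral_sum mu mv) => [|w|w x _]; last 2 first.
- by apply: measurable_funTS; exact: mg.
- exact: g0.
rewrite big_filter.
rewrite mulr_sumr -sumEFin; apply: lee_sum => w _.
have := mean_jensen hK hmu fi v (M w) p1; rewrite size_tuple => h.
by rewrite mulrC EFinM lee_pdivrMr// muleC.
Qed.

End KorevaarSchoen.

(** * The two inclusions *)

Section Characterization.
Context (R : realType) (D a : nat) (S : {set multi_index D a})
  (K : set 'rV[R]_D) (mu : probability (borelRV R D) R)
  (hK : gen_carpet S K) (hmu : self_similar S K mu) (p : R) (p1 : 1 < p).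

Local Notation N := (#|S|%:R : R).
Local Notation step := (step K).
Local Notation avg := (@mean R D a S K mu).
Local Notation mT := (measurable_fun [set: borelRV R D]).
Local Notation EE := (@edge_energy R D a S K p).
Implicit Types (f : borelRV R D -> R).

Let N0 : 0 < N. Proof. by rewrite ltr0n (card_letters_gt0 hK). Qed.
Let Nn0 n : 0 < N ^+ n. Proof. by rewrite exprn_gt0. Qed.
Let D0 : 0 < D%:R :> R. Proof. by rewrite ltr0n; have := carpet_dim hK; lia. Qed.
Let a1 : 1 < a%:R :> R. Proof. by rewrite ltr1n (carpet_a_gt1 hK). Qed.
Let a0 : 0 < a%:R :> R. Proof. exact: lt_trans ltr01 a1. Qed.
Let An0 n : 0 < (a%:R : R) ^+ n := apow_gt0 hK n.
Let p0 : 0 < p. Proof. exact: lt_trans ltr01 p1. Qed.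
Let pn0 : p != 0. Proof. exact: lt0r_neq0. Qed.

Lemma Lfun_integrable_Lp f : f \in Lfun mu p%:E ->
  [/\ mT f, mu.-integrable setT (EFin \o f) & (Lp mu p f < +oo)%E].
Proof.
move=> fL; split.
- by have := sub_Lfun_mfun fL; rewrite inE.
- apply/Lfun1_integrable; apply: Lfun_subset fL; rewrite ?lee_fin ?(ltW p1)//.
  by rewrite fin_num_measure.
- have /integrableP[_] := Lfun_integrable (ltW p1) fL.
  by under eq_integral do rewrite gee0_abs ?lee_fin ?powR_ge0//.
Qed.

Lemma apow_powR (b : R) n : (a%:R ^+ n) `^ b = (a%:R `^ b) ^+ n.
Proof. by rewrite -powR_mulrn ?(ltW a0)// -powRrM mulrC powRrM powR_mulrn ?powR_ge0. Qed.

Lemma apow_beta : 0 < rho_exp S K p -> a%:R `^ beta_exp S K p = N * rho_exp S K p.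
Proof.
move=> r0; rewrite /powR gt_eqF// /beta_exp divfK ?gt_eqF ?ln_gt0//.
by rewrite lnK// posrE mulr_gt0.
Qed.

Lemma scale_exists (r : R) : 0 < r -> D%:R * r * a%:R <= 1 ->
  exists n, [/\ (0 < n)%N, D%:R * r * a%:R ^+ n <= 1 & 1 < D%:R * r * a%:R ^+ n.+1].
Proof.
move=> r0 hr.
have ex : exists n, 1 < D%:R * r * a%:R ^+ n.
  have [n hn] := apow_small hK (mulr_gt0 (mulr_gt0 D0 r0) (ltr0Sn R 1)).
  exists n; move: hn; rewrite ltr_pdivrMr// => hn.
  by rewrite -(ltr_pM2r (ltr0Sn R 1)) mul1r mulrAC.
(* The least exponent beyond the threshold is at least 2 by [hr], so its predecessor is a positive
   level. *)
case: (ex_minnP ex) => -[|[|n]] h1 hmin.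
- move: h1; rewrite expr0 mulr1 => h1.
  have := lt_le_trans h1 (ler_peMr (ltW (mulr_gt0 D0 r0)) (ltW a1)).
  by rewrite ltNge hr.
- by move: h1; rewrite expr1 ltNge hr.
exists n.+1; split => //; by rewrite leNgt; apply/negP => /hmin; rewrite ltnn.
Qed.

(** At a radius of order a^-n the factor r^-b is of order th^-n and cancels the decay of both error
    terms. The parameters b, th and c are left free so that the case rho = 0 is covered too, by th =
    1 and c = 0. *)
Lemma korevaar_schoen_bounded (b th C M : R) f (c : nat -> seq (letter S) -> R) :
  mT f -> 0 < th -> 0 <= C -> 0 <= M -> 0 <= b -> a%:R `^ b * th = 1 ->
  (forall n, (0 < n)%N -> (Lp mu p (f \- step n (c n))%R <= (C * th ^+ n)%:E)%E) ->
  (forall n, (0 < n)%N -> (N ^+ n)^-1 * EE n (c n) <= M * th ^+ n) ->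
  exists Q : R, forall r, 0 < r -> D%:R * r * a%:R <= 1 ->
    (korevaar_schoen K mu p b f r <= Q%:E)%E.
Proof.
move=> mf th0 C0 M0 b0 ab hC hM.
exists (N ^+ D.+1 * (2 `^ p * 2 `^ p) * (D%:R `^ b * a%:R `^ b) * (2 * (3 ^ D)%:R * C + M)).
move=> r r0 hr; have [n [n0 h1 h2]] := scale_exists r0 hr.
(* This is why D + 1 extra levels are used: 1 < D r a^(n+1) and D <= a^D. *)
have rm : (a%:R ^+ (n + D.+1))^-1 < r.
  have Da : D%:R <= a%:R ^+ D :> R.
    by rewrite -natrX ler_nat; apply/ltnW/ltn_expl; exact: carpet_a_gt1 hK.
  rewrite -div1r ltr_pdivrMr// addnS -addSn exprD; apply: lt_le_trans h2 _.
  by rewrite -mulrA mulrC [leRHS]mulrA ler_pM2l// mulr_gt0.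
apply: le_trans (korevaar_schoen_le hK hmu p1 b mf r0 h1 rm (hC n n0)) _.
have rb : (r `^ b)^-1 <= D%:R `^ b * (a%:R `^ b) ^+ n.+1.
  rewrite -apow_powR -powRM ?(ltW D0) ?(ltW (An0 _))//.
  rewrite -[leRHS]invrK lef_pV2 ?posrE ?invr_gt0 ?powR_gt0 ?mulr_gt0//.
  rewrite -powR_inv1 ?powR_ge0// powRAC.
  apply: ge0_ler_powR; rewrite ?nnegrE ?powR_ge0 ?(ltW r0)//.
  rewrite powR_inv1; last by rewrite mulr_ge0// ltW.
  by rewrite -div1r ler_pdivrMr ?mulr_gt0// mulrCA mulrA ltW.
have E0 := edge_energy_ge0 K p n (c n).
have i0 : 0 <= (N ^+ n)^-1 by rewrite invr_ge0 ltW.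
set t := 2 `^ p * 2 `^ p; have t0 : 0 <= t by rewrite mulr_ge0 ?powR_ge0.
set A := a%:R `^ b in ab rb *; set B := D%:R `^ b in rb *.
have G : N ^+ (n + D.+1) * (t / r `^ b) <= N ^+ n * N ^+ D.+1 * (t * (B * A ^+ n.+1)).
  by rewrite exprD ler_wpM2l ?mulr_ge0 ?(ltW (Nn0 _))// ler_wpM2l.
have F : 2 * (3 ^ D)%:R * (N ^+ n)^-1 * (C * th ^+ n) + (N ^+ n)^-1 * (N ^+ n)^-1 * EE n (c n)
    <= (N ^+ n)^-1 * th ^+ n * (2 * (3 ^ D)%:R * C + M).
  have := ler_wpM2l i0 (hM n n0); rewrite mulrA.
  move: (EE n (c n)) (N ^+ n)^-1 (th ^+ n) ((3 ^ D)%:R : R) => e i u d h; lra.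
rewrite lee_fin; apply: le_trans (ler_pM _ _ G F) _.
- by rewrite mulr_ge0 ?mulr_ge0 ?invr_ge0 ?powR_ge0// ltW.
- by rewrite addr_ge0// !mulr_ge0// exprn_ge0// ltW.
rewrite le_eqVlt; apply/orP; left; apply/eqP.
have e : A ^+ n * th ^+ n = 1 by rewrite -exprMn ab expr1n.
rewrite -[RHS]mulr1 -[X in _ = _ * X]e (exprSr A n); field.
by rewrite gt_eqF.
Qed.

Lemma mean_increments_geometric (th M : R) f : mu.-integrable setT (EFin \o f) ->
  0 < th -> th < 1 -> 0 <= M ->
  (forall n, (0 < n)%N -> (N ^+ n)^-1 * EE n (avg f) <= M * th ^+ n) ->
  exists2 C : R, 0 <= C & forall n k,
    (Lp mu p (step (n + k) (avg f) \- step n (avg f))%R <= (C * th ^+ n)%:E)%E.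
Proof.
move=> fi th0 th1 M0 hM.
set m := avg f in hM *.
pose q := th `^ p^-1; pose B := (N `^ p * N * M) `^ p^-1.
have q0 : 0 < q by exact: powR_gt0.
have qp : q `^ p = th by rewrite /q -powRrM mulVf// powRr1// ltW.
have q1 : q < 1.
  rewrite ltNge; apply/negP => q1; have : (1 : R) `^ p <= q `^ p.
    by apply: powR_le_nneg => //; exact: ltW.
  by rewrite powR1 qp leNgt th1.
have k0 : 0 <= N `^ p * N * M by rewrite !mulr_ge0 ?powR_ge0.
have Bp : B `^ p = N `^ p * N * M by rewrite /B -powRrM mulVf// powRr1.
have B0 : 0 <= B by exact: powR_ge0.
have qn n : (q ^+ n) `^ p = th ^+ n.
  by rewrite -powR_mulrn ?(ltW q0)// powRAC qp powR_mulrn// ltW.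
have qn0 n : 0 <= q ^+ n by rewrite exprn_ge0// ltW.
have ms n := measurable_step hK n m.
have inc n : (Lp mu p (step n.+1 m \- step n m)%R <= ((B * q ^+ n.+1) `^ p)%:E)%E.
  apply: le_trans (Lp_increment hK hmu p1 fi n) _; rewrite lee_fin.
  rewrite powRM// Bp qn -!mulrA ler_wpM2l ?powR_ge0// ler_wpM2l ?(ltW N0)//.
  exact: hM.
have c0 : 0 < 1 - q by rewrite subr_gt0.
(* The norms of the increments have ratio q = th^(1/p); the closed form of the partial geometric sum
   is what makes the induction close. *)
have tel n k : (Lp mu p (step (n + k) m \- step n m)%R <=
    ((B * q ^+ n.+1 * (1 - q ^+ k) / (1 - q)) `^ p)%:E)%E.
  elim: k => [|k IH].
    rewrite addn0 expr0 subrr mulr0 mul0r powR0// (_ : _ \- _ = cst 0); last first.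
      by apply/funext => x /=; rewrite subrr.
    by rewrite (Lp_cst mu p) normr0 powR0.
  rewrite addnS (_ : _ \- _ = (step (n + k).+1 m \- step (n + k) m) \+
      (step (n + k) m \- step n m)); last by apply/funext => x /=; ring.
  rewrite (_ : B * _ * _ / _ = B * q ^+ (n + k).+1 + B * q ^+ n.+1 * (1 - q ^+ k) / (1 - q)).
    apply: (Lp_minkowski p1) => //; try exact: measurable_funB.
      by rewrite mulr_ge0.
    rewrite !mulr_ge0 ?invr_ge0 ?(ltW c0)// subr_ge0.
    by rewrite exprn_ile1// ?(ltW q0)// ltW.
  by rewrite -addSn exprD (exprSr q k); field; rewrite gt_eqF.
exists ((B / (1 - q)) `^ p) => [|n k]; first exact: powR_ge0.
apply: le_trans (tel n k) _; rewrite lee_fin -qn -powRM ?divr_ge0 ?(ltW c0)//.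
apply: powR_le_nneg; first exact: ltW.
  by rewrite !mulr_ge0 ?invr_ge0 ?(ltW c0)// subr_ge0 exprn_ile1// ?(ltW q0)// ltW.
rewrite (_ : _ / _ = B / (1 - q) * q ^+ n * (q * (1 - q ^+ k))); last first.
  by rewrite (exprSr q n); field; rewrite gt_eqF.
rewrite ler_piMr ?mulr_ge0 ?invr_ge0 ?(ltW c0)//.
have : q * (1 - q ^+ k) <= 1 * 1.
  apply: ler_pM => //; rewrite ?(ltW q0) ?(ltW q1)// ?subr_ge0 ?lerBlDr ?lerDl//.
  by rewrite exprn_ile1// ?(ltW q0)// ltW.
by rewrite mul1r.
Qed.

(** For each n, some later level n + l approximates f within th^n. How large l must be is unknown,
    but the bound on the increments is uniform in l. *)
Lemma mean_approx_geometric (th M : R) f :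
  mu.-integrable setT (EFin \o f) -> (Lp mu p f < +oo)%E ->
  0 < th -> th < 1 -> 0 <= M ->
  (forall n, (0 < n)%N -> (N ^+ n)^-1 * EE n (avg f) <= M * th ^+ n) ->
  exists2 C : R, 0 <= C & forall n,
    (Lp mu p (f \- step n (avg f))%R <= (C * th ^+ n)%:E)%E.
Proof.
move=> fi ffin th0 th1 M0 hM.
have [C C0 hC] := mean_increments_geometric fi th0 th1 M0 hM.
have mf : mT f by apply/measurable_EFinP; exact: measurable_int fi.
have ms n := measurable_step hK n (avg f).
exists (2 `^ p * (1 + C)) => [|n]; first by rewrite mulr_ge0 ?powR_ge0// addr_ge0.
have [l hl] := Lp_sub_mean_small hK hmu p1 fi ffin (exprn_gt0 n th0).
rewrite (_ : f \- _ = (f \- step (n + l) (avg f)) \+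
    (step (n + l) (avg f) \- step n (avg f))); last first.
  by apply/funext => x /=; ring.
have mA := measurable_funB mf (ms (n + l)%N).
have mB := measurable_funB (ms (n + l)%N) (ms n).
apply: (le_trans (LpD_le mu p1 mA mB)).
rewrite -mulrA EFinM; apply: lee_wpmul2l; first by rewrite lee_fin powR_ge0.
rewrite mulrDl mul1r EFinD; apply: leeD; last exact: hC.
by apply: hl; exact: leq_addl.
Qed.

Lemma korevaar_schoen_limf (b Q : R) f :
  (forall r, 0 < r -> D%:R * r * a%:R <= 1 -> (korevaar_schoen K mu p b f r <= Q%:E)%E) ->
  (limf_esup (korevaar_schoen K mu p b f) 0^'+ < +oo)%E.
Proof.
move=> h; apply: le_lt_trans (ltry Q).
pose V : set R := [set r | 0 < r /\ D%:R * r * a%:R <= 1].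
apply: (@le_trans _ _ (ereal_sup (korevaar_schoen K mu p b f @` V))).
  apply: ereal_inf_lbound; exists V => //; near=> r; split => //.
  rewrite mulrAC -ler_pdivlMl ?mulr_gt0// mulr1.
  near: r; apply: nbhs_right_le; rewrite invr_gt0; exact: mulr_gt0.
by apply: ge_ereal_sup => _ [r [r0 rV] <-]; exact: h.
Unshelve. all: by end_near. Qed.

Lemma Fp_korevaar_schoen f : Fp S K mu p f ->
  (limf_esup (korevaar_schoen K mu p (beta_exp S K p) f) 0^'+ < +oo)%E.
Proof.
move=> [fL supfin]; have [mf fi ffin] := Lfun_integrable_Lp fL.
have [rho0|rho1] := rho_exp_gt hK p0.
  (* Since ln 0 is 0 by convention, the exponent vanishes. Comparison with the zero step functions
     at ratio 1 then bounds the integrals by the L^p norm alone. *)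
  have b0 : beta_exp S K p = 0 by rewrite /beta_exp rho0 mulr0 ln0// mul0r.
  have E0 n : EE n (fun=> 0) = 0.
    by apply: big1 => u _; rewrite subrr normr0 powR0.
  have s0 n : step n (fun=> 0) = cst 0.
    by apply/funext => x; rewrite /step big1// => w _; rewrite mul0r.
  have [||||||||Q hQ] := @korevaar_schoen_bounded (beta_exp S K p) 1 (fine (Lp mu p f)) 0 f
      (fun _ _ => 0).
  - exact: mf.
  - exact: ltr01.
  - by apply: fine_ge0; exact: Lp_ge0.
  - exact: lexx.
  - by rewrite b0.
  - by rewrite b0 powRr0 mulr1.
  - move=> n _; rewrite s0 expr1n mulr1 fineK; last first.
      by rewrite ge0_fin_numE// Lp_ge0.
    by rewrite (_ : f \- cst 0 = f)//; apply/funext => x /=; rewrite subr0.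
  - by move=> n _; rewrite E0 mulr0 mul0r.
  exact: korevaar_schoen_limf hQ.
have r0 : 0 < rho_exp S K p by rewrite -(pmulr_rgt0 _ N0); exact: lt_trans ltr01 rho1.
set rho := rho_exp S K p in supfin rho1 r0.
have [M hM] : exists M : R, forall n, (0 < n)%N -> rho ^+ n * EE n (avg f) <= M.
  move: supfin; set s := ereal_sup _ => sfin.
  have s0 : (0 <= s)%E.
    apply: (@le_trans _ _ (rho ^+ 1 * energy p (cell_rel K (n := 1)) (@Mn R D a S K mu 1 f))%:E).
      by rewrite lee_fin energy_Mn mulr_ge0 ?expr1 ?(ltW r0)// mulr_ge0 ?edge_energy_ge0// invr_ge0.
    by apply: ereal_sup_ubound; exists 1%N.
  exists (2 * fine s) => n n0.
  suff : rho ^+ n * (2^-1 * EE n (avg f)) <= fine s.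
    by rewrite mulrCA ler_pdivrMl.
  rewrite -lee_fin fineK; last by rewrite ge0_fin_numE.
  by apply: ereal_sup_ubound; exists n; [exact: n0|rewrite energy_Mn].
have M0 : 0 <= M.
  apply: le_trans (hM 1%N isT); by rewrite mulr_ge0 ?edge_energy_ge0// exprn_ge0// ltW.
(* With this ratio, a bound M on rho^n times the energy becomes the bound M th^n on N^-n times the
   energy. *)
pose th := (N * rho)^-1.
have th0 : 0 < th by rewrite invr_gt0 mulr_gt0.
have th1 : th < 1 by rewrite invf_lt1// mulr_gt0.
have {}hM n : (0 < n)%N -> (N ^+ n)^-1 * EE n (avg f) <= M * th ^+ n.
  move=> n0; rewrite /th exprVn exprMn invfM mulrCA ler_wpM2l ?invr_ge0 ?(ltW (Nn0 n))//.
  by rewrite -ler_pdivrMr ?invr_gt0 ?exprn_gt0// invrK mulrC; exact: hM.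
have [C C0 hC] := mean_approx_geometric fi ffin th0 th1 M0 hM.
have b0 : 0 <= beta_exp S K p.
  by rewrite divr_ge0 ?ln_ge0 ?(ltW a1) ?(ltW rho1).
have [||||||||Q hQ] := @korevaar_schoen_bounded (beta_exp S K p) th C M f (fun=> avg f) => //.
  by rewrite apow_beta// mulfV// gt_eqF// mulr_gt0.
exact: korevaar_schoen_limf hQ.
Qed.

Lemma korevaar_schoen_Fp f : f \in Lfun mu p%:E ->
  (limf_esup (korevaar_schoen K mu p (beta_exp S K p) f) 0^'+ < +oo)%E ->
  Fp S K mu p f.
Proof.
move=> fL lfin; split=> //; have [mf fi ffin] := Lfun_integrable_Lp fL.
have [rho0|rho1] := rho_exp_gt hK p0.
  (* The supremum runs over n >= 1, where rho^n = 0. *)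
  apply: le_lt_trans (ltry 0); apply: ge_ereal_sup => _ [n n0 <-].
  by rewrite rho0 expr0n -[n == 0%N]negbK -lt0n n0 mul0r.
have r0 : 0 < rho_exp S K p by rewrite -(pmulr_rgt0 _ N0); exact: lt_trans ltr01 rho1.
set rho := rho_exp S K p in rho1 r0 *.
set b := beta_exp S K p in lfin.
(* A finite upper limit gives a right neighbourhood of 0 on which the integrals have a finite
   supremum. *)
move: lfin; rewrite limf_esupE => /ereal_inf_lt[_ [V hV <-] supV].
have [e e0 eV] : exists2 e : R, 0 < e & forall r, 0 < r -> r < e -> V r.
  move: hV => [e /= e0 he]; exists e => // r rpos re; apply: he => //.
  by rewrite /ball /= sub0r normrN gtr0_norm.
have [n0 hn0] := apow_small hK (divr_gt0 e0 (ltr0Sn R 1)).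
have an0 : 3 / a%:R ^+ n0 < e.
  by move: hn0; rewrite ltr_pdivlMr// => /(le_lt_trans _); apply; rewrite mulrAC ler_pM2r ?invr_gt0//; lra.
set s := ereal_sup _ in supV.
have KS0 (r : R) : (0 <= korevaar_schoen K mu p b f r)%E.
  apply: integral_ge0 => x _; rewrite mule_ge0 ?lee_fin ?invr_ge0 ?fine_ge0//.
  by apply: integral_ge0 => y _; rewrite lee_fin divr_ge0 ?powR_ge0.
have leV (r : R) : 0 < r -> r < e -> (korevaar_schoen K mu p b f r <= s)%E.
  by move=> rpos re; apply: ereal_sup_ubound; exists r => //; exact: eV.
have s0 : (0 <= s)%E.
  by apply: le_trans (leV (e / 2) _ _); [exact: KS0|rewrite divr_gt0|rewrite ltr_pdivrMr//; lra].
have [v sE] : exists v : R, s = v%:E by exists (fine s); rewrite fineK// ge0_fin_numE.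
rewrite sE lee_fin in s0.
have term0 n : 0 <= rho ^+ n * EE n (avg f).
  by rewrite mulr_ge0 ?edge_energy_ge0// exprn_ge0// ltW.
(* The radius 3 a^-n exceeds the 2 a^-n of [near_sub_ball], and D r a^n = 3 D, so a ball reaches at
   most 3 D cells in each direction. *)
pose q := ((2 * (3 * D)).+1 ^ D)%:R : R.
have q0 : 0 < q by rewrite ltr0n expn_gt0.
have large n : (n0 <= n)%N -> rho ^+ n * EE n (avg f) <= v * q * 3 `^ b.
  move=> n0n; pose r := 3 / a%:R ^+ n : R.
  have rpos : 0 < r by rewrite divr_gt0.
  have re : r < e.
    apply: le_lt_trans an0; rewrite ler_pM2l// lef_pV2 ?posrE//.
    by rewrite ler_eXn2l.
  have r2 : 2 / a%:R ^+ n < r by rewrite ltr_pM2r ?invr_gt0// ltr_nat.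
  have rL : D%:R * r * a%:R ^+ n <= (3 * D)%:R.
    by rewrite /r mulrA divfK ?gt_eqF// natrM mulrC.
  have := le_trans (korevaar_schoen_ge hK hmu p1 b fi rpos r2 rL) (leV r rpos re).
  rewrite sE lee_fin -/q => h.
  have rb : r `^ b = 3 `^ b / (N * rho) ^+ n.
    rewrite powRM// ?invr_ge0 ?(ltW (An0 n))// -apow_beta// -apow_powR.
    rewrite -powR_inv1 ?(ltW (An0 n))// powRAC powR_inv1// powR_ge0//.
  have b30 : 0 < 3 `^ b :> R by exact: powR_gt0.
  have nr0 : 0 < (N * rho) ^+ n by rewrite exprn_gt0// mulr_gt0.
  have pos : 0 < q * (3 `^ b / (N * rho) ^+ n) * N ^+ n by rewrite !mulr_gt0 ?invr_gt0.
  move: h; rewrite rb -invfM mulrC ler_pdivrMr// => h.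
  have := ler_wpM2l (exprn_ge0 n (ltW r0)) h; move/le_trans; apply.
  rewrite le_eqVlt; apply/orP; left; apply/eqP; rewrite exprMn; field.
  by rewrite !gt_eqF// exprn_gt0.
(* The upper limit gives no information on the levels below n0; their energies enter as a finite
   sum. *)
pose Q := v * q * 3 `^ b + \sum_(i < n0) rho ^+ i * EE i (avg f).
have Q1 : 0 <= v * q * 3 `^ b by rewrite !mulr_ge0 ?s0 ?powR_ge0// ltW.
have all_n n : rho ^+ n * EE n (avg f) <= Q.
  have [/large h|h] := leqP n0 n.
    by apply: le_trans h _; rewrite lerDl sumr_ge0.
  rewrite /Q (bigD1 (Ordinal h))//= addrCA lerDl addr_ge0// sumr_ge0//.
apply: le_lt_trans (ltry Q); apply: ge_ereal_sup => _ [n _ <-].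
rewrite lee_fin energy_Mn; apply: le_trans (all_n n).
rewrite mulrCA -[leRHS]mul1r ler_wpM2r//; lra.
Qed.

End Characterization.

Theorem theorem2p22 (R : realType) (D a : nat) (S : {set multi_index D a})
    (K : set 'rV[R]_D) (mu : probability (borelRV R D) R) (p : R)
    (hK : gen_carpet S K)
    (hmu : self_similar S K mu)
    (hp : (dimARC (@dcarpet_on R D K) < p%:E)%E) :
  Fp S K mu p =
  [set f : borelRV R D -> R | f \in Lfun mu p%:E /\
    (limf_esup (korevaar_schoen K mu p (beta_exp S K p) f) 0^'+ < +oo)%E].
Proof.
have p1 := gt_dimARC_gt1 hK hp.
apply/seteqP; split => f.
  by move=> fF; split; [case: fF|exact: (Fp_korevaar_schoen hK hmu p1 fF)].
by move=> [fL ffin]; exact: (korevaar_schoen_Fp hK hmu p1 fL ffin).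
Qed.
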